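(* For $c,d\ge0$, the generalised Mirzakhani volume of the moduli space $\mathcal M_{\mathbb A_1}(c|d)$ of flippered $1$-crowns with neck length $d$ and strap length $c$ is \[ V_{\mathbb A_1}(c|d)=\frac{1}{\sqrt{2\cosh c+2\cosh d}} . \]
   Context: **Flippered crowns.** $\mathbb A_n$ ($n\ge1$) is the closed disk with $n$ cyclically ordered labelled boundary points $q_1,\dots,q_n$ and one interior point $p_1$ removed. A flippered surface $X$ of type $\mathbb A_n$ is $\mathbb A_n$ with a complete hyperbolic metric whose boundary components are bi-infinite geodesics, called arches $\alpha_1,\dots,\alpha_n$. Each $q_j$ is either a tine (its two adjacent arch ends are asymptotic; strap length $0$) or a flipper (a half-funnel); in the latter case the $j$-th strap $\sigma_j$ is the geodesic segment which cuts off the flipper and is orthogonal to the adjacent arches, and the strap length is its length. The puncture $p_1$ is a cusp (neck length $0$) or a funnel bounded by a simple closed geodesic, whose length is the neck length. $X$ is crowned if all strap lengths are $0$. $\mathcal M_{\mathbb A_n}(\vec c)$ is the space of (label- and orientation-preserving) isometry classes of such $X$ with strap lengths $\vec c$, and $\mathcal M_{\mathbb A_n}(\vec c\,|d)$ is the subspace with neck length $d$; for $n=1$ the latter is a single point. **Action.** An orthojectory on $X$ is an inextensible oriented geodesic starting orthogonally at a point of $\partial X$ (its base point). It is peripheral if it can be properly homotoped (endpoints moving in $\partial X$) arbitrarily deeply into a flipper or tine, and essential otherwise. $\mathbb I_i\subset\alpha_i$ is the smallest closed interval containing all base points of essential orthojectories starting on $\alpha_i$. The generalised Chekhov action is $S(X)=\frac12\sum_{i=1}^n\ell(\mathbb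 I_i)+\sum_{i=1}^n\log\cosh(c_i/2)$, with $c_i$ the strap lengths of $X$. **Volume form.** Put $\mathcal A=\{j:c_j>0\}$ and let $\dot{\mathbb A}_n(\mathcal A)$ be $\mathbb A_n$ with each $q_j$, $j\in\mathcal A$, replaced by two adjacent boundary punctures. For a flippered surface $X$ whose strap lengths are positive exactly at $j\in\mathcal A$, removing from each flipper the largest open half-plane contained in it gives a crowned surface $\mathrm{Clip}(X)$ of type $\dot{\mathbb A}_n(\mathcal A)$. Choose an ideal triangulation of $\dot{\mathbb A}_n(\mathcal A)$ (a maximal collection of pairwise disjoint, non-isotopic essential arcs ending at punctures, none isotopic to an arch), realise it by geodesics (spiralling in a fixed direction if the interior puncture is a funnel), and let $s_1,\dots,s_N$ be the shearing coordinates of $\mathrm{Clip}(X)$ (signed distances between the feet of the perpendiculars dropped on an arc from the opposite ideal vertices of its two adjacent ideal triangles, left shears positive). Then $\Omega^{\mathrm{WP}}(\vec c)$ is the top-degree form on $\mathcal M_{\mathbb A_n}(\vec c)$ with $\bigwedge_i ds_i=\pm\bigwedge_{j\in\mathcal A}d\bigl(2\log\sinh\tfrac{\ell(\sigma_j)}2\bigr)\wedge\Omega^{\mathrm{WP}}(\vec c)$, and $\Omega^{\mathrm{WP}}(\vec c\,|d)$ is the top-degree form on $\mathcal M_{\mathbb A_n}(\vec c\,|d)$ with $\Omega^{\mathrm{WP}}(\vec c)=\pm\, d(\text{neck length})\wedge\Omega^{\mathrm{WP}}(\vec c\,|d)$. These do not depend on the triangulation up to sign; signs are chosen so that volumes are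 positive (for $n=1$, $\Omega^{\mathrm{WP}}(c|d)$ is a positive number). **Volume.** $V_{\mathbb A_n}(\vec c\,|d)=\int_{\mathcal M_{\mathbb A_n}(\vec c|d)}e^{-S}\,\Omega^{\mathrm{WP}}(\vec c\,|d)$. *)

(* Defs.v *)
From Stdlib Require Import Reals ZArith.
From Coquelicot Require Import Coquelicot.

Open Scope R_scope.

(** * The hyperbolic plane

    Upper half-plane model: points are complex numbers [z] with [0 < Im z],
    with the standard orientation.  The ideal boundary is [option R], [None]
    being the point at infinity. *)

Record SL2 : Set := mkSL2 {
  ma : R; mb : R; mc : R; md : R;
  sl2_det : ma * md - mb * mc = 1 }.

Lemma sl2_mul_det (g h : SL2) :
  (ma g * ma h + mb g * mc h) * (mc g * mb h + md g * md h)
  - (ma g * mb h + mb g * md h) * (mc g * ma h + md g * mc h) = 1.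
Proof.
  transitivity ((ma g * md g - mb g * mc g) * (ma h * md h - mb h * mc h)).
  - ring.
  - rewrite !sl2_det; ring.
Qed.

Lemma sl2_one_det : 1 * 1 - 0 * 0 = 1.
Proof. ring. Qed.

Lemma sl2_inv_det (g : SL2) : md g * ma g - (- mb g) * (- mc g) = 1.
Proof. rewrite <- (sl2_det g); ring. Qed.

Definition sl2_mul (g h : SL2) : SL2 := mkSL2 _ _ _ _ (sl2_mul_det g h).
Definition sl2_one : SL2 := mkSL2 _ _ _ _ sl2_one_det.
Definition sl2_inv (g : SL2) : SL2 := mkSL2 _ _ _ _ (sl2_inv_det g).

Fixpoint sl2_npow (g : SL2) (n : nat) : SL2 :=
  match n with O => sl2_one | S m => sl2_mul g (sl2_npow g m) end.

Definition sl2_zpow (g : SL2) (k : Z) : SL2 :=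
  match k with
  | Z0 => sl2_one
  | Zpos p => sl2_npow g (Pos.to_nat p)
  | Zneg p => sl2_npow (sl2_inv g) (Pos.to_nat p)
  end.

Definition mob (g : SL2) (z : C) : C :=
  ((RtoC (ma g) * z + RtoC (mb g)) / (RtoC (mc g) * z + RtoC (md g)))%C.

Definition ideal : Set := option R.

Definition mob_ideal (g : SL2) (x : ideal) : ideal :=
  match x with
  | None => if Req_EM_T (mc g) 0 then None else Some (ma g / mc g)
  | Some t => if Req_EM_T (mc g * t + md g) 0 then None
              else Some ((ma g * t + mb g) / (mc g * t + md g))
  end.

(** Equivalent to [cosh d = 1 + |z - w|^2 / (2 Im z Im w)]. *)
Definition hdist (z w : C) : R :=
  2 * arcsinh (Cmod (z - w)%C / (2 * sqrt (Im z * Im w))).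

(** Every oriented unit-speed geodesic is the image under some [g] of the
    geodesic [t |-> i e^t] from [0] to infinity. *)
Definition geod (g : SL2) (t : R) : C := mob g (0, exp t).
Definition gstart (g : SL2) : ideal := mob_ideal g (Some 0).
Definition gend (g : SL2) : ideal := mob_ideal g None.

(** The open half-plane on the right of the oriented geodesic [geod g]. *)
Definition right_of (g : SL2) (z : C) : Prop :=
  0 < Im z /\ 0 < Re (mob (sl2_inv g) z).

(** The model is conformal, so that angles are Euclidean angles. *)
Definition orthogonal_at (g : SL2) (s : R) (h : SL2) (t : R) : Prop :=
  geod g s = geod h t /\
  Derive (fun u => Re (geod g u)) s * Derive (fun u => Re (geod h u)) t
  + Derive (fun u => Im (geod g u)) s * Derive (fun u => Im (geod h u)) t = 0.

(** [geod g t] is the foot of the perpendicular dropped from [x]. *)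
Definition foot (g : SL2) (x : ideal) (t : R) : Prop :=
  exists h s, orthogonal_at g t h s /\ gend h = x.

(** The cyclic order on a line completed by one point [None]: going in the
    increasing direction from [x], one meets [y] strictly before [z]. *)
Definition opt_lt {A : Type} (lt : A -> A -> Prop) (x y : option A) : Prop :=
  match x, y with
  | Some a, Some b => lt a b
  | Some _, None => True
  | None, _ => False
  end.

Definition cyclic {A : Type} (lt : A -> A -> Prop) (x y z : option A) : Prop :=
  (opt_lt lt x y /\ opt_lt lt y z) \/ (opt_lt lt y z /\ opt_lt lt z x) \/
  (opt_lt lt z x /\ opt_lt lt x y).

(** * Flippered 1-crowns

    A flippered 1-crown is given by its universal cover, as a domain [cover]
    of the hyperbolic plane modulo the infinite cyclic group generated by
    [hol], the holonomy of a loop around the interior puncture.  The domain is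
    the complement of disjoint open half-planes, bounded by the translates of
    the geodesic [geod arch], a lift of the unique arch; the removed
    half-planes lie to the right of the arches.  Their disjointness makes [hol]
    of infinite order and keeps its fixed points away from the arches. *)
Record crown : Set := mkCrown {
  hol : SL2;
  arch : SL2;
  hol_not_elliptic : 4 <= (ma hol + md hol) ^ 2;
  arch_disjoint : forall (k : Z) (z : C), k <> 0%Z ->
    right_of arch z -> ~ right_of (sl2_mul (sl2_zpow hol k) arch) z;
  (* among hol and its inverse, hol is the one that moves the arches in the
     increasing direction of the ideal boundary *)
  hol_direction :
    cyclic Rlt (gend arch) (mob_ideal hol (gend arch))
               (mob_ideal hol (mob_ideal hol (gend arch))) }.

Definition deck (X : crown) (k : Z) : SL2 := sl2_zpow (hol X) k.
Definition lift_arch (X : crown) (k : Z) : SL2 := sl2_mul (deck X k) (arch X).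

Definition cover (X : crown) (z : C) : Prop :=
  0 < Im z /\ forall k, ~ right_of (lift_arch X k) z.

Definition cover_boundary (X : crown) (z : C) : Prop :=
  exists k t, z = geod (lift_arch X k) t.

(** Orientation-preserving isometries of the quotient surfaces, as isometries
    between the covers that conjugate the deck groups. *)
Definition isometric (X Y : crown) : Prop :=
  exists g : SL2,
    (forall z, 0 < Im z -> (cover X z <-> cover Y (mob g z))) /\
    (forall k, exists m, forall z, 0 < Im z ->
       mob g (mob (deck X k) z) = mob (deck Y m) (mob g z)) /\
    (forall m, exists k, forall z, 0 < Im z ->
       mob g (mob (deck X k) z) = mob (deck Y m) (mob g z)).

Definition is_cusp (X : crown) : Prop := (ma (hol X) + md (hol X)) ^ 2 = 4.

(** [hol X] translates [geod h] forward by [l], so that [geod h] covers a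
    closed geodesic of length [l]. *)
Definition covers_neck (X : crown) (h : SL2) (l : R) : Prop :=
  0 < l /\ forall t, mob (hol X) (geod h t) = geod h (t + l).

Definition neck_length (X : crown) (l : R) : Prop :=
  (is_cusp X /\ l = 0) \/ exists h, covers_neck X h l.

(** The arch ends on both sides of the boundary puncture lift to the end of
    [geod (arch X)] and the start of its image under [hol X]. *)
Definition is_tine (X : crown) : Prop :=
  gend (arch X) = mob_ideal (hol X) (gstart (arch X)).

(** [geod h], between times [s0] and [s1], is a lift of the strap; the flipper
    is on its right. *)
Definition is_strap (X : crown) (h : SL2) (s0 s1 : R) : Prop :=
  ~ is_tine X /\ s0 < s1 /\
  (exists t, orthogonal_at h s0 (arch X) t) /\
  (exists t, orthogonal_at h s1 (lift_arch X 1) t).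

Definition strap_length (X : crown) (c : R) : Prop :=
  (is_tine X /\ c = 0) \/
  exists h s0 s1, is_strap X h s0 s1 /\ c = hdist (geod h s0) (geod h s1).

(** [X] represents a point of the moduli space with strap length [c] and neck
    length [d]. *)
Definition in_moduli (c d : R) (X : crown) : Prop :=
  strap_length X c /\ neck_length X d.

(** * Orthojectories and the generalised Chekhov action *)

(** [geod h], restricted to [orth_dom X h], is a lift of an orthojectory whose
    base point is [geod (arch X) t]. *)
Definition is_orthojectory (X : crown) (t : R) (h : SL2) : Prop :=
  orthogonal_at (arch X) t h 0 /\
  exists e, 0 < e /\ cover X (geod h e).

Definition orth_dom (X : crown) (h : SL2) (t : R) : Prop :=
  0 <= t /\ forall u, 0 <= u <= t -> cover X (geod h u).

(** The point of the surface under [z] is at distance more than [r] from a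
    fixed point of the arch. *)
Definition far (X : crown) (r : R) (z : C) : Prop :=
  forall k, r < hdist z (geod (lift_arch X k) 0).

(** Homotopies of curves in the surface, lifted to the cover.  Balls of the
    surface being relatively compact, [ph_proper] is properness. *)
Record proper_homotopy (X : crown) (h : SL2) (H : R -> R -> C) : Prop := {
  ph_cont : continuous_on
    (fun p : R * R => 0 <= fst p <= 1 /\ orth_dom X h (snd p))
    (fun p : R * R => H (fst p) (snd p));
  ph_cover : forall s t, 0 <= s <= 1 -> orth_dom X h t -> cover X (H s t);
  ph_init : forall t, orth_dom X h t -> H 0 t = geod h t;
  ph_base : forall s, 0 <= s <= 1 -> cover_boundary X (H s 0);
  ph_final : forall T, orth_dom X h T -> (forall t, orth_dom X h t -> t <= T) ->
    forall s, 0 <= s <= 1 -> cover_boundary X (H s T);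
  ph_proper : forall r, exists M, forall s t, 0 <= s <= 1 -> orth_dom X h t ->
    ~ far X r (H s t) -> t <= M }.

(** [geod f] runs from the lift [geod (arch X)] of the arch to the next one;
    on its right it cuts off a lift of (a neighbourhood of) the flipper or
    tine. *)
Definition cuts_off (X : crown) (f : SL2) : Prop :=
  exists s0 s1, s0 < s1 /\
    (exists t, geod f s0 = geod (arch X) t) /\
    (exists t, geod f s1 = geod (lift_arch X 1) t).

Definition is_peripheral (X : crown) (h : SL2) : Prop :=
  exists f, cuts_off X f /\
  forall r, exists H, proper_homotopy X h H /\
    forall t, orth_dom X h t ->
      far X r (H 1 t) /\ exists k, right_of (sl2_mul (deck X k) f) (H 1 t).

Definition essential_base (X : crown) (t : R) : Prop :=
  exists h, is_orthojectory X t h /\ ~ is_peripheral X h.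

(** [[t1, t2]] is the smallest closed interval containing all base points of
    essential orthojectories; its length is [t2 - t1], as [geod (arch X)] has
    unit speed. *)
Definition essential_interval (X : crown) (t1 t2 : R) : Prop :=
  t1 <= t2 /\
  (forall t, essential_base X t -> t1 <= t <= t2) /\
  (forall u1 u2, (forall t, essential_base X t -> u1 <= t <= u2) ->
     u1 <= t1 /\ t2 <= u2).

Definition chekhov_action (X : crown) (S : R) : Prop :=
  exists t1 t2 c, essential_interval X t1 t2 /\ strap_length X c /\
    S = (t2 - t1) / 2 + ln (cosh (c / 2)).

(** * Ideal triangulations of a once-punctured [N]-gon

    In the universal cover, the lifts of the boundary punctures are
    [Some k], numbered in cyclic order, and [None] is the lift of the
    interior puncture; the deck group acts by translation by [N].  Isotopy
    classes of arcs correspond to orbits of pairs of vertices. *)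
Definition vertex : Set := option Z.

Definition shift (n : Z) (a : vertex) : vertex := option_map (Z.add n) a.

Definition is_side (a b : vertex) : Prop :=
  match a, b with
  | Some i, Some j => (j = i + 1)%Z \/ (i = j + 1)%Z
  | _, _ => False
  end.

Definition crossing (a b c d : vertex) : Prop :=
  (cyclic Z.lt a c b /\ cyclic Z.lt b d a) \/
  (cyclic Z.lt a d b /\ cyclic Z.lt b c a).

Record arc_system (N : Z) (T : vertex -> vertex -> Prop) : Prop := {
  as_sym : forall a b, T a b -> T b a;
  as_invariant : forall a b, T a b <-> T (shift N a) (shift N b);
  as_essential : forall a b, T a b -> a <> b /\ ~ is_side a b;
  as_noncrossing : forall a b c d, T a b -> T c d -> ~ crossing a b c d }.

Definition ideal_triangulation (N : Z) (T : vertex -> vertex -> Prop) : Prop :=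
  arc_system N T /\
  forall T', arc_system N T' -> (forall a b, T a b -> T' a b) ->
    forall a b, T' a b -> T a b.

Definition same_arc (N : Z) (e e' : vertex * vertex) : Prop :=
  exists k : Z,
    (fst e' = shift (k * N) (fst e) /\ snd e' = shift (k * N) (snd e)) \/
    (fst e' = shift (k * N) (snd e) /\ snd e' = shift (k * N) (fst e)).

(** * Shearing coordinates of the clipped surface *)

(** [geod g] bounds the largest open half-plane contained in the flipper (in
    its lift adjacent to [geod (arch X)]). *)
Definition is_clip (X : crown) (g : SL2) : Prop :=
  exists h s0 s1, is_strap X h s0 s1 /\
    (forall z, right_of g z -> cover X z /\ right_of h z) /\
    (forall g', (forall z, right_of g' z -> cover X z /\ right_of h z) ->
       forall z, right_of g' z -> right_of g z).

(** The ideal points [V k] which are the lifts of the [N] boundary punctures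
    of the clipped surface: one for a tine, two for a flipper. *)
Definition clip_vertices (X : crown) (N : Z) (V : Z -> ideal) : Prop :=
  (N = 1%Z /\ is_tine X /\
   forall k, V k = mob_ideal (deck X k) (gstart (arch X))) \/
  (N = 2%Z /\ exists g, is_clip X g /\
   forall k, V (2 * k)%Z = mob_ideal (deck X k) (gstart g) /\
             V (2 * k + 1)%Z = mob_ideal (deck X k) (gend g)).

(** The ideal point to which the lifts of arcs ending at the interior puncture
    are drawn; for a funnel, [fwd] is the direction of spiralling. *)
Definition spiral_point (X : crown) (fwd : bool) (P : ideal) : Prop :=
  (is_cusp X /\ mob_ideal (hol X) P = P) \/
  exists h l, covers_neck X h l /\ P = if fwd then gend h else gstart h.

Definition realise (V : Z -> ideal) (P : ideal) (a : vertex) : ideal :=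
  match a with Some k => V k | None => P end.

(** [s] is the shearing coordinate of [X] along the arc [e = (a, b)].  The
    adjacent ideal triangles are [(a, b, u)] on the left and [(a, b, u')] on
    the right of the geodesic from [a] to [b]; seen from the left triangle,
    moving towards [b] is moving to the left. *)
Definition is_shear (X : crown) (N : Z) (T : vertex -> vertex -> Prop)
    (fwd : bool) (e : vertex * vertex) (s : R) : Prop :=
  let (a, b) := e in
  let edge x y := T x y \/ is_side x y in
  exists V P, clip_vertices X N V /\ spiral_point X fwd P /\
  exists u u', edge a u /\ edge b u /\ cyclic Z.lt b u a /\
               edge a u' /\ edge b u' /\ cyclic Z.lt a u' b /\
  exists g t t',
    gstart g = realise V P a /\ gend g = realise V P b /\
    foot g (realise V P u) t /\ foot g (realise V P u') t' /\
    s = t' - t.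

(** * The volume form

    The neck length and, when positive, the strap length are coordinates on
    the moduli spaces.  A neck length [0] is a boundary point, whence the
    differentials relative to [domain1] and [domain2]. *)
Definition domain1 (d : R) : Prop := 0 <= d.
Definition domain2 (p : R * R) : Prop := 0 < fst p /\ 0 <= snd p.

Definition is_sign (e : R) : Prop := e = 1 \/ e = -1.

Definition wedge (l1 l2 : R * R -> R) (u v : R * R) : R :=
  l1 u * l2 v - l1 v * l2 u.

(** [w] is the volume form for strap length [0] and neck length [d]: the only
    shearing coordinate [f] satisfies [df = +- w d(neck length)]. *)
Definition wp_tine (d w : R) : Prop :=
  forall T fwd e,
    ideal_triangulation 1 T ->
    (forall a b, T a b <-> same_arc 1 e (a, b)) ->
    exists (f : R -> R) (df : R -> R) (eps : R),
      (forall d' X, domain1 d' -> in_moduli 0 d' X ->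
         is_shear X 1 T fwd e (f d')) /\
      filterdiff f (within domain1 (locally d)) df /\
      is_sign eps /\
      forall u, df u = eps * (w * u).

(** [w] is the volume form for strap length [c > 0] and neck length [d].
    Here [dk] is the differential of [2 log sinh (strap length / 2)], and
    [omega] represents the form on the space with fixed strap length, whose
    tangent space is the kernel of [dk]. *)
Definition wp_flipper (c d w : R) : Prop :=
  forall T fwd e1 e2,
    ideal_triangulation 2 T ->
    ~ same_arc 2 e1 e2 ->
    (forall a b, T a b <-> same_arc 2 e1 (a, b) \/ same_arc 2 e2 (a, b)) ->
    exists (f1 f2 : R * R -> R) (df1 df2 dk omega : R * R -> R) (eps eps' : R),
      (forall p X, domain2 p -> in_moduli (fst p) (snd p) X ->
         is_shear X 2 T fwd e1 (f1 p) /\ is_shear X 2 T fwd e2 (f2 p)) /\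
      filterdiff f1 (within domain2 (locally (c, d))) df1 /\
      filterdiff f2 (within domain2 (locally (c, d))) df2 /\
      filterdiff (fun p : R * R => 2 * ln (sinh (fst p / 2)))
        (within domain2 (locally (c, d))) dk /\
      is_linear omega /\ is_sign eps /\ is_sign eps' /\
      (forall u v, wedge df1 df2 u v = eps * wedge dk omega u v) /\
      (forall u, dk u = 0 -> omega u = eps' * (w * snd u)).

Definition wp_form (c d w : R) : Prop :=
  0 < w /\ (c = 0 -> wp_tine d w) /\ (0 < c -> wp_flipper c d w).

(** The moduli space with fixed strap and neck lengths is a single point [X],
    at which the volume form is a positive number, so that the integral of
    [exp (- S)] is a product. *)
Definition is_volume (c d v : R) : Prop :=
  exists X S w,
    in_moduli c d X /\ (forall Y, in_moduli c d Y -> isometric X Y) /\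
    chekhov_action X S /\ wp_form c d w /\
    v = exp (- S) * w.

(* Main.v *)
From Stdlib Require Import Reals ZArith Lra Lia Psatz Classical Eqdep_dec.
From Coquelicot Require Import Coquelicot.
Require Import Defs.

Open Scope R_scope.

(** The moduli space is a point, so that the volume is the product of
    [exp (- S)] and of a coefficient [w] of the volume form; both are computed
    on an explicit crown.

    In the chart where the arch runs from [0] to infinity, the holonomy is, up
    to sign, a matrix [M] with rows [al, be] and [- ga, - de], where [al], [be]
    and [ga] are positive and [0 <= de] ([normal_form]).  All the notions
    involved are invariant under a change of chart.  If [c] is the strap length
    and [d] the neck length, the common perpendicular of consecutive arches
    gives [al de = sinh (c / 2) ^ 2], and the trace gives
    [al - de = 2 cosh (d / 2)]; hence [al + de = 2 Q] with
    [Q ^ 2 = cosh (c / 2) ^ 2 + sinh (d / 2) ^ 2] ([shape_half_sum]).  Only the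
    ratio of [be] and [ga] is left, and it depends on the parametrisation of
    the arch ([moduli_point]).

    The orthojectory from [i exp t] is the half-circle [|z| = exp t].  It ends
    on the next arch, or in the flipper before it, if [al / ga < exp t], and in
    the other direction if [exp t < be / al].  In the first case, a flow pushes
    it deeply into the flipper, along the geodesics orthogonal to the strap
    ([flipper_peripheral]), or into the tine, along vertical lines
    ([tine_peripheral]); a reflection reduces the second case to the first.  In
    between, a homotopy into a boundary puncture would have to cross one of two
    circular barriers, compact in the cover, so that their points are not far
    from the arch ([between_not_peripheral]).  So the essential interval has
    length [ln (al ^ 2 / (be ga))]; as [be ga = cosh (c / 2) ^ 2], the action
    is [S = ln al] ([model_action]).

    For a flipper, the largest half-plane inside it is bounded by the geodesic
    from the end of the arch to the start of the next one, and the vertices of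
    the clipped crown are the translates of both ends.  Shears are logarithms of
    cross-ratios of these points and of an eigenvector of [M]
    ([shear_cross_ratio]); for every triangulation, both shears are combinations
    of [ln de] and [d] with a coefficient matrix of determinant [1] or [-1]
    ([flipper_shears]).  Therefore [w] is the derivative of [ln de] with respect
    to [2 ln (sinh (c / 2)) = ln (al de)] for fixed [al - de], which is
    [al / (al + de)] ([log_de_diff]).  For a tine, the only shear is the neck
    length up to sign, and [w] is [1], which is the same expression as [de]
    vanishes ([wp_tine_iff]).

    The volume is thus [(1 / al) (al / (al + de)) = 1 / (2 Q)], and
    [4 Q ^ 2 = 2 cosh c + 2 cosh d] ([volume_value]). *)

(** * Moebius transformations in real coordinates *)

Lemma sl2_ext (g h : SL2) :
  ma g = ma h -> mb g = mb h -> mc g = mc h -> md g = md h -> g = h.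
Proof.
  destruct g as [a b c d e], h as [a' b' c' d' e']; cbn.
  intros; subst. f_equal. apply UIP_dec, Req_EM_T.
Qed.

(** Equality in [PSL2]: a Moebius transformation determines its matrix up to
    sign. *)
Definition peq (g h : SL2) : Prop :=
  exists s, s ^ 2 = 1 /\ ma g = s * ma h /\ mb g = s * mb h /\
            mc g = s * mc h /\ md g = s * md h.

Lemma peq_refl g : peq g g.
Proof. exists 1. repeat split; ring. Qed.

Lemma peq_sym g h : peq g h -> peq h g.
Proof.
  intros (s & Hs & H1 & H2 & H3 & H4). exists s. rewrite H1, H2, H3, H4.
  repeat split; try assumption; rewrite <- Rmult_assoc;
    replace (s * s) with (s ^ 2) by ring; rewrite Hs; ring.
Qed.

Lemma peq_trans g h k : peq g h -> peq h k -> peq g k.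
Proof.
  intros (s & Hs & H1 & H2 & H3 & H4) (t & Ht & K1 & K2 & K3 & K4).
  exists (s * t). rewrite H1, H2, H3, H4, K1, K2, K3, K4.
  repeat split; try ring. rewrite Rpow_mult_distr, Hs, Ht; ring.
Qed.

Lemma peq_mul g g' h h' : peq g g' -> peq h h' -> peq (sl2_mul g h) (sl2_mul g' h').
Proof.
  intros (s & Hs & H1 & H2 & H3 & H4) (t & Ht & K1 & K2 & K3 & K4).
  exists (s * t). cbn [sl2_mul ma mb mc md]. rewrite H1, H2, H3, H4, K1, K2, K3, K4.
  repeat split; try ring. rewrite Rpow_mult_distr, Hs, Ht; ring.
Qed.

Lemma peq_inv g h : peq g h -> peq (sl2_inv g) (sl2_inv h).
Proof.
  intros (s & Hs & H1 & H2 & H3 & H4). exists s. cbn [sl2_inv ma mb mc md].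
  rewrite H1, H2, H3, H4. repeat split; try ring; assumption.
Qed.

Lemma sl2_mul_assoc g h k : sl2_mul g (sl2_mul h k) = sl2_mul (sl2_mul g h) k.
Proof. apply sl2_ext; cbn; ring. Qed.

Lemma sl2_mul_1l g : sl2_mul sl2_one g = g.
Proof. apply sl2_ext; cbn; ring. Qed.

Lemma sl2_mul_1r g : sl2_mul g sl2_one = g.
Proof. apply sl2_ext; cbn; ring. Qed.

Lemma sl2_mul_invl g : sl2_mul (sl2_inv g) g = sl2_one.
Proof. apply sl2_ext; cbn; rewrite <- ?(sl2_det g); ring. Qed.

Lemma sl2_mul_invr g : sl2_mul g (sl2_inv g) = sl2_one.
Proof. apply sl2_ext; cbn; rewrite <- ?(sl2_det g); ring. Qed.

Lemma sl2_inv_inv g : sl2_inv (sl2_inv g) = g.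
Proof. apply sl2_ext; cbn; ring. Qed.

Lemma sl2_inv_mul g h : sl2_inv (sl2_mul g h) = sl2_mul (sl2_inv h) (sl2_inv g).
Proof. apply sl2_ext; cbn; ring. Qed.

(** The squared norm of the denominator [c z + d]. *)
Definition nrm (g : SL2) (z : C) : R :=
  (mc g * Re z + md g) ^ 2 + (mc g * Im z) ^ 2.

Lemma nrm_pos g z : 0 < Im z -> 0 < nrm g z.
Proof.
  intros Hz. unfold nrm. pose proof (sl2_det g) as Hd.
  destruct (Req_dec (mc g) 0) as [E|E].
  - rewrite E in *. assert (md g <> 0) by (intros F; rewrite F in Hd; lra).
    assert (0 < md g ^ 2) by (apply pow2_gt_0; assumption). nra.
  - assert (0 < (mc g * Im z) ^ 2) by (apply pow2_gt_0; nra).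
    pose proof (pow2_ge_0 (mc g * Re z + md g)). lra.
Qed.

Lemma mob_coord g z : 0 < Im z ->
  mob g z = ((ma g * mc g * (Re z ^ 2 + Im z ^ 2)
              + (ma g * md g + mb g * mc g) * Re z + mb g * md g) / nrm g z,
             Im z / nrm g z).
Proof.
  intros Hz. pose proof (nrm_pos g z Hz) as Hn. destruct z as [x y].
  pose proof (sl2_det g) as Hd.
  unfold mob, Cdiv, Cmult, Cplus, Cinv, RtoC, nrm, Re, Im in *; cbn [fst snd] in *.
  f_equal.
  - field. nra.
  - field_simplify_eq; [|nra].
    replace (ma g) with (ma g * 1) by ring.
    nra.
Qed.

Lemma mob_im g z : 0 < Im z -> Im (mob g z) = Im z / nrm g z.
Proof. intros H; rewrite mob_coord by assumption; reflexivity. Qed.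

Lemma mob_im_pos g z : 0 < Im z -> 0 < Im (mob g z).
Proof.
  intros H; rewrite mob_im by assumption.
  apply Rdiv_lt_0_compat; [assumption | apply nrm_pos; assumption].
Qed.

Lemma mob_den g z : 0 < Im z -> (RtoC (mc g) * z + RtoC (md g))%C <> 0.
Proof.
  intros Hz E. pose proof (nrm_pos g z Hz) as Hn. destruct z as [x y].
  unfold Cmult, Cplus, RtoC in E; cbn in E. injection E as E1 E2.
  unfold nrm, Re, Im in Hn; cbn [fst snd] in Hn.
  replace (mc g * x + md g) with 0 in Hn by lra.
  replace (mc g * y) with 0 in Hn by lra. lra.
Qed.

Lemma mob_mul g h z : 0 < Im z -> mob (sl2_mul g h) z = mob g (mob h z).
Proof.
  intros Hz. pose proof (mob_den h z Hz) as D1.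
  pose proof (mob_den g _ (mob_im_pos h z Hz)) as D2.
  pose proof (mob_den (sl2_mul g h) z Hz) as D3.
  unfold mob in *; cbn in *.
  rewrite !RtoC_plus, !RtoC_mult in *.
  field. split; [exact D1|].
  intros E. apply D3. rewrite <- E. ring.
Qed.

Lemma mob_one z : mob sl2_one z = z.
Proof.
  unfold mob; cbn. field.
Qed.

Lemma mob_invl g z : 0 < Im z -> mob (sl2_inv g) (mob g z) = z.
Proof. intros H. rewrite <- mob_mul, sl2_mul_invl by assumption. apply mob_one. Qed.

Lemma mob_invr g z : 0 < Im z -> mob g (mob (sl2_inv g) z) = z.
Proof. intros H. rewrite <- mob_mul, sl2_mul_invr by assumption. apply mob_one. Qed.

Lemma mob_peq g h z : 0 < Im z -> peq g h -> mob g z = mob h z.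
Proof.
  intros Hz (s & Hs & H1 & H2 & H3 & H4). rewrite !mob_coord by assumption.
  assert (N : nrm g z = nrm h z).
  { unfold nrm. rewrite H3, H4.
    transitivity (s ^ 2 * ((mc h * Re z + md h) ^ 2 + (mc h * Im z) ^ 2)); [ring|].
    rewrite Hs; ring. }
  rewrite N. f_equal. f_equal. rewrite H1, H2, H3, H4.
  transitivity (s ^ 2 * (ma h * mc h * (Re z ^ 2 + Im z ^ 2)
     + (ma h * md h + mb h * mc h) * Re z + mb h * md h)); [ring|].
  rewrite Hs; ring.
Qed.

(** The quadratic function which is positive to the right of [geod g]. *)
Definition side (g : SL2) (z : C) : R :=
  - (md g * mc g) * (Re z ^ 2 + Im z ^ 2)
  + (ma g * md g + mb g * mc g) * Re z - ma g * mb g.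

Lemma side_mob_inv g z : 0 < Im z -> Re (mob (sl2_inv g) z) * nrm (sl2_inv g) z = side g z.
Proof.
  intros Hz. pose proof (nrm_pos (sl2_inv g) z Hz).
  rewrite mob_coord by assumption. unfold side, Re at 1; cbn [fst].
  cbn [sl2_inv ma mb mc md]. field. lra.
Qed.

Lemma right_of_side g z : right_of g z <-> 0 < Im z /\ 0 < side g z.
Proof.
  unfold right_of. split; intros [Hz H]; split; try assumption;
    pose proof (side_mob_inv g z Hz) as E; pose proof (nrm_pos (sl2_inv g) z Hz); nra.
Qed.

Lemma side_mob g h z : 0 < Im z -> side (sl2_mul g h) (mob g z) * nrm g z = side h z.
Proof.
  intros Hz. pose proof (mob_im_pos g z Hz) as Hz'.
  pose proof (nrm_pos g z Hz) as Hn.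
  rewrite mob_coord by assumption. unfold side; cbn [Re Im fst snd sl2_mul ma mb mc md].
  assert (K : (((ma g * mc g * (Re z ^ 2 + Im z ^ 2) +
       (ma g * md g + mb g * mc g) * Re z + mb g * md g) / nrm g z) ^ 2 +
      (Im z / nrm g z) ^ 2) = ((ma g * Re z + mb g) ^ 2 + (ma g * Im z) ^ 2) / nrm g z).
  { pose proof (sl2_det g) as Hd. field_simplify_eq; [|lra]. unfold nrm.
    transitivity ((ma g * mc g * (Re z ^ 2 + Im z ^ 2) +
       (ma g * md g + mb g * mc g) * Re z + mb g * md g) ^ 2
       + (ma g * md g - mb g * mc g) ^ 2 * Im z ^ 2); [rewrite Hd|]; ring. }
  rewrite K. field_simplify_eq; [|lra]. unfold nrm.
  transitivity ((ma g * md g - mb g * mc g) ^ 2 * (- (md h * mc h) * (Re z ^ 2 + Im z ^ 2)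
  + (ma h * md h + mb h * mc h) * Re z - ma h * mb h)); [ring|].
  rewrite sl2_det. ring.
Qed.

Lemma right_of_mob g h z : 0 < Im z -> right_of (sl2_mul g h) (mob g z) <-> right_of h z.
Proof.
  intros Hz. rewrite !right_of_side. pose proof (side_mob g h z Hz).
  pose proof (nrm_pos g z Hz). pose proof (mob_im_pos g z Hz).
  split; intros [_ K]; split; try assumption; nra.
Qed.

Lemma side_peq g h z : peq g h -> side g z = side h z.
Proof.
  intros (s & Hs & H1 & H2 & H3 & H4). unfold side. rewrite H1, H2, H3, H4.
  transitivity (s ^ 2 * (- (md h * mc h) * (Re z ^ 2 + Im z ^ 2)
  + (ma h * md h + mb h * mc h) * Re z - ma h * mb h)); [ring|].
  rewrite Hs; ring.
Qed.

Lemma right_of_peq g h z : peq g h -> right_of g z <-> right_of h z.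
Proof. intros H. rewrite !right_of_side, (side_peq g h z H). reflexivity. Qed.

(** * Hyperbolic distance *)

(** [4 sinh^2 (hdist z w / 2)] *)
Definition chord (z w : C) : R :=
  ((Re z - Re w) ^ 2 + (Im z - Im w) ^ 2) / (Im z * Im w).

Lemma chord_pos z w : 0 < Im z -> 0 < Im w -> 0 <= chord z w.
Proof.
  intros. apply Rdiv_le_0_compat.
  - pose proof (pow2_ge_0 (Re z - Re w)). pose proof (pow2_ge_0 (Im z - Im w)). lra.
  - nra.
Qed.

Lemma hdist_chord z w : 0 < Im z -> 0 < Im w ->
  hdist z w = 2 * arcsinh (sqrt (chord z w) / 2).
Proof.
  intros Hz Hw. unfold hdist. f_equal. f_equal.
  unfold chord. rewrite sqrt_div_alt by nra.
  assert (0 < sqrt (Im z * Im w)) by (apply sqrt_lt_R0; nra).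
  unfold Cmod. replace (fst (z - w)%C) with (Re z - Re w) by (destruct z, w; reflexivity).
  replace (snd (z - w)%C) with (Im z - Im w) by (destruct z, w; reflexivity).
  field. lra.
Qed.

Lemma chord_mob g z w : 0 < Im z -> 0 < Im w -> chord (mob g z) (mob g w) = chord z w.
Proof.
  intros Hz Hw. pose proof (nrm_pos g z Hz) as Nz. pose proof (nrm_pos g w Hw) as Nw.
  unfold chord. rewrite !mob_coord by assumption. cbn [Re Im fst snd].
  set (n := nrm g z) in *. set (m := nrm g w) in *.
  set (P := ma g * mc g * (Re z ^ 2 + Im z ^ 2) +
       (ma g * md g + mb g * mc g) * Re z + mb g * md g).
  set (Q := ma g * mc g * (Re w ^ 2 + Im w ^ 2) +
       (ma g * md g + mb g * mc g) * Re w + mb g * md g).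
  assert (K : (P / n - Q / m) ^ 2 + (Im z / n - Im w / m) ^ 2
     = ((Re z - Re w) ^ 2 + (Im z - Im w) ^ 2) / (n * m)).
  { field_simplify_eq; [|lra].
    assert (E1 : (P * m - Q * n) ^ 2 + (ma g * md g - mb g * mc g) ^ 2 * (Im z * m - Im w * n) ^ 2
      = (ma g * md g - mb g * mc g) ^ 2 * ((Re z - Re w) ^ 2 + (Im z - Im w) ^ 2) * n * m).
    { unfold P, Q, n, m, nrm. ring. }
    rewrite sl2_det in E1. nra. }
  rewrite K. field. repeat split; lra.
Qed.

Lemma hdist_mob g z w : 0 < Im z -> 0 < Im w -> hdist (mob g z) (mob g w) = hdist z w.
Proof.
  intros Hz Hw. rewrite !hdist_chord, chord_mob; auto using mob_im_pos.
Qed.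

(** Lower and upper bounds on distances amount to bounds on [chord]. *)
Lemma hdist_gt r z w : 0 < Im z -> 0 < Im w ->
  4 * sinh (Rabs r / 2) ^ 2 < chord z w -> r < hdist z w.
Proof.
  intros Hz Hw H. rewrite hdist_chord by assumption.
  apply Rle_lt_trans with (Rabs r); [apply Rle_abs|].
  assert (S0 : 0 <= sinh (Rabs r / 2)).
  { rewrite <- sinh_0. pose proof (Rabs_pos r).
    destruct (Req_dec (Rabs r / 2) 0) as [E|E]; [rewrite E; lra|].
    left. apply sinh_lt. lra. }
  replace (Rabs r) with (2 * arcsinh (sinh (Rabs r / 2)))
    by (rewrite arcsinh_sinh; lra).
  apply Rmult_lt_compat_l; [lra|]. apply arcsinh_lt.
  assert (2 * sinh (Rabs r / 2) < sqrt (chord z w)); [|lra].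
  rewrite <- (sqrt_Rsqr (2 * sinh (Rabs r / 2))) by lra.
  apply sqrt_lt_1; unfold Rsqr; [nra | apply chord_pos; assumption | nra].
Qed.

Lemma hdist_le B z w : 0 < Im z -> 0 < Im w -> chord z w <= B ->
  hdist z w <= 2 * arcsinh (sqrt B / 2).
Proof.
  intros Hz Hw H. rewrite hdist_chord by assumption.
  apply Rmult_le_compat_l; [lra|]. apply arcsinh_le.
  apply Rmult_le_compat_r; [lra|]. apply sqrt_le_1_alt, H.
Qed.

(** * Geodesics *)

Lemma geod_im g t : 0 < Im (geod g t).
Proof. apply mob_im_pos, exp_pos. Qed.

Lemma geod_coord g t :
  geod g t = ((ma g * mc g * exp t ^ 2 + mb g * md g) / ((mc g * exp t) ^ 2 + md g ^ 2),
              exp t / ((mc g * exp t) ^ 2 + md g ^ 2)).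
Proof.
  unfold geod. rewrite mob_coord by (apply exp_pos).
  unfold nrm; cbn [Re Im fst snd].
  replace ((mc g * 0 + md g) ^ 2 + (mc g * exp t) ^ 2)
    with ((mc g * exp t) ^ 2 + md g ^ 2) by ring.
  f_equal. f_equal. ring.
Qed.

Lemma geod_den g t : 0 < (mc g * exp t) ^ 2 + md g ^ 2.
Proof.
  pose proof (nrm_pos g (0, exp t) (exp_pos t)) as H. unfold nrm in H; cbn [Re Im fst snd] in H.
  replace (mc g * 0 + md g) with (md g) in H by ring. lra.
Qed.

Lemma geod_mul g h t : geod (sl2_mul g h) t = mob g (geod h t).
Proof. apply mob_mul, exp_pos. Qed.

Lemma geod_peq g h t : peq g h -> geod g t = geod h t.
Proof. apply mob_peq, exp_pos. Qed.

Lemma geod_side g t : side g (geod g t) = 0.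
Proof.
  rewrite geod_coord. pose proof (geod_den g t) as H. pose proof (sl2_det g) as D.
  unfold side; cbn [Re Im fst snd].
  field_simplify_eq; [|lra].
  transitivity (md g * mc g * exp t ^ 2 * ((ma g * md g - mb g * mc g) ^ 2 - 1)); [ring|].
  rewrite D. ring.
Qed.

Lemma side_geod g z : 0 < Im z -> side g z = 0 -> exists t, z = geod g t.
Proof.
  intros Hz H. pose proof (side_mob_inv g z Hz) as E.
  pose proof (nrm_pos (sl2_inv g) z Hz) as Hn.
  pose proof (mob_im_pos (sl2_inv g) z Hz) as Hi.
  exists (ln (Im (mob (sl2_inv g) z))). unfold geod. rewrite exp_ln by assumption.
  replace (0, Im (mob (sl2_inv g) z)) with (mob (sl2_inv g) z).
  - rewrite mob_invr by assumption. reflexivity.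
  - assert (Re (mob (sl2_inv g) z) = 0) by nra.
    rewrite (surjective_pairing (mob (sl2_inv g) z)) at 1. f_equal. exact H0.
Qed.

Lemma exp_mul_opp x : exp x * exp (- x) = 1.
Proof. rewrite <- exp_plus, Rplus_opp_r. apply exp_0. Qed.

Lemma dil_det s : exp (s / 2) * exp (- (s / 2)) - 0 * 0 = 1.
Proof. rewrite exp_mul_opp. ring. Qed.

(** Translation by [s] along the geodesic from [0] to infinity. *)
Definition dil (s : R) : SL2 := mkSL2 _ _ _ _ (dil_det s).

Lemma exp_half s : exp (s / 2) * exp (s / 2) = exp s.
Proof. rewrite <- exp_plus. f_equal. lra. Qed.

Lemma mob_dil s z : mob (dil s) z = (exp s * Re z, exp s * Im z).
Proof.
  pose proof (exp_pos (s / 2)) as P. pose proof (exp_half s) as E.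
  unfold mob, dil, Cdiv, Cmult, Cplus, Cinv, RtoC; destruct z as [x y]; cbn [ma mb mc md fst snd Re Im].
  rewrite exp_Ropp, <- E. f_equal; field; lra.
Qed.

Lemma geod_dil g s t : geod (sl2_mul g (dil s)) t = geod g (s + t).
Proof.
  rewrite geod_mul. unfold geod at 1. rewrite mob_dil; cbn [Re Im fst snd].
  unfold geod. rewrite exp_plus. do 2 f_equal. ring.
Qed.

Lemma hdist_geod g s t : hdist (geod g s) (geod g t) = Rabs (s - t).
Proof.
  unfold geod. rewrite hdist_mob by apply exp_pos.
  rewrite hdist_chord by apply exp_pos. unfold chord; cbn [Re Im fst snd].
  replace (((0 - 0) ^ 2 + (exp s - exp t) ^ 2) / (exp s * exp t))
    with ((2 * sinh (Rabs (s - t) / 2)) ^ 2).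
  2:{ replace ((2 * sinh (Rabs (s - t) / 2)) ^ 2) with ((2 * sinh ((s - t) / 2)) ^ 2).
      2:{ unfold Rabs. destruct Rcase_abs; [|reflexivity].
          replace (- (s - t) / 2) with (- ((s - t) / 2)) by lra.
          unfold sinh. rewrite Ropp_involutive. field. }
      unfold sinh. pose proof (exp_half s) as Es. pose proof (exp_half t) as Et.
      pose proof (exp_pos (s / 2)). pose proof (exp_pos (t / 2)).
      replace (exp ((s - t) / 2)) with (exp (s / 2) * / exp (t / 2))
        by (rewrite <- exp_Ropp, <- exp_plus; f_equal; lra).
      replace (exp (- ((s - t) / 2))) with (exp (t / 2) * / exp (s / 2))
        by (rewrite <- exp_Ropp, <- exp_plus; f_equal; lra).
      rewrite <- Es, <- Et. field. lra. }
  rewrite sqrt_pow2.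
  - replace (2 * sinh (Rabs (s - t) / 2) / 2) with (sinh (Rabs (s - t) / 2)) by field.
    rewrite arcsinh_sinh. field.
  - assert (sinh 0 <= sinh (Rabs (s - t) / 2)); [|rewrite sinh_0 in *; lra].
    pose proof (Rabs_pos (s - t)).
    destruct (Req_dec (Rabs (s - t) / 2) 0) as [E|E]; [rewrite E; lra|].
    left; apply sinh_lt; lra.
Qed.

(** * Orthogonality *)

(** [H] is [G] followed by a quarter turn, up to sign: the unit tangent
    vectors of [geod G] and [geod H] at time [0] have the same base point and
    are orthogonal. *)
Definition quarter_turn (G H : SL2) : Prop :=
  exists k e, 2 * k ^ 2 = 1 /\ e ^ 2 = 1 /\
    ma H = k * (ma G - e * mb G) /\ mb H = k * (e * ma G + mb G) /\
    mc H = k * (mc G - e * md G) /\ md H = k * (e * mc G + md G).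

Lemma geod_derive_re g t :
  Derive (fun u => Re (geod g u)) t
  = 2 * mc g * md g * exp t ^ 2 / ((mc g * exp t) ^ 2 + md g ^ 2) ^ 2.
Proof.
  pose proof (geod_den g t) as Hn. pose proof (sl2_det g) as Hd.
  apply is_derive_unique.
  apply (is_derive_ext (fun u => (ma g * mc g * exp u ^ 2 + mb g * md g)
                                 / ((mc g * exp u) ^ 2 + md g ^ 2))).
  { intros u. rewrite geod_coord. reflexivity. }
  auto_derive.
  - cbn [pow] in *. lra.
  - cbn [pow] in *. field_simplify_eq; [|lra].
    transitivity (2 * exp t ^ 2 * mc g * md g * (ma g * md g - mb g * mc g)); [ring|].
    rewrite Hd; ring.
Qed.

Lemma geod_derive_im g t :
  Derive (fun u => Im (geod g u)) t
  = exp t * (md g ^ 2 - mc g ^ 2 * exp t ^ 2) / ((mc g * exp t) ^ 2 + md g ^ 2) ^ 2.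
Proof.
  pose proof (geod_den g t) as Hn.
  apply is_derive_unique.
  apply (is_derive_ext (fun u => exp u / ((mc g * exp u) ^ 2 + md g ^ 2))).
  { intros u. rewrite geod_coord. reflexivity. }
  auto_derive.
  - cbn [pow] in *. lra.
  - cbn [pow] in *. field; lra.
Qed.

(** At time [0], the direction of [geod G] is given by the argument of
    [mc G + i md G], doubled: a right angle between the directions is a
    rotation of [(mc G, md G)] by 45 degrees. *)
Lemma orthogonal_at_0 G H : orthogonal_at G 0 H 0 <-> quarter_turn G H.
Proof.
  unfold orthogonal_at, quarter_turn. rewrite !geod_derive_re, !geod_derive_im, !geod_coord, exp_0.
  pose proof (geod_den G 0) as NG. pose proof (geod_den H 0) as NH.
  rewrite exp_0 in NG, NH.
  pose proof (sl2_det G) as DG. pose proof (sl2_det H) as DH.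
  destruct G as [A B c d dG], H as [A' B' c' d' dH]; cbn [ma mb mc md] in *.
  clear dG dH.
  replace (1 ^ 2) with 1 by ring. rewrite !Rmult_1_r in *. rewrite !Rmult_1_l in *.
  set (m := c ^ 2 + d ^ 2) in *. set (m' := c' ^ 2 + d' ^ 2) in *.
  split.
  - intros [E1 E2]. injection E1 as E3 E4.
    assert (Em : m' = m).
    { apply (f_equal Rinv) in E4. rewrite !Rinv_div, !Rdiv_1_r in E4. lra. }
    rewrite Em in *.
    assert (E5 : A * c + B * d = A' * c' + B' * d').
    { apply (Rmult_eq_reg_r (/ m)); [exact E3|]. apply Rinv_neq_0_compat; lra. }
    assert (E6 : (c * c' + d * d') ^ 2 = (d * c' - c * d') ^ 2).
    { assert (2 * c * d * (2 * c' * d') + (d ^ 2 - c ^ 2) * (d' ^ 2 - c' ^ 2) = 0).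
      { apply (Rmult_eq_reg_r (/ m ^ 2 * / m ^ 2)).
        - rewrite Rmult_0_l, <- E2. field. lra.
        - apply Rmult_integral_contrapositive_currified; apply Rinv_neq_0_compat;
            apply pow_nonzero; lra. }
      nra. }
    set (P := c * c' + d * d') in *. set (Q := d * c' - c * d') in *.
    assert (E7 : P ^ 2 + Q ^ 2 = m * m).
    { rewrite <- Em at 1. unfold P, Q, m, m'. ring. }
    assert (P0 : P <> 0).
    { intros F. rewrite F in *. nra. }
    exists (P / m), (- Q / P).
    assert (Hc : c' = (c * P + d * Q) / m).
    { field_simplify_eq; [|lra]. unfold P, Q, m. ring. }
    assert (Hd : d' = (d * P - c * Q) / m).
    { field_simplify_eq; [|lra]. unfold P, Q, m. ring. }
    assert (HA : A' * m = d' + c' * (A * c + B * d)).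
    { rewrite <- Em, E5. unfold m'.
      transitivity (d' * (A' * d' - B' * c') + c' * (A' * c' + B' * d')); [ring|].
      rewrite DH; ring. }
    assert (HB : B' * m = - c' + d' * (A * c + B * d)).
    { rewrite <- Em, E5. unfold m'.
      transitivity (- c' * (A' * d' - B' * c') + d' * (A' * c' + B' * d')); [ring|].
      rewrite DH; ring. }
    repeat split.
    + field_simplify_eq; [|lra]. nra.
    + field_simplify_eq; [|lra]. nra.
    + apply (Rmult_eq_reg_r m); [|lra]. rewrite HA, Hc, Hd.
      field_simplify_eq; [|lra].
      transitivity (d * P * (A * d - B * c) - c * Q * (A * d - B * c) + (c * P + d * Q) * (A * c + B * d)).
      { rewrite DG; ring. }
      unfold m. ring.
    + apply (Rmult_eq_reg_r m); [|lra]. rewrite HB, Hc, Hd.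
      field_simplify_eq; [|lra].
      transitivity (- (c * P + d * Q) * (A * d - B * c) + (d * P - c * Q) * (A * c + B * d)).
      { rewrite DG; ring. }
      unfold m. ring.
    + rewrite Hc. field. lra.
    + rewrite Hd. field. lra.
  - intros (k & e & Hk & He & H1 & H2 & H3 & H4).
    assert (Em : m' = m).
    { unfold m', m. rewrite H3, H4.
      transitivity (k ^ 2 * (1 + e ^ 2) * (c ^ 2 + d ^ 2)); [ring|].
      rewrite He. replace (k ^ 2 * (1 + 1)) with (2 * k ^ 2) by ring. rewrite Hk; ring. }
    rewrite Em in *. split.
    + f_equal. f_equal. rewrite H1, H2, H3, H4.
      transitivity (k ^ 2 * (1 + e ^ 2) * (A * c + B * d)).
      * rewrite He. replace (k ^ 2 * (1 + 1)) with (2 * k ^ 2) by ring. rewrite Hk; ring.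
      * ring.
    + field_simplify_eq; [|lra]. rewrite H3, H4.
      transitivity (k ^ 2 * (1 - e ^ 2) * (d ^ 2 + c ^ 2) ^ 2); [ring|]. rewrite He; ring.
Qed.

Lemma Derive_shift f s t : Derive (fun u => f (s + u)) t = Derive f (s + t).
Proof.
  unfold Derive. f_equal. apply Lim_ext. intros h. do 2 f_equal. f_equal. lra.
Qed.

Lemma orthogonal_at_dil g s h t :
  orthogonal_at g s h t <-> quarter_turn (sl2_mul g (dil s)) (sl2_mul h (dil t)).
Proof.
  rewrite <- orthogonal_at_0. unfold orthogonal_at. rewrite !geod_dil, !Rplus_0_r.
  rewrite !(Derive_ext (fun u => Re (geod (sl2_mul _ (dil _)) u)) _ _
     (fun u => f_equal Re (geod_dil _ _ u))).
  rewrite !(Derive_ext (fun u => Im (geod (sl2_mul _ (dil _)) u)) _ _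
     (fun u => f_equal Im (geod_dil _ _ u))).
  rewrite (Derive_shift (fun u => Re (geod g u))), (Derive_shift (fun u => Re (geod h u))),
    (Derive_shift (fun u => Im (geod g u))), (Derive_shift (fun u => Im (geod h u))), !Rplus_0_r.
  reflexivity.
Qed.

Lemma quarter_turn_mul k g h : quarter_turn g h -> quarter_turn (sl2_mul k g) (sl2_mul k h).
Proof.
  intros (x & e & Hx & He & H1 & H2 & H3 & H4). exists x, e.
  cbn [sl2_mul ma mb mc md]. rewrite H1, H2, H3, H4.
  repeat split; try assumption; ring.
Qed.

Lemma quarter_turn_peq g g' h h' :
  peq g g' -> peq h h' -> quarter_turn g h -> quarter_turn g' h'.
Proof.
  intros Hg Hh (x & e & Hx & He & H1 & H2 & H3 & H4).
  destruct Hg as (s & Hs & S1 & S2 & S3 & S4).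
  destruct (peq_sym _ _ Hh) as (t & Ht & T1 & T2 & T3 & T4).
  exists (s * t * x), e.
  rewrite T1, T2, T3, T4, H1, H2, H3, H4, S1, S2, S3, S4.
  repeat split; try assumption; try ring.
  transitivity (s ^ 2 * t ^ 2 * (2 * x ^ 2)); [ring|]. rewrite Hs, Ht, Hx; ring.
Qed.

Lemma quarter_turn_sym g h : quarter_turn g h -> quarter_turn h g.
Proof.
  intros (x & e & Hx & He & H1 & H2 & H3 & H4). exists x, (- e).
  rewrite H1, H2, H3, H4.
  repeat split; try assumption; try (rewrite <- He; ring).
  - transitivity (2 * x ^ 2 * ma g * (1 + e ^ 2) / 2); [rewrite Hx, He; field | field].
  - transitivity (2 * x ^ 2 * mb g * (1 + e ^ 2) / 2); [rewrite Hx, He; field | field].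
  - transitivity (2 * x ^ 2 * mc g * (1 + e ^ 2) / 2); [rewrite Hx, He; field | field].
  - transitivity (2 * x ^ 2 * md g * (1 + e ^ 2) / 2); [rewrite Hx, He; field | field].
Qed.

Lemma orthogonal_at_mul k g s h t :
  orthogonal_at g s h t -> orthogonal_at (sl2_mul k g) s (sl2_mul k h) t.
Proof.
  rewrite !orthogonal_at_dil, <- !sl2_mul_assoc. apply quarter_turn_mul.
Qed.

Lemma orthogonal_at_peq g g' s h h' t :
  peq g g' -> peq h h' -> orthogonal_at g s h t -> orthogonal_at g' s h' t.
Proof.
  rewrite !orthogonal_at_dil. intros Hg Hh.
  apply quarter_turn_peq; apply peq_mul; auto using peq_refl.
Qed.

(** * Ideal points as lines in the plane *)

(** [SL2] acts linearly on the lines of the plane, so that the relative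
    position of ideal points is expressed by determinants, without a special
    case for infinity. *)
Definition vec (x : ideal) : R * R := match x with Some t => (t, 1) | None => (1, 0) end.

Definition line_of (v : R * R) : ideal :=
  if Req_EM_T (snd v) 0 then None else Some (fst v / snd v).

Definition act (g : SL2) (v : R * R) : R * R :=
  (ma g * fst v + mb g * snd v, mc g * fst v + md g * snd v).

Definition det2 (v w : R * R) : R := fst v * snd w - snd v * fst w.

Lemma det2_act g v w : det2 (act g v) (act g w) = det2 v w.
Proof.
  unfold det2, act; cbn [fst snd].
  transitivity ((ma g * md g - mb g * mc g) * (fst v * snd w - snd v * fst w)); [ring|].
  rewrite sl2_det; ring.
Qed.

Lemma det2_anti v w : det2 v w = - det2 w v.
Proof. unfold det2; ring. Qed.

Lemma act_mul g h v : act (sl2_mul g h) v = act g (act h v).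
Proof. unfold act; cbn [sl2_mul ma mb mc md fst snd]. f_equal; ring. Qed.

Lemma act_nonzero g v : v <> (0, 0) -> act g v <> (0, 0).
Proof.
  intros H E. apply H.
  assert (K : act (sl2_inv g) (act g v) = v).
  { rewrite <- act_mul, sl2_mul_invl. destruct v; unfold act; cbn. f_equal; ring. }
  rewrite <- K, E. unfold act; cbn. f_equal; ring.
Qed.

Lemma vec_nonzero x : vec x <> (0, 0).
Proof. destruct x as [t|]; cbn; intros E; injection E; intros; lra. Qed.

Lemma mob_ideal_line g x : mob_ideal g x = line_of (act g (vec x)).
Proof.
  destruct x as [t|]; unfold mob_ideal, line_of, act; cbn [vec fst snd].
  - rewrite !Rmult_1_r. reflexivity.
  - rewrite !Rmult_1_r, !Rmult_0_r, !Rplus_0_r. reflexivity.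
Qed.

Lemma vec_line_of v : v <> (0, 0) ->
  exists l, l <> 0 /\ v = (l * fst (vec (line_of v)), l * snd (vec (line_of v))).
Proof.
  intros H. unfold line_of. destruct v as [x y]; cbn [fst snd] in *.
  destruct (Req_EM_T y 0) as [E|E]; cbn [vec fst snd].
  - exists x. split; [intros F; apply H; congruence|]. rewrite E; f_equal; ring.
  - exists y. split; [assumption|]. f_equal; field; assumption.
Qed.

Lemma line_of_eq v w : v <> (0, 0) -> w <> (0, 0) -> line_of v = line_of w <-> det2 v w = 0.
Proof.
  intros Hv Hw. destruct v as [x y], w as [x' y']; unfold line_of, det2; cbn [fst snd].
  destruct (Req_EM_T y 0) as [E|E], (Req_EM_T y' 0) as [E'|E'].
  - subst. split; [intros _; ring | reflexivity].
  - subst. split; [discriminate|]. intros K. exfalso. apply Hv. f_equal.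
    rewrite Rmult_0_l, Rminus_0_r in K. apply Rmult_integral in K. tauto.
  - subst. split; [discriminate|]. intros K. exfalso. apply Hw. f_equal.
    rewrite Rmult_0_r in K. assert (y * x' = 0) by lra. apply Rmult_integral in H. tauto.
  - split.
    + intros K. injection K as K. apply (f_equal (fun z => z * (y * y'))) in K.
      field_simplify in K; [lra | assumption | assumption].
    + intros K. f_equal. field_simplify_eq; [lra | tauto].
Qed.

Lemma line_of_vec x : line_of (vec x) = x.
Proof.
  destruct x as [t|]; unfold line_of; cbn [vec fst snd].
  - destruct (Req_EM_T 1 0); [lra|]. f_equal; field.
  - destruct (Req_EM_T 0 0); [reflexivity|lra].
Qed.

Lemma line_of_scale l v : l <> 0 -> line_of (l * fst v, l * snd v) = line_of v.
Proof.
  intros Hl. unfold line_of; cbn [fst snd].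
  destruct (Req_EM_T (l * snd v) 0) as [E|E], (Req_EM_T (snd v) 0) as [F|F]; try reflexivity.
  - apply Rmult_integral in E. tauto.
  - rewrite F in E. lra.
  - f_equal. field. tauto.
Qed.

Lemma line_of_act g v : v <> (0, 0) -> mob_ideal g (line_of v) = line_of (act g v).
Proof.
  intros Hv. destruct (vec_line_of v Hv) as (l & Hl & E).
  rewrite mob_ideal_line. rewrite E at 2.
  rewrite <- (line_of_scale l) by assumption. f_equal.
  unfold act; cbn [fst snd]. f_equal; ring.
Qed.

Lemma mob_ideal_mul g h x : mob_ideal (sl2_mul g h) x = mob_ideal g (mob_ideal h x).
Proof.
  rewrite (mob_ideal_line h x), line_of_act, mob_ideal_line, act_mul; auto.
  apply act_nonzero, vec_nonzero.
Qed.

Lemma mob_ideal_peq g h x : peq g h -> mob_ideal g x = mob_ideal h x.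
Proof.
  intros (s & Hs & H1 & H2 & H3 & H4). rewrite !mob_ideal_line.
  rewrite <- (line_of_scale s (act h (vec x))).
  - f_equal. unfold act; cbn [fst snd]. rewrite H1, H2, H3, H4. f_equal; ring.
  - intros E. rewrite E in Hs. lra.
Qed.

Lemma gend_line g : gend g = line_of (ma g, mc g).
Proof.
  unfold gend. rewrite mob_ideal_line. f_equal. unfold act; cbn. f_equal; ring.
Qed.

Lemma gstart_line g : gstart g = line_of (mb g, md g).
Proof.
  unfold gstart. rewrite mob_ideal_line. f_equal. unfold act; cbn. f_equal; ring.
Qed.

Lemma gend_mul g h : gend (sl2_mul g h) = mob_ideal g (gend h).
Proof. apply mob_ideal_mul. Qed.

Lemma gstart_mul g h : gstart (sl2_mul g h) = mob_ideal g (gstart h).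
Proof. apply mob_ideal_mul. Qed.

Lemma col1_nonzero g : (ma g, mc g) <> (0, 0).
Proof. intros E. injection E as E1 E2. pose proof (sl2_det g). rewrite E1, E2 in H. lra. Qed.

Lemma col2_nonzero g : (mb g, md g) <> (0, 0).
Proof. intros E. injection E as E1 E2. pose proof (sl2_det g). rewrite E1, E2 in H. lra. Qed.

(** * The cyclic order of ideal points *)

Lemma Rmult3_sign a b c : 0 < a * b * c ->
  (0 < a /\ 0 < b /\ 0 < c) \/ (0 < a /\ b < 0 /\ c < 0) \/
  (a < 0 /\ 0 < b /\ c < 0) \/ (a < 0 /\ b < 0 /\ 0 < c).
Proof.
  intros H.
  destruct (Rtotal_order a 0) as [A|[A|A]], (Rtotal_order b 0) as [B|[B|B]],
    (Rtotal_order c 0) as [K|[K|K]]; subst; try tauto; exfalso; try lra.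
  - assert (0 < a * b) by nra. nra.
  - assert (a * b < 0) by nra. nra.
  - assert (a * b < 0) by nra. nra.
  - assert (0 < a * b) by nra. nra.
Qed.

(** Three reals are in cyclic order when the product of their cyclic
    differences is positive. *)
Lemma cyclic_det2 x y z : cyclic Rlt x y z <->
  0 < det2 (vec x) (vec y) * det2 (vec y) (vec z) * det2 (vec z) (vec x).
Proof.
  unfold cyclic, opt_lt, det2.
  destruct x as [x|], y as [y|], z as [z|]; cbn [vec fst snd]; split; intros H;
    try (apply Rmult3_sign in H); try lra;
  repeat match goal with
  | H : _ \/ _ |- _ => destruct H as [H|H]
  | H : _ /\ _ |- _ => destruct H
  end; try lra; try tauto.
  - assert (0 < (y - x) * (z - y)) by (apply Rmult_lt_0_compat; lra).
    assert (0 < (y - x) * (z - y) * (z - x)) by (apply Rmult_lt_0_compat; lra). nra.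
  - assert (0 < (z - y) * (x - z)) by (apply Rmult_lt_0_compat; lra).
    assert (0 < (z - y) * (x - z) * (x - y)) by (apply Rmult_lt_0_compat; lra). nra.
  - assert (0 < (x - z) * (y - x)) by (apply Rmult_lt_0_compat; lra).
    assert (0 < (x - z) * (y - x) * (y - z)) by (apply Rmult_lt_0_compat; lra). nra.
Qed.

Lemma cyclic_line u v w : u <> (0, 0) -> v <> (0, 0) -> w <> (0, 0) ->
  cyclic Rlt (line_of u) (line_of v) (line_of w) <-> 0 < det2 u v * det2 v w * det2 w u.
Proof.
  intros Hu Hv Hw. rewrite cyclic_det2.
  destruct (vec_line_of u Hu) as (a & Ha & Eu), (vec_line_of v Hv) as (b & Hb & Ev),
    (vec_line_of w Hw) as (c & Hc & Ew).
  set (u' := vec (line_of u)) in *. set (v' := vec (line_of v)) in *.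
  set (w' := vec (line_of w)) in *. clearbody u' v' w'. rewrite Eu, Ev, Ew.
  unfold det2; cbn [fst snd].
  set (X := (fst u' * snd v' - snd u' * fst v') * (fst v' * snd w' - snd v' * fst w') *
    (fst w' * snd u' - snd w' * fst u')).
  replace ((a * fst u' * (b * snd v') - a * snd u' * (b * fst v')) *
    (b * fst v' * (c * snd w') - b * snd v' * (c * fst w')) *
    (c * fst w' * (a * snd u') - c * snd w' * (a * fst u')))
    with ((a * b * c) ^ 2 * X) by (unfold X; ring).
  assert (0 < (a * b * c) ^ 2).
  { apply pow2_gt_0. repeat apply Rmult_integral_contrapositive_currified; assumption. }
  split; intros; nra.
Qed.

Lemma cyclic_mob g x y z :
  cyclic Rlt (mob_ideal g x) (mob_ideal g y) (mob_ideal g z) <-> cyclic Rlt x y z.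
Proof.
  rewrite !mob_ideal_line, cyclic_line, cyclic_det2, !det2_act; try reflexivity;
    apply act_nonzero, vec_nonzero.
Qed.

(** * Feet of perpendiculars and shears *)

(** In the chart where [geod g] runs from [0] to infinity, the perpendicular
    from [x] meets it at height [|x|], and the two determinants are homogeneous
    coordinates of [x]. *)
Lemma foot_det2 g x t : foot g x t <->
  x <> gstart g /\ x <> gend g /\
  Rabs (det2 (mb g, md g) (vec x)) = exp t * Rabs (det2 (ma g, mc g) (vec x)).
Proof.
  set (E := exp (t / 2)). set (F := exp (- (t / 2))).
  assert (EF : E * F = 1) by apply exp_mul_opp.
  assert (E0 : 0 < E) by apply exp_pos. assert (F0 : 0 < F) by apply exp_pos.
  assert (EE : E * E = exp t) by apply exp_half.
  pose proof (sl2_det g) as Dg.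
  split.
  - intros (h & s & Ho & Hx). apply orthogonal_at_dil in Ho.
    destruct Ho as (k & e & Hk & He & H1 & _ & H3 & _).
    cbn [sl2_mul dil ma mb mc md] in H1, H3. fold E F in H1, H3.
    rewrite !Rmult_0_r, !Rplus_0_r, !Rplus_0_l in H1, H3.
    set (W := (ma h * exp (s / 2), mc h * exp (s / 2))).
    assert (Hs : 0 < exp (s / 2)) by apply exp_pos.
    assert (WW : W <> (0, 0)).
    { intros K. injection K as K1 K2. apply (col1_nonzero h). f_equal; nra. }
    assert (XW : x = line_of W).
    { rewrite <- Hx, gend_line. unfold W.
      rewrite <- (line_of_scale (exp (s / 2))) by lra. f_equal; cbn [fst snd]. f_equal; ring. }
    destruct (vec_line_of W WW) as (l & Hl & EW).
    rewrite <- XW in EW.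
    assert (K0 : k <> 0) by (intros K; rewrite K in Hk; lra).
    assert (e0 : e <> 0) by (intros K; rewrite K in He; lra).
    assert (D2 : det2 (mb g, md g) W = - k * E).
    { unfold det2, W; cbn [fst snd]. rewrite H1, H3.
      transitivity (- k * E * (ma g * md g - mb g * mc g)); [ring|]. rewrite Dg; ring. }
    assert (D1 : det2 (ma g, mc g) W = - e * k * F).
    { unfold det2, W; cbn [fst snd]. rewrite H1, H3.
      transitivity (- e * k * F * (ma g * md g - mb g * mc g)); [ring|]. rewrite Dg; ring. }
    repeat split.
    + rewrite XW, gstart_line. intros K. apply eq_sym, line_of_eq in K; auto using col2_nonzero.
      rewrite D2 in K. nra.
    + rewrite XW, gend_line. intros K. apply eq_sym, line_of_eq in K; auto using col1_nonzero.
      rewrite D1 in K. assert (e * k <> 0) by (apply Rmult_integral_contrapositive_currified; assumption).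
      nra.
    + assert (Q : forall v, det2 v W = l * det2 v (vec x)).
      { intros v. rewrite EW. unfold det2; cbn [fst snd]. ring. }
      rewrite Q in D1, D2.
      assert (AE : Rabs e = 1).
      { rewrite <- (sqrt_Rsqr_abs e). unfold Rsqr. replace (e * e) with 1 by nra. apply sqrt_1. }
      apply (Rmult_eq_reg_l (Rabs l)); [|apply Rabs_no_R0; assumption].
      rewrite <- Rabs_mult, D2.
      transitivity (exp t * Rabs (l * det2 (ma g, mc g) (vec x))).
      2:{ rewrite Rabs_mult. ring. }
      rewrite D1, !Rabs_mult, !Rabs_Ropp, (Rabs_pos_eq E), (Rabs_pos_eq F), AE by lra.
      rewrite <- EE. transitivity (Rabs k * E * (E * F)); [rewrite EF|]; ring.
  - intros (N1 & N2 & HE).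
    set (p := det2 (ma g, mc g) (vec x)) in *. set (q := det2 (mb g, md g) (vec x)) in *.
    assert (P0 : p <> 0).
    { intros K. apply N2. rewrite gend_line, <- (line_of_vec x).
      apply eq_sym, line_of_eq; auto using col1_nonzero, vec_nonzero. }
    assert (Q0 : q <> 0).
    { intros K. apply N1. rewrite gstart_line, <- (line_of_vec x).
      apply eq_sym, line_of_eq; auto using col2_nonzero, vec_nonzero. }
    set (e := E * E * p / q).
    assert (He : e ^ 2 = 1).
    { unfold e. assert (K : q ^ 2 = (E * E * p) ^ 2).
      { rewrite EE, <- (pow2_abs q), <- (pow2_abs (exp t * p)), Rabs_mult, HE.
        rewrite (Rabs_pos_eq (exp t)) by (left; apply exp_pos). reflexivity. }
      apply (Rmult_eq_reg_r (q ^ 2)); [|apply pow_nonzero; assumption].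
      rewrite Rmult_1_l, K at 1.
      unfold Rdiv. rewrite Rpow_mult_distr, Rmult_assoc.
      rewrite <- K, <- Rpow_mult_distr. rewrite Rinv_l by assumption. ring. }
    set (k := / sqrt 2).
    assert (Hk : 2 * k ^ 2 = 1).
    { unfold k. assert (S : 0 < sqrt 2) by (apply sqrt_lt_R0; lra).
      replace (2 * (/ sqrt 2) ^ 2) with (2 / (sqrt 2 * sqrt 2)) by (field; lra).
      rewrite sqrt_sqrt by lra. field. }
    assert (Dh : k * (ma g * E - e * (mb g * F)) * (k * (e * (mc g * E) + md g * F))
      - k * (e * (ma g * E) + mb g * F) * (k * (mc g * E - e * (md g * F))) = 1).
    { transitivity (k ^ 2 * (1 + e ^ 2) * (E * F) * (ma g * md g - mb g * mc g)); [ring|].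
      rewrite Dg, EF, He. replace (k ^ 2 * (1 + 1)) with (2 * k ^ 2) by ring. rewrite Hk; ring. }
    exists (mkSL2 _ _ _ _ Dh), 0. split.
    + apply orthogonal_at_dil. exists k, e.
      cbn [sl2_mul dil ma mb mc md]. fold E F.
      replace (- (0 / 2)) with 0 by lra. replace (0 / 2) with 0 by lra. rewrite exp_0.
      repeat split; try assumption; ring.
    + rewrite gend_line. cbn [ma mc]. rewrite <- (line_of_vec x).
      assert (K0 : k <> 0) by (intros K; rewrite K in Hk; lra).
      apply line_of_eq; [ | apply vec_nonzero |].
      * intros K. injection K as K1 K2.
        assert (R1 : ma g * E - e * (mb g * F) = 0)
          by (apply Rmult_integral in K1; tauto).
        assert (R2 : mc g * E - e * (md g * F) = 0)
          by (apply Rmult_integral in K2; tauto).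
        assert (E * (ma g * md g - mb g * mc g) = 0).
        { transitivity (md g * (ma g * E - e * (mb g * F)) - mb g * (mc g * E - e * (md g * F))); [ring|].
          rewrite R1, R2; ring. }
        rewrite Dg in H. lra.
      * transitivity (k * (E * p - e * F * q)).
        { unfold p, q, det2; cbn [fst snd]. ring. }
        unfold e. replace (E * E * p / q * F * q) with (E * p * (E * F)) by (field; assumption).
        rewrite EF. ring.
Qed.

Lemma exp_pos_neq t : exp t <> 0.
Proof. pose proof (exp_pos t). lra. Qed.

(** The shear of the ideal triangles [(a, b, u)] and [(a, b, u')] is the
    logarithm of a cross-ratio: both feet are given by [foot_det2], and the
    scales of the vectors that represent the ends of [g] cancel. *)
Lemma shear_cross_ratio a b u u' s :
  a <> (0, 0) -> b <> (0, 0) -> u <> (0, 0) -> u' <> (0, 0) ->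
  det2 a b <> 0 -> det2 a u <> 0 -> det2 b u <> 0 -> det2 a u' <> 0 -> det2 b u' <> 0 ->
  (exists g t t', gstart g = line_of a /\ gend g = line_of b /\
     foot g (line_of u) t /\ foot g (line_of u') t' /\ s = t' - t) <->
  s = ln (Rabs (det2 a u' * det2 b u / (det2 a u * det2 b u'))).
Proof.
  intros A0 B0 U0 U0' Hab Hau Hbu Hau' Hbu'.
  set (Z := Rabs (det2 a u' * det2 b u / (det2 a u * det2 b u'))).
  assert (Z0 : 0 < Z).
  { apply Rabs_pos_lt. apply Rmult_integral_contrapositive_currified.
    - apply Rmult_integral_contrapositive_currified; assumption.
    - apply Rinv_neq_0_compat. apply Rmult_integral_contrapositive_currified; assumption. }
  assert (Key : forall g l m w t, l <> 0 -> m <> 0 ->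
    a = (l * mb g, l * md g) -> b = (m * ma g, m * mc g) ->
    w <> (0, 0) -> det2 a w <> 0 -> det2 b w <> 0 ->
    (foot g (line_of w) t <-> exp t = Rabs (det2 a w / det2 b w) * Rabs (m / l))).
  { intros g l m w t Hl Hm Ea Eb W0 Haw Hbw.
    destruct (vec_line_of w W0) as (n & Hn & Ew).
    assert (Qa : det2 a w = l * n * det2 (mb g, md g) (vec (line_of w))).
    { rewrite Ea. rewrite Ew at 1. unfold det2; cbn [fst snd]. ring. }
    assert (Qb : det2 b w = m * n * det2 (ma g, mc g) (vec (line_of w))).
    { rewrite Eb. rewrite Ew at 1. unfold det2; cbn [fst snd]. ring. }
    set (da := det2 (mb g, md g) (vec (line_of w))) in *.
    set (db := det2 (ma g, mc g) (vec (line_of w))) in *.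
    assert (da0 : da <> 0) by (intros K; rewrite K in Qa; lra).
    assert (db0 : db <> 0) by (intros K; rewrite K in Qb; lra).
    rewrite foot_det2. fold da db. rewrite Qa, Qb, <- Rabs_mult.
    replace (l * n * da / (m * n * db) * (m / l)) with (da / db) by (field; tauto).
    rewrite Rabs_div by assumption.
    pose proof (Rabs_no_R0 db db0) as db1.
    split.
    - intros (_ & _ & K). rewrite K. field. assumption.
    - intros K. repeat split.
      + rewrite gstart_line. intros N. apply Haw. rewrite Qa.
        apply line_of_eq in N; auto using col2_nonzero.
        assert (M : det2 w (mb g, md g) = - (n * da)).
        { rewrite Ew at 1. unfold da, det2; cbn [fst snd]. ring. }
        assert (n * da <> 0) by (apply Rmult_integral_contrapositive_currified; assumption).
        rewrite M in N. lra.
      + rewrite gend_line. intros N. apply Hbw. rewrite Qb.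
        apply line_of_eq in N; auto using col1_nonzero.
        assert (M : det2 w (ma g, mc g) = - (n * db)).
        { rewrite Ew at 1. unfold db, det2; cbn [fst snd]. ring. }
        assert (n * db <> 0) by (apply Rmult_integral_contrapositive_currified; assumption).
        rewrite M in N. lra.
      + rewrite K. field. assumption. }
  assert (Comp : forall g l m t t', l <> 0 -> m <> 0 ->
    a = (l * mb g, l * md g) -> b = (m * ma g, m * mc g) ->
    foot g (line_of u) t -> foot g (line_of u') t' -> t' - t = ln Z).
  { intros g l m t t' Hl Hm Ea Eb Ft Ft'.
    apply (Key g l m) in Ft; auto. apply (Key g l m) in Ft'; auto.
    rewrite <- (ln_exp (t' - t)). f_equal.
    unfold Rminus. rewrite exp_plus, exp_Ropp, Ft, Ft'. unfold Z.
    rewrite !Rabs_div, !Rabs_mult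
      by (try assumption; apply Rmult_integral_contrapositive_currified; assumption).
    pose proof (Rabs_no_R0 _ Hau). pose proof (Rabs_no_R0 _ Hbu).
    pose proof (Rabs_no_R0 _ Hau'). pose proof (Rabs_no_R0 _ Hbu').
    pose proof (Rabs_no_R0 _ Hl). pose proof (Rabs_no_R0 _ Hm).
    field. repeat split; assumption. }
  split.
  - intros (g & t & t' & Ga & Gb & Ft & Ft' & ->).
    rewrite gstart_line in Ga. rewrite gend_line in Gb.
    destruct (vec_line_of a A0) as (l & Hl & Ea), (vec_line_of b B0) as (m & Hm & Eb).
    destruct (vec_line_of _ (col2_nonzero g)) as (l' & Hl' & Ea').
    destruct (vec_line_of _ (col1_nonzero g)) as (m' & Hm' & Eb').
    rewrite Ga in Ea'. rewrite Gb in Eb'. injection Ea' as Ea1 Ea2. injection Eb' as Eb1 Eb2.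
    apply (Comp g (l / l') (m / m')); auto.
    + unfold Rdiv. apply Rmult_integral_contrapositive_currified; auto using Rinv_neq_0_compat.
    + unfold Rdiv. apply Rmult_integral_contrapositive_currified; auto using Rinv_neq_0_compat.
    + rewrite Ea at 1. rewrite Ea1, Ea2. f_equal; field; assumption.
    + rewrite Eb at 1. rewrite Eb1, Eb2. f_equal; field; assumption.
  - intros ->.
    assert (D : fst b / det2 b a * snd a - fst a * (snd b / det2 b a) = 1).
    { unfold det2 in *. field. intros K. apply Hab. lra. }
    assert (Hba : det2 b a <> 0) by (rewrite det2_anti; lra).
    set (g := mkSL2 _ _ _ _ D).
    assert (Ea : a = (1 * mb g, 1 * md g)) by (destruct a; cbn; f_equal; ring).
    assert (Eb : b = (det2 b a * ma g, det2 b a * mc g)).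
    { destruct b; cbn [g ma mc fst snd]. f_equal; field; assumption. }
    assert (One : (1 : R) <> 0) by lra.
    assert (Pos : forall x, x <> 0 -> 0 < Rabs x * Rabs (det2 b a / 1)).
    { intros x Hx. apply Rmult_lt_0_compat; apply Rabs_pos_lt; [assumption|].
      rewrite Rdiv_1_r. assumption. }
    assert (Hq : forall w, det2 a w <> 0 -> det2 b w <> 0 -> det2 a w / det2 b w <> 0).
    { intros w H1 H2. apply Rmult_integral_contrapositive_currified; auto using Rinv_neq_0_compat. }
    set (t := ln (Rabs (det2 a u / det2 b u) * Rabs (det2 b a / 1))).
    set (t' := ln (Rabs (det2 a u' / det2 b u') * Rabs (det2 b a / 1))).
    assert (Ft : foot g (line_of u) t).
    { apply (Key g 1 (det2 b a)); auto. unfold t. rewrite exp_ln; auto. }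
    assert (Ft' : foot g (line_of u') t').
    { apply (Key g 1 (det2 b a)); auto. unfold t'. rewrite exp_ln; auto. }
    exists g, t, t'. repeat split; auto.
    + rewrite gstart_line. f_equal. destruct a; reflexivity.
    + rewrite gend_line. transitivity (line_of (det2 b a * ma g, det2 b a * mc g)).
      * symmetry. apply (line_of_scale _ (ma g, mc g)). assumption.
      * f_equal. symmetry. exact Eb.
    + symmetry. apply (Comp g 1 (det2 b a)); auto.
Qed.

(** * Continuity of explicit maps *)

Lemma ct_plus {U : UniformSpace} (f g : U -> R) x :
  continuous f x -> continuous g x -> continuous (fun u => f u + g u) x.
Proof. exact (continuous_plus (K := R_AbsRing) (V := R_NormedModule) f g x). Qed.

Lemma ct_opp {U : UniformSpace} (f : U -> R) x :
  continuous f x -> continuous (fun u => - f u) x.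
Proof. exact (continuous_opp (K := R_AbsRing) (V := R_NormedModule) f x). Qed.

Lemma ct_minus {U : UniformSpace} (f g : U -> R) x :
  continuous f x -> continuous g x -> continuous (fun u => f u - g u) x.
Proof. intros. apply ct_plus; [|apply ct_opp]; assumption. Qed.

Lemma ct_mult {U : UniformSpace} (f g : U -> R) x :
  continuous f x -> continuous g x -> continuous (fun u => f u * g u) x.
Proof. exact (continuous_mult (K := R_AbsRing) f g x). Qed.

Lemma ct_real {U : UniformSpace} (h : R -> R) (f : U -> R) x :
  continuous f x -> continuous h (f x) -> continuous (fun u => h (f u)) x.
Proof. intros. exact (continuous_comp f h x H H0). Qed.

Lemma ct_inv {U : UniformSpace} (f : U -> R) x :
  f x <> 0 -> continuous f x -> continuous (fun u => / f u) x.
Proof. intros. apply (ct_real Rinv); [assumption|]. apply continuous_Rinv; assumption. Qed.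

Lemma ct_div {U : UniformSpace} (f g : U -> R) x :
  g x <> 0 -> continuous f x -> continuous g x -> continuous (fun u => f u / g u) x.
Proof. intros. apply ct_mult; [|apply ct_inv]; assumption. Qed.

Lemma ct_sqrt {U : UniformSpace} (f : U -> R) x :
  continuous f x -> continuous (fun u => sqrt (f u)) x.
Proof. intros. apply (ct_real sqrt); [assumption|]. apply continuous_sqrt. Qed.

Lemma ct_exp {U : UniformSpace} (f : U -> R) x :
  continuous f x -> continuous (fun u => exp (f u)) x.
Proof. intros. apply (ct_real exp); [assumption|]. apply continuous_exp. Qed.

Lemma ct_const {U : UniformSpace} (c : R) (x : U) : continuous (fun _ => c) x.
Proof. apply continuous_const. Qed.

Lemma ct_pow {U : UniformSpace} (f : U -> R) n x :
  continuous f x -> continuous (fun u => f u ^ n) x.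
Proof.
  intros. induction n as [|n IH]; cbn [pow].
  - apply ct_const.
  - apply ct_mult; assumption.
Qed.

Lemma ct_pair {U : UniformSpace} (f g : U -> R) x :
  continuous f x -> continuous g x -> continuous (fun u => (f u, g u) : C) x.
Proof.
  intros Hf Hg. apply (filterlim_filter_le_2 (G := filter_prod (locally (f x)) (locally (g x)))).
  - intros P [eps H]. exists (fun u => ball (f x) eps u) (fun u => ball (g x) eps u).
    + exists eps; auto.
    + exists eps; auto.
    + intros u v Hu Hv. apply H. split; assumption.
  - apply filterlim_pair; assumption.
Qed.

Lemma ct_re {U : UniformSpace} (f : U -> C) x :
  continuous f x -> continuous (fun u => Re (f u)) x.
Proof.
  intros H. apply (continuous_comp (V := C_UniformSpace) f (fun z : C => fst z) x H).
  destruct (f x). apply (continuous_fst (U := R_UniformSpace) (V := R_UniformSpace)).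
Qed.

Lemma ct_im {U : UniformSpace} (f : U -> C) x :
  continuous f x -> continuous (fun u => Im (f u)) x.
Proof.
  intros H. apply (continuous_comp (V := C_UniformSpace) f (fun z : C => snd z) x H).
  destruct (f x). apply (continuous_snd (U := R_UniformSpace) (V := R_UniformSpace)).
Qed.

(** Continuity of explicit expressions, up to the nonvanishing of
    denominators. *)
Ltac ct :=
  repeat lazymatch goal with
  | |- continuous (fun u => u) _ => apply continuous_id
  | |- continuous (fun u => (@?f u, @?g u)) _ => apply (ct_pair f g)
  | |- continuous (fun u => @?f u + @?g u) _ => apply (ct_plus f g)
  | |- continuous (fun u => @?f u - @?g u) _ => apply (ct_minus f g)
  | |- continuous (fun u => @?f u * @?g u) _ => apply (ct_mult f g)
  | |- continuous (fun u => @?f u / @?g u) _ => apply (ct_div f g)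
  | |- continuous (fun u => - @?f u) _ => apply (ct_opp f)
  | |- continuous (fun u => / @?f u) _ => apply (ct_inv f)
  | |- continuous (fun u => @?f u ^ ?n) _ => apply (ct_pow f n)
  | |- continuous (fun u => sqrt (@?f u)) _ => apply (ct_sqrt f)
  | |- continuous (fun u => exp (@?f u)) _ => apply (ct_exp f)
  | |- continuous (fun u => Re (@?f u)) _ => apply (ct_re f)
  | |- continuous (fun u => Im (@?f u)) _ => apply (ct_im f)
  | |- continuous (fun _ => ?c) _ => apply (ct_const c)
  | |- continuous _ _ => assumption
  end.

Lemma continuous_locally_ext {U V : UniformSpace} (f g : U -> V) x :
  locally x (fun u => f u = g u) -> f x = g x -> continuous f x -> continuous g x.
Proof.
  intros H E Hf. unfold continuous. rewrite <- E.
  apply (filterlim_ext_loc f); assumption.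
Qed.

Lemma continuous_pos_locally {U : UniformSpace} (f : U -> R) x :
  continuous f x -> 0 < f x -> locally x (fun u => 0 < f u).
Proof.
  intros H P. apply H. exists (mkposreal _ P). intros y Hy.
  unfold ball in Hy; cbn in Hy. unfold AbsRing_ball, abs, minus, plus, opp in Hy; cbn in Hy.
  apply Rabs_def2 in Hy. lra.
Qed.

Lemma continuous_mob g z : 0 < Im z -> continuous (mob g) z.
Proof.
  intros Hz.
  assert (Ci : continuous (fun u : C => u) z) by apply continuous_id.
  apply (continuous_locally_ext (fun z : C =>
     ((ma g * mc g * (Re z ^ 2 + Im z ^ 2)
              + (ma g * md g + mb g * mc g) * Re z + mb g * md g) / nrm g z,
             Im z / nrm g z) : C)).
  - assert (L : locally z (fun u : C => 0 < Im u)).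
    { apply continuous_pos_locally; [|assumption]. apply (ct_im (fun u : C => u)). assumption. }
    revert L. apply filter_imp. intros u Hu. symmetry. apply mob_coord, Hu.
  - symmetry. apply mob_coord, Hz.
  - pose proof (nrm_pos g z Hz). unfold nrm in *. ct; cbv beta; lra.
Qed.

Lemma continuous_geod g t : continuous (geod g) t.
Proof.
  apply (continuous_comp (fun t => (0, exp t) : C) (mob g)).
  - apply ct_pair; [apply ct_const|apply continuous_exp].
  - apply continuous_mob, exp_pos.
Qed.

Lemma continuous_within {U V : UniformSpace} (D : U -> Prop) (f : U -> V) x :
  continuous f x -> filterlim f (within D (locally x)) (locally (f x)).
Proof.
  intros H P HP. specialize (H P HP). unfold filtermap, within in *.
  revert H. apply filter_imp. auto.
Qed.

Definition clamp (a b x : R) : R := Rmax a (Rmin b x).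

Lemma clamp_in a b x : a <= b -> a <= clamp a b x <= b.
Proof.
  intros. unfold clamp, Rmax, Rmin. destruct (Rle_dec b x); destruct Rle_dec; lra.
Qed.

Lemma clamp_id a b x : a <= x <= b -> clamp a b x = x.
Proof.
  intros. unfold clamp, Rmax, Rmin. destruct (Rle_dec b x); destruct Rle_dec; lra.
Qed.

Lemma clamp_lip a b x y : Rabs (clamp a b x - clamp a b y) <= Rabs (x - y).
Proof.
  unfold clamp, Rmax, Rmin. unfold Rabs.
  repeat (destruct Rle_dec); repeat destruct Rcase_abs; lra.
Qed.

Lemma continuous_clamp a b x : continuous (clamp a b) x.
Proof.
  intros P [eps H]. exists eps. intros y Hy. apply H.
  unfold ball in *; cbn in *. unfold AbsRing_ball, abs, minus, plus, opp in *; cbn in *.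
  apply Rle_lt_trans with (2 := Hy). apply clamp_lip.
Qed.

(** Homotopies are only continuous relative to their domain, whence the
    restricted filter; clamping the variable reduces this to the intermediate
    value theorem on the line. *)
Lemma continuous_on_sign (f : R -> R) a b : a <= b ->
  (forall x, a <= x <= b -> filterlim f (within (fun u => a <= u <= b) (locally x)) (locally (f x))) ->
  (forall x, a <= x <= b -> f x <> 0) -> 0 < f a -> 0 < f b.
Proof.
  intros Hab Hf Hn Ha. destruct (Rlt_or_le 0 (f b)) as [L|L]; [assumption|exfalso].
  assert (C1 : continuity (fun x => f (clamp a b x))).
  { intros x. apply continuity_pt_filterlim.
    assert (K := Hf (clamp a b x) (clamp_in a b x Hab)).
    intros P HP. specialize (K P HP).
    pose proof (continuous_clamp a b x _ K) as M. unfold filtermap in *.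
    revert M. apply filter_imp. intros y Hy. apply Hy, clamp_in, Hab. }
  destruct (IVT_gen (fun x => f (clamp a b x)) a b 0 C1) as (x & Hx & E).
  - rewrite !clamp_id by lra. unfold Rmin, Rmax. destruct Rle_dec; lra.
  - rewrite Rmin_left, Rmax_right in Hx by lra. rewrite clamp_id in E by lra. apply (Hn x); lra.
Qed.

(** * Invariance under a change of chart *)

(** [g] carries the universal cover of [X] to that of [Y], matching the marked
    arches with their parametrisations and the generators of the deck groups;
    matrices only matter up to sign. *)
Definition chart (X Y : crown) (g : SL2) : Prop :=
  peq (hol Y) (sl2_mul (sl2_mul g (hol X)) (sl2_inv g)) /\
  peq (arch Y) (sl2_mul g (arch X)).

Lemma chart_sym X Y g : chart X Y g -> chart Y X (sl2_inv g).
Proof.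
  intros [H1 H2]. split.
  - rewrite sl2_inv_inv. apply peq_sym.
    eapply peq_trans.
    + apply peq_mul; [apply peq_mul; [apply peq_refl | exact H1] | apply peq_refl].
    + replace (sl2_mul (sl2_mul (sl2_inv g) (sl2_mul (sl2_mul g (hol X)) (sl2_inv g))) g)
        with (hol X); [apply peq_refl|].
      rewrite !sl2_mul_assoc, sl2_mul_invl, sl2_mul_1l, <- sl2_mul_assoc, sl2_mul_invl, sl2_mul_1r.
      reflexivity.
  - apply peq_sym. eapply peq_trans.
    + apply peq_mul; [apply peq_refl | exact H2].
    + rewrite sl2_mul_assoc, sl2_mul_invl, sl2_mul_1l. apply peq_refl.
Qed.

Lemma conj_npow g h n :
  sl2_npow (sl2_mul (sl2_mul g h) (sl2_inv g)) n = sl2_mul (sl2_mul g (sl2_npow h n)) (sl2_inv g).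
Proof.
  induction n as [|n IH]; cbn [sl2_npow].
  - rewrite sl2_mul_1r, sl2_mul_invr. reflexivity.
  - rewrite IH, !sl2_mul_assoc. do 2 f_equal.
    rewrite <- (sl2_mul_assoc _ (sl2_inv g) g), sl2_mul_invl, sl2_mul_1r. reflexivity.
Qed.

Lemma npow_peq g h n : peq g h -> peq (sl2_npow g n) (sl2_npow h n).
Proof.
  intros H. induction n as [|n IH]; cbn [sl2_npow]; [apply peq_refl | apply peq_mul; assumption].
Qed.

Lemma zpow_peq g h k : peq g h -> peq (sl2_zpow g k) (sl2_zpow h k).
Proof.
  intros H. destruct k; cbn [sl2_zpow]; auto using peq_refl, npow_peq, peq_inv.
Qed.

Lemma conj_zpow g h k :
  sl2_zpow (sl2_mul (sl2_mul g h) (sl2_inv g)) k = sl2_mul (sl2_mul g (sl2_zpow h k)) (sl2_inv g).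
Proof.
  destruct k; cbn [sl2_zpow].
  - rewrite sl2_mul_1r, sl2_mul_invr. reflexivity.
  - apply conj_npow.
  - rewrite <- conj_npow. f_equal. rewrite !sl2_inv_mul, !sl2_inv_inv, sl2_mul_assoc. reflexivity.
Qed.

Lemma chart_deck X Y g k : chart X Y g -> peq (deck Y k) (sl2_mul (sl2_mul g (deck X k)) (sl2_inv g)).
Proof.
  intros [H _]. unfold deck. rewrite <- conj_zpow. apply zpow_peq, H.
Qed.

Lemma chart_deck_mul X Y g k : chart X Y g -> peq (sl2_mul (deck Y k) g) (sl2_mul g (deck X k)).
Proof.
  intros H. eapply peq_trans.
  - apply peq_mul; [apply (chart_deck X Y g k H) | apply peq_refl].
  - rewrite <- sl2_mul_assoc, sl2_mul_invl, sl2_mul_1r. apply peq_refl.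
Qed.

Lemma chart_lift_arch X Y g k : chart X Y g -> peq (lift_arch Y k) (sl2_mul g (lift_arch X k)).
Proof.
  intros H. unfold lift_arch. eapply peq_trans.
  - apply peq_mul; [apply peq_refl | apply H].
  - rewrite !sl2_mul_assoc. apply peq_mul; [apply chart_deck_mul, H | apply peq_refl].
Qed.

Lemma chart_hol X Y g : chart X Y g -> peq (sl2_mul (hol Y) g) (sl2_mul g (hol X)).
Proof.
  intros H. pose proof (chart_deck_mul X Y g 1 H) as K.
  change (deck Y 1) with (sl2_mul (hol Y) sl2_one) in K.
  change (deck X 1) with (sl2_mul (hol X) sl2_one) in K.
  rewrite !sl2_mul_1r in K. exact K.
Qed.

Lemma chart_geod_lift X Y g k t : chart X Y g ->
  geod (lift_arch Y k) t = mob g (geod (lift_arch X k) t).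
Proof.
  intros H. rewrite (geod_peq _ _ t (chart_lift_arch X Y g k H)). apply geod_mul.
Qed.

Lemma chart_geod_arch X Y g t : chart X Y g -> geod (arch Y) t = mob g (geod (arch X) t).
Proof.
  intros [_ H]. rewrite (geod_peq _ _ t H). apply geod_mul.
Qed.

Lemma chart_gend X Y g : chart X Y g -> gend (arch Y) = mob_ideal g (gend (arch X)).
Proof. intros [_ H]. unfold gend. rewrite (mob_ideal_peq _ _ None H). apply gend_mul. Qed.

Lemma chart_gstart X Y g : chart X Y g -> gstart (arch Y) = mob_ideal g (gstart (arch X)).
Proof. intros [_ H]. unfold gstart. rewrite (mob_ideal_peq _ _ _ H). apply gstart_mul. Qed.

Lemma chart_deck_ideal X Y g k x : chart X Y g ->
  mob_ideal (deck Y k) (mob_ideal g x) = mob_ideal g (mob_ideal (deck X k) x).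
Proof.
  intros H. rewrite <- !mob_ideal_mul. apply mob_ideal_peq, chart_deck_mul, H.
Qed.

Lemma chart_hol_ideal X Y g x : chart X Y g ->
  mob_ideal (hol Y) (mob_ideal g x) = mob_ideal g (mob_ideal (hol X) x).
Proof.
  intros H. rewrite <- !mob_ideal_mul. apply mob_ideal_peq, chart_hol, H.
Qed.

Lemma chart_hol_mob X Y g z : chart X Y g -> 0 < Im z ->
  mob (hol Y) (mob g z) = mob g (mob (hol X) z).
Proof.
  intros H Hz. rewrite <- !mob_mul by assumption. apply mob_peq; [assumption|]. apply chart_hol, H.
Qed.

Lemma chart_right_deck X Y g k f z : chart X Y g -> 0 < Im z ->
  right_of (sl2_mul (deck Y k) (sl2_mul g f)) (mob g z) <-> right_of (sl2_mul (deck X k) f) z.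
Proof.
  intros H Hz. rewrite sl2_mul_assoc.
  rewrite (right_of_peq _ (sl2_mul (sl2_mul g (deck X k)) f)).
  - rewrite <- sl2_mul_assoc. apply right_of_mob, Hz.
  - apply peq_mul; [apply chart_deck_mul, H | apply peq_refl].
Qed.

Lemma mob_inj g z w : 0 < Im z -> 0 < Im w -> mob g z = mob g w -> z = w.
Proof.
  intros Hz Hw H. rewrite <- (mob_invl g z), <- (mob_invl g w), H by assumption. reflexivity.
Qed.

Lemma cover_im X z : cover X z -> 0 < Im z.
Proof. intros [H _]. exact H. Qed.

Lemma chart_cover_iff X Y g z : chart X Y g -> 0 < Im z -> cover Y (mob g z) <-> cover X z.
Proof.
  intros H Hz. unfold cover.
  assert (E : forall k, right_of (lift_arch Y k) (mob g z) <-> right_of (lift_arch X k) z).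
  { intros k. rewrite (right_of_peq _ _ _ (chart_lift_arch X Y g k H)). apply right_of_mob, Hz. }
  split; intros [_ K]; (split; [auto using mob_im_pos|]); intros k; specialize (K k); rewrite E in *; exact K.
Qed.

Lemma chart_cover X Y g z : chart X Y g -> cover X z -> cover Y (mob g z).
Proof. intros H K. apply (chart_cover_iff X Y); [assumption|apply K|assumption]. Qed.

Lemma chart_boundary X Y g z : chart X Y g -> cover_boundary X z -> cover_boundary Y (mob g z).
Proof.
  intros H (k & t & ->). exists k, t. symmetry. apply chart_geod_lift, H.
Qed.

Lemma chart_far X Y g r z : chart X Y g -> 0 < Im z -> far Y r (mob g z) <-> far X r z.
Proof.
  intros H Hz. unfold far. split; intros K k; specialize (K k);
    rewrite (chart_geod_lift X Y g) in * by assumption; rewrite hdist_mob in *; auto using geod_im.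
Qed.

Lemma chart_tine X Y g : chart X Y g -> is_tine X -> is_tine Y.
Proof.
  unfold is_tine. intros H K.
  rewrite (chart_gend X Y g H), (chart_gstart X Y g H), (chart_hol_ideal X Y g) by assumption.
  rewrite K. reflexivity.
Qed.

Lemma chart_tine_iff X Y g : chart X Y g -> is_tine X <-> is_tine Y.
Proof.
  intros H. split; [apply (chart_tine X Y g H) | apply (chart_tine Y X _ (chart_sym _ _ _ H))].
Qed.

Lemma chart_strap X Y g h s0 s1 : chart X Y g ->
  is_strap X h s0 s1 -> is_strap Y (sl2_mul g h) s0 s1.
Proof.
  intros H (N & L & (t0 & O0) & (t1 & O1)). split; [|split; [assumption|split]].
  - rewrite <- (chart_tine_iff X Y g H). exact N.
  - exists t0. apply (orthogonal_at_peq (sl2_mul g h) _ _ (sl2_mul g (arch X))).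
    + apply peq_refl.
    + apply peq_sym, H.
    + apply orthogonal_at_mul, O0.
  - exists t1. apply (orthogonal_at_peq (sl2_mul g h) _ _ (sl2_mul g (lift_arch X 1))).
    + apply peq_refl.
    + apply peq_sym, chart_lift_arch, H.
    + apply orthogonal_at_mul, O1.
Qed.

Lemma chart_strap_length X Y g c : chart X Y g -> strap_length X c -> strap_length Y c.
Proof.
  intros H [[T ->]|(h & s0 & s1 & S & ->)].
  - left. split; [apply (chart_tine X Y g H T) | reflexivity].
  - right. exists (sl2_mul g h), s0, s1. split; [apply (chart_strap X Y g h s0 s1 H S)|].
    rewrite !geod_mul. symmetry. apply hdist_mob; apply geod_im.
Qed.

Lemma chart_covers_neck X Y g h l : chart X Y g -> covers_neck X h l -> covers_neck Y (sl2_mul g h) l.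
Proof.
  intros H [L K]. split; [assumption|]. intros t.
  rewrite !geod_mul, (chart_hol_mob X Y), K; auto using geod_im.
Qed.

Lemma chart_cusp X Y g : chart X Y g -> is_cusp X -> is_cusp Y.
Proof.
  intros [(s & Hs & H1 & _ & _ & H4) _] K. unfold is_cusp in *. rewrite H1, H4, <- K.
  cbn [sl2_mul sl2_inv ma mb mc md].
  transitivity (s ^ 2 * ((ma g * md g - mb g * mc g) * (ma (hol X) + md (hol X))) ^ 2); [ring|].
  rewrite Hs, sl2_det. ring.
Qed.

Lemma chart_neck_length X Y g d : chart X Y g -> neck_length X d -> neck_length Y d.
Proof.
  intros H [[T ->]|(h & K)].
  - left. split; [apply (chart_cusp X Y g H T) | reflexivity].
  - right. exists (sl2_mul g h). apply (chart_covers_neck X Y g h d H K).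
Qed.

Lemma chart_in_moduli X Y g c d : chart X Y g -> in_moduli c d X -> in_moduli c d Y.
Proof.
  intros H [K1 K2]. split;
    [apply (chart_strap_length X Y g c H K1) | apply (chart_neck_length X Y g d H K2)].
Qed.

Lemma chart_orth_dom X Y g h t : chart X Y g -> orth_dom Y (sl2_mul g h) t <-> orth_dom X h t.
Proof.
  intros H. unfold orth_dom. split; intros [P K]; (split; [assumption|]); intros u Hu;
    specialize (K u Hu); rewrite geod_mul in *; rewrite (chart_cover_iff X Y) in *; auto using geod_im.
Qed.

Lemma chart_orthojectory X Y g h t : chart X Y g ->
  is_orthojectory X t h -> is_orthojectory Y t (sl2_mul g h).
Proof.
  intros H [O (e & P & K)]. split.
  - apply (orthogonal_at_peq (sl2_mul g (arch X)) _ _ (sl2_mul g h)).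
    + apply peq_sym, H.
    + apply peq_refl.
    + apply orthogonal_at_mul, O.
  - exists e. split; [assumption|]. rewrite geod_mul. apply (chart_cover X Y g _ H K).
Qed.

(** Proper homotopies only involve the cover, its boundary and distances, so
    that any continuous map which respects these transports them. *)
Lemma proper_homotopy_image X Y h h' (m : C -> C) H :
  (forall t, orth_dom Y h' t <-> orth_dom X h t) ->
  (forall t, geod h' t = m (geod h t)) ->
  (forall z, 0 < Im z -> continuous m z) ->
  (forall z, cover X z -> cover Y (m z)) ->
  (forall z, cover_boundary X z -> cover_boundary Y (m z)) ->
  (forall r z, 0 < Im z -> far X r z -> far Y r (m z)) ->
  proper_homotopy X h H -> proper_homotopy Y h' (fun s t => m (H s t)).
Proof.
  intros D G Cm Hc Hb Hf [P1 P2 P3 P4 P5 P6]. split.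
  - intros p [Hp1 Hp2]. apply D in Hp2. specialize (P1 p (conj Hp1 Hp2)).
    apply (filterlim_filter_le_1 (F := within (fun p : R * R => 0 <= fst p <= 1 /\ orth_dom X h (snd p)) (locally p))).
    + intros Q. unfold within. apply filter_imp. intros x Hx [K1 K2]. apply Hx. split; [assumption|].
      apply D, K2.
    + apply (filterlim_comp _ _ _ (fun p : R * R => H (fst p) (snd p)) m _ _ _ P1).
      apply Cm, (cover_im X), P2; assumption.
  - intros s t Hs Ht. apply Hc, P2; [assumption|]. apply D, Ht.
  - intros t Ht. rewrite P3, G; [reflexivity|]. apply D, Ht.
  - intros s Hs. apply Hb, P4, Hs.
  - intros T HT Hmax s Hs. apply Hb, (P5 T); auto.
    + apply D, HT.
    + intros t Ht. apply Hmax, D, Ht.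
  - intros r. destruct (P6 r) as [M HM]. exists M. intros s t Hs Ht N.
    apply D in Ht. apply (HM s t Hs Ht). intros F. apply N, Hf; [|exact F].
    apply (cover_im X), P2; assumption.
Qed.

Lemma chart_proper_homotopy X Y g h H : chart X Y g -> proper_homotopy X h H ->
  proper_homotopy Y (sl2_mul g h) (fun s t => mob g (H s t)).
Proof.
  intros Hg. apply proper_homotopy_image.
  - intros t. apply chart_orth_dom, Hg.
  - intros t. apply geod_mul.
  - apply continuous_mob.
  - intros z. apply chart_cover, Hg.
  - intros z. apply chart_boundary, Hg.
  - intros r z Hz. apply chart_far; assumption.
Qed.

Lemma chart_cuts_off X Y g f : chart X Y g -> cuts_off X f -> cuts_off Y (sl2_mul g f).
Proof.
  intros H (s0 & s1 & L & (t0 & E0) & (t1 & E1)). exists s0, s1. split; [assumption|]. split.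
  - exists t0. rewrite geod_mul, E0. symmetry. apply chart_geod_arch, H.
  - exists t1. rewrite geod_mul, E1. symmetry. apply chart_geod_lift, H.
Qed.

Lemma chart_peripheral X Y g h : chart X Y g -> is_peripheral X h -> is_peripheral Y (sl2_mul g h).
Proof.
  intros Hg (f & Hf & K). exists (sl2_mul g f). split; [apply (chart_cuts_off X Y g f Hg Hf)|].
  intros r. destruct (K r) as (H & PH & HH). exists (fun s t => mob g (H s t)). split.
  - apply (chart_proper_homotopy X Y g h H Hg PH).
  - intros t Ht. apply (chart_orth_dom X Y g h t Hg) in Ht.
    destruct (HH t Ht) as [F (k & R)].
    assert (P : 0 < Im (H 1 t)) by apply R.
    split; [apply (chart_far X Y g r _ Hg P), F|].
    exists k. apply (chart_right_deck X Y g k f _ Hg P), R.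
Qed.

Lemma chart_essential_base X Y g t : chart X Y g -> essential_base X t -> essential_base Y t.
Proof.
  intros Hg (h & O & N). exists (sl2_mul g h). split; [apply (chart_orthojectory X Y g h t Hg O)|].
  intros P. apply N. apply (chart_peripheral _ _ _ _ (chart_sym X Y g Hg)) in P.
  rewrite sl2_mul_assoc, sl2_mul_invl, sl2_mul_1l in P. exact P.
Qed.

Lemma chart_essential_interval X Y g t1 t2 : chart X Y g ->
  essential_interval X t1 t2 -> essential_interval Y t1 t2.
Proof.
  intros Hg (L & K & M). split; [assumption|]. split.
  - intros t Ht. apply K, (chart_essential_base Y X _ t (chart_sym X Y g Hg) Ht).
  - intros u1 u2 Hu. apply M. intros t Ht. apply Hu, (chart_essential_base X Y g t Hg Ht).
Qed.

Lemma chart_action X Y g S : chart X Y g -> chekhov_action X S -> chekhov_action Y S.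
Proof.
  intros Hg (t1 & t2 & c & E & L & ->). exists t1, t2, c. split; [|split; [|reflexivity]].
  - apply (chart_essential_interval X Y g _ _ Hg E).
  - apply (chart_strap_length X Y g _ Hg L).
Qed.

Lemma right_of_mob_inv g h z : 0 < Im z -> right_of (sl2_mul g h) z <-> right_of h (mob (sl2_inv g) z).
Proof.
  intros Hz. rewrite <- (right_of_mob g h) by (apply mob_im_pos, Hz).
  rewrite mob_invr by assumption. reflexivity.
Qed.

Lemma chart_clip X Y g f : chart X Y g -> is_clip X f -> is_clip Y (sl2_mul g f).
Proof.
  intros Hg (h & s0 & s1 & S & K & M). exists (sl2_mul g h), s0, s1.
  split; [apply (chart_strap X Y g h _ _ Hg S)|].
  split.
  - intros z Hz. assert (P : 0 < Im z) by apply Hz.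
    apply right_of_mob_inv in Hz; [|assumption]. destruct (K _ Hz) as [K1 K2].
    split.
    + rewrite <- (mob_invr g z) by assumption. apply (chart_cover X Y g _ Hg K1).
    + apply right_of_mob_inv; assumption.
  - intros g' Hg' z Hz. assert (P : 0 < Im z) by apply Hz.
    apply right_of_mob_inv; [assumption|]. apply (M (sl2_mul (sl2_inv g) g')).
    + intros w Hw. assert (Q : 0 < Im w) by apply Hw.
      apply right_of_mob_inv in Hw; [|assumption]. rewrite sl2_inv_inv in Hw.
      destruct (Hg' _ Hw) as [G1 G2]. split.
      * apply (chart_cover_iff X Y g w Hg Q), G1.
      * apply right_of_mob in G2; assumption.
    + apply right_of_mob; assumption.
Qed.

Lemma chart_clip_vertices X Y g N V : chart X Y g ->
  clip_vertices X N V -> clip_vertices Y N (fun k => mob_ideal g (V k)).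
Proof.
  intros Hg [(E & T & K)|(E & f & C & K)].
  - left. split; [assumption|]. split; [apply (chart_tine X Y g Hg T)|].
    intros k. rewrite K, (chart_gstart X Y g Hg), (chart_deck_ideal X Y g) by assumption. reflexivity.
  - right. split; [assumption|]. exists (sl2_mul g f). split; [apply (chart_clip X Y g f Hg C)|].
    intros k. destruct (K k) as [K1 K2].
    rewrite K1, K2, gstart_mul, gend_mul, !(chart_deck_ideal X Y g) by assumption. split; reflexivity.
Qed.

Lemma chart_spiral_point X Y g fwd P : chart X Y g ->
  spiral_point X fwd P -> spiral_point Y fwd (mob_ideal g P).
Proof.
  intros Hg [[T K]|(h & l & K & ->)].
  - left. split; [apply (chart_cusp X Y g Hg T)|]. rewrite (chart_hol_ideal X Y g), K by assumption. reflexivity.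
  - right. exists (sl2_mul g h), l. split; [apply (chart_covers_neck X Y g h l Hg K)|].
    rewrite gend_mul, gstart_mul. destruct fwd; reflexivity.
Qed.

Lemma foot_mul k g x t : foot g x t -> foot (sl2_mul k g) (mob_ideal k x) t.
Proof.
  intros (h & s & O & E). exists (sl2_mul k h), s. split; [apply orthogonal_at_mul, O|].
  rewrite gend_mul, E. reflexivity.
Qed.

Lemma chart_shear X Y g N T fwd e s : chart X Y g ->
  is_shear X N T fwd e s -> is_shear Y N T fwd e s.
Proof.
  intros Hg. destruct e as [a b].
  intros (V & P & HV & HP & u & u' & K1 & K2 & K3 & K4 & K5 & K6 & f & t & t' & F1 & F2 & F3 & F4 & F5).
  exists (fun k => mob_ideal g (V k)), (mob_ideal g P).
  split; [apply (chart_clip_vertices X Y g N V Hg HV)|].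
  split; [apply (chart_spiral_point X Y g fwd P Hg HP)|].
  exists u, u'. do 6 (split; [assumption|]).
  assert (Q : forall c, realise (fun k => mob_ideal g (V k)) (mob_ideal g P) c = mob_ideal g (realise V P c)).
  { intros [k|]; reflexivity. }
  exists (sl2_mul g f), t, t'. rewrite !Q, gstart_mul, gend_mul, F1, F2.
  repeat split; auto using foot_mul.
Qed.

Lemma zpow_1 g : sl2_zpow g 1 = g.
Proof. change (sl2_zpow g 1) with (sl2_mul g sl2_one). apply sl2_mul_1r. Qed.

(** * Reflection in the unit circle *)

Definition nsq (z : C) : R := Re z ^ 2 + Im z ^ 2.

Lemma nsq_pos z : 0 < Im z -> 0 < nsq z.
Proof. intros. unfold nsq. pose proof (pow2_ge_0 (Re z)). nra. Qed.

(** This reflection reverses the geodesic from [0] to infinity. *)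
Definition mirror (z : C) : C := (Re z / nsq z, Im z / nsq z).

(** The conjugate of [g] by [mirror]. *)
Definition flip (g : SL2) : SL2.
Proof. refine (mkSL2 (md g) (mc g) (mb g) (ma g) _). rewrite <- (sl2_det g). ring. Defined.

Lemma flip_mul g h : flip (sl2_mul g h) = sl2_mul (flip g) (flip h).
Proof. apply sl2_ext; cbn; ring. Qed.

Lemma flip_one : flip sl2_one = sl2_one.
Proof. apply sl2_ext; reflexivity. Qed.

Lemma flip_inv g : flip (sl2_inv g) = sl2_inv (flip g).
Proof. apply sl2_ext; cbn; ring. Qed.

Lemma flip_npow g n : flip (sl2_npow g n) = sl2_npow (flip g) n.
Proof.
  induction n as [|n IH]; cbn [sl2_npow]; [apply flip_one|]. rewrite flip_mul, IH. reflexivity.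
Qed.

Lemma flip_zpow g k : flip (sl2_zpow g k) = sl2_zpow (flip g) k.
Proof.
  destruct k; cbn [sl2_zpow].
  - apply flip_one.
  - apply flip_npow.
  - rewrite flip_npow, flip_inv. reflexivity.
Qed.

Lemma zpow_inv g k : sl2_zpow (sl2_inv g) k = sl2_zpow g (- k).
Proof. destruct k; cbn [sl2_zpow Z.opp]; try reflexivity. rewrite sl2_inv_inv. reflexivity. Qed.

Lemma mirror_im z : 0 < Im z -> 0 < Im (mirror z).
Proof. intros H. apply Rdiv_lt_0_compat; [assumption | apply nsq_pos, H]. Qed.

Lemma mirror_nsq z : 0 < Im z -> nsq (mirror z) = / nsq z.
Proof.
  intros H. pose proof (nsq_pos z H). unfold mirror, nsq at 1; cbn [Re Im fst snd].
  unfold nsq in *. field. lra.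
Qed.

Lemma mirror_mirror z : 0 < Im z -> mirror (mirror z) = z.
Proof.
  intros H. pose proof (nsq_pos z H). unfold mirror at 1. rewrite mirror_nsq by assumption.
  unfold mirror; cbn [Re Im fst snd]. destruct z as [x y]; cbn [Re Im fst snd]. f_equal; field; lra.
Qed.

Lemma flip_side g z : 0 < Im z -> side (flip g) (mirror z) * nsq z = side g z.
Proof.
  intros H. pose proof (nsq_pos z H) as Hn. unfold side.
  change (Re (mirror z) ^ 2 + Im (mirror z) ^ 2) with (nsq (mirror z)). rewrite mirror_nsq by assumption.
  change (Re z ^ 2 + Im z ^ 2) with (nsq z).
  unfold mirror; cbn [Re fst flip ma mb mc md]. field. lra.
Qed.

Lemma flip_right g z : 0 < Im z -> right_of (flip g) (mirror z) <-> right_of g z.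
Proof.
  intros H. rewrite !right_of_side. pose proof (flip_side g z H). pose proof (nsq_pos z H).
  pose proof (mirror_im z H). split; intros [_ K]; split; try assumption; nra.
Qed.

(** * The model crowns *)

(** Parameters of a crown in the chart where the arch runs from [0] to
    infinity: the matrix of the holonomy is [[al, be], [- ga, - de]]. *)
Record shape : Set := mkShape {
  al : R; be : R; ga : R; de : R;
  be_pos : 0 < be;
  ga_pos : 0 < ga;
  de_pos : 0 <= de;
  shape_det : be * ga - al * de = 1;
  shape_trace : 2 <= al - de }.

Lemma al_pos p : 2 <= al p.
Proof. pose proof (de_pos p). pose proof (shape_trace p). lra. Qed.

Lemma monodromy_det p : al p * - de p - be p * - ga p = 1.
Proof. rewrite <- (shape_det p). ring. Qed.

Definition monodromy (p : shape) : SL2 := mkSL2 (al p) (be p) (- ga p) (- de p) (monodromy_det p).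

(** By Cayley-Hamilton, the powers of the monodromy are [x M - y], where
    [x] and [y] are consecutive terms of a linear recurrence; it is increasing
    because the trace is at least [2]. *)
Lemma monodromy_npow p n : exists x y,
  0 <= y /\ y + 1 <= x /\ ((1 <= n)%nat -> 1 <= y /\ x <= (al p - de p) * y) /\
  ma (sl2_npow (monodromy p) (S n)) = x * al p - y /\
  mb (sl2_npow (monodromy p) (S n)) = x * be p /\
  mc (sl2_npow (monodromy p) (S n)) = - (x * ga p) /\
  md (sl2_npow (monodromy p) (S n)) = - (x * de p) - y.
Proof.
  pose proof (shape_det p) as Hd. pose proof (shape_trace p) as Ht.
  induction n as [|n (x & y & H1 & H2 & H3 & E1 & E2 & E3 & E4)].
  - exists 1, 0. cbn [sl2_npow sl2_mul sl2_one ma mb mc md monodromy].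
    repeat split; try lra; try lia; ring.
  - exists ((al p - de p) * x - y), x.
    set (m := sl2_npow (monodromy p) (S n)) in *.
    change (sl2_npow (monodromy p) (S (S n))) with (sl2_mul (monodromy p) m).
    cbn [sl2_mul ma mb mc md monodromy]. rewrite E1, E2, E3, E4.
    assert (B : be p * ga p = 1 + al p * de p) by lra.
    split; [lra|]. split; [nra|]. split; [intros _; split; nra|].
    repeat split; try ring.
    + transitivity (al p * (x * al p - y) - x * (be p * ga p)); [ring|]. rewrite B. ring.
    + transitivity (- x * (be p * ga p) + de p * (x * de p + y)); [ring|]. rewrite B. ring.
Qed.

Lemma monodromy_zpow_pos p k : (1 <= k)%Z -> exists x y,
  0 <= y /\ y + 1 <= x /\ ((2 <= k)%Z -> 1 <= y /\ x <= (al p - de p) * y) /\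
  ma (sl2_zpow (monodromy p) k) = x * al p - y /\
  mb (sl2_zpow (monodromy p) k) = x * be p /\
  mc (sl2_zpow (monodromy p) k) = - (x * ga p) /\
  md (sl2_zpow (monodromy p) k) = - (x * de p) - y.
Proof.
  intros Hk. destruct k as [|q|q]; try lia. cbn [sl2_zpow].
  destruct (Pos2Nat.is_succ q) as [n En].
  destruct (monodromy_npow p n) as (x & y & H1 & H2 & H3 & E). exists x, y. rewrite En.
  do 2 (split; [assumption|]). split; [|exact E]. intros. apply H3. lia.
Qed.

Lemma swap_det p : ga p * be p - al p * de p = 1.
Proof. rewrite <- (shape_det p). ring. Qed.

(** The shape of the reflected crown. *)
Definition swap (p : shape) : shape :=
  mkShape (al p) (ga p) (be p) (de p) (ga_pos p) (be_pos p) (de_pos p) (swap_det p) (shape_trace p).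

Lemma flip_monodromy p k :
  flip (sl2_zpow (monodromy p) k) = sl2_zpow (monodromy (swap p)) (- k).
Proof.
  rewrite flip_zpow, <- zpow_inv. f_equal. apply sl2_ext; cbn; ring.
Qed.

Lemma monodromy_zpow_neg p k : (k <= -1)%Z -> exists x y,
  0 <= y /\ y + 1 <= x /\ ((k <= -2)%Z -> 1 <= y /\ x <= (al p - de p) * y) /\
  ma (sl2_zpow (monodromy p) k) = - (x * de p) - y /\
  mb (sl2_zpow (monodromy p) k) = - (x * be p) /\
  mc (sl2_zpow (monodromy p) k) = x * ga p /\
  md (sl2_zpow (monodromy p) k) = x * al p - y.
Proof.
  intros Hk. destruct (monodromy_zpow_pos (swap p) (- k) ltac:(lia)) as (x & y & H1 & H2 & H3 & E1 & E2 & E3 & E4).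
  exists x, y. do 2 (split; [assumption|]). split; [intros; apply H3; lia|].
  pose proof (flip_monodromy p k) as F. rewrite <- F in E1, E2, E3, E4.
  cbn [flip swap ma mb mc md al be ga de] in E1, E2, E3, E4. repeat split; lra.
Qed.

Lemma side_one z : side sl2_one z = Re z.
Proof. unfold side; cbn [sl2_one ma mb mc md]. ring. Qed.

(** For [k > 0], all coefficients of the quadratic function have the right
    sign; the reflection exchanges [k] and [- k]. *)
Lemma monodromy_side_neg p k z : k <> 0%Z -> 0 < Im z -> 0 <= Re z ->
  side (sl2_zpow (monodromy p) k) z < 0.
Proof.
  assert (Pos : forall p k z, (1 <= k)%Z -> 0 < Im z -> 0 <= Re z ->
    side (sl2_zpow (monodromy p) k) z < 0).
  { clear p k z. intros p k z Hk Hz Hr. pose proof (al_pos p) as Ha. pose proof (be_pos p) as Hb.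
    pose proof (ga_pos p) as Hg. pose proof (de_pos p) as Hd.
    assert (Hn : 0 < Re z ^ 2 + Im z ^ 2) by nra.
    destruct (monodromy_zpow_pos p k Hk) as (x & y & H1 & H2 & _ & E1 & E2 & E3 & E4).
    unfold side. rewrite E1, E2, E3, E4.
    assert (P1 : 0 < x * al p - y) by nra. assert (P2 : 0 < x * ga p) by nra.
    assert (P3 : 0 < x * be p) by nra. assert (P4 : 0 <= x * de p + y) by nra.
    assert (P5 : 0 <= (x * de p + y) * (x * ga p)) by nra.
    assert (P6 : 0 < (x * al p - y) * (x * be p)) by nra.
    assert (P7 : 0 <= (x * de p + y) * (x * al p - y)) by nra.
    assert (P8 : 0 <= (x * be p) * (x * ga p)) by nra.
    nra. }
  intros Hk Hz Hr. destruct (Z.lt_trichotomy k 0) as [L|[L|L]]; [|lia | apply Pos; [lia | assumption ..]].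
  pose proof (flip_side (sl2_zpow (monodromy p) k) z Hz) as F. rewrite flip_monodromy in F.
  pose proof (nsq_pos z Hz) as N.
  assert (0 <= Re (mirror z)) by (apply Rdiv_le_0_compat; assumption).
  pose proof (Pos (swap p) (- k)%Z (mirror z) ltac:(lia) (mirror_im z Hz) H). nra.
Qed.

Lemma model_not_elliptic p : 4 <= (ma (monodromy p) + md (monodromy p)) ^ 2.
Proof. cbn [monodromy ma md]. pose proof (shape_trace p). nra. Qed.

Lemma model_disjoint p : forall (k : Z) (z : C), k <> 0%Z ->
  right_of sl2_one z -> ~ right_of (sl2_mul (sl2_zpow (monodromy p) k) sl2_one) z.
Proof.
  intros k z Hk. rewrite sl2_mul_1r, !right_of_side, side_one. intros [Hz Hr] [_ K].
  pose proof (monodromy_side_neg p k z Hk Hz). lra.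
Qed.

Lemma model_direction p :
  cyclic Rlt (gend sl2_one) (mob_ideal (monodromy p) (gend sl2_one))
             (mob_ideal (monodromy p) (mob_ideal (monodromy p) (gend sl2_one))).
Proof.
  rewrite gend_line, !line_of_act by (auto using act_nonzero, col1_nonzero).
  apply cyclic_line; auto using act_nonzero, col1_nonzero.
  rewrite det2_act. unfold det2, act; cbn [sl2_one monodromy ma mb mc md fst snd].
  pose proof (ga_pos p). pose proof (shape_trace p).
  replace ((1 * (- ga p * 1 + - de p * 0) - 0 * (al p * 1 + be p * 0)) *
    (1 * (- ga p * 1 + - de p * 0) - 0 * (al p * 1 + be p * 0)) *
    ((al p * (al p * 1 + be p * 0) + be p * (- ga p * 1 + - de p * 0)) * 0 -
    (- ga p * (al p * 1 + be p * 0) + - de p * (- ga p * 1 + - de p * 0)) * 1))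
  with (ga p * ga p * ga p * (al p - de p)) by ring.
  repeat apply Rmult_lt_0_compat; lra.
Qed.

Definition model (p : shape) : crown :=
  mkCrown (monodromy p) sl2_one (model_not_elliptic p) (model_disjoint p) (model_direction p).

Lemma model_lift p k : lift_arch (model p) k = sl2_zpow (monodromy p) k.
Proof. unfold lift_arch, deck, model; cbn [hol arch]. apply sl2_mul_1r. Qed.

(** Evaluate the polynomial near [0], near infinity and at its maximum. *)
Lemma quadratic_nonpos a b c : b ^ 2 - 4 * a * c = 1 ->
  (forall r, 0 < r -> a * r ^ 2 + b * r + c <= 0) -> a <= 0 /\ b <= -1 /\ c <= 0.
Proof.
  intros D H.
  assert (Hc : c <= 0).
  { destruct (Rle_or_lt c 0) as [L|L]; [assumption|exfalso].
    set (r := c / (2 * (Rabs a + Rabs b + c))).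
    assert (P : 0 < Rabs a + Rabs b + c) by (pose proof (Rabs_pos a); pose proof (Rabs_pos b); lra).
    assert (R0 : 0 < r) by (apply Rdiv_lt_0_compat; lra).
    assert (R1 : r * (Rabs a + Rabs b + c) = c / 2) by (unfold r; field; lra).
    assert (R2 : r < 1) by (pose proof (Rabs_pos a); pose proof (Rabs_pos b); nra).
    specialize (H r R0).
    assert (- (Rabs a * r) <= a * r ^ 2).
    { pose proof (Rle_abs (- a)). rewrite Rabs_Ropp in *. pose proof (Rabs_pos a).
      assert (r ^ 2 <= r) by nra. nra. }
    assert (- (Rabs b * r) <= b * r).
    { pose proof (Rle_abs (- b)). rewrite Rabs_Ropp in *. nra. }
    nra. }
  assert (Ha : a <= 0).
  { destruct (Rle_or_lt a 0) as [L|L]; [assumption|exfalso].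
    set (r := 1 + (Rabs b + Rabs c) / a).
    pose proof (Rabs_pos b). pose proof (Rabs_pos c).
    assert (Q : 0 <= (Rabs b + Rabs c) / a) by (apply Rdiv_le_0_compat; lra).
    assert (R0 : 1 <= r) by (unfold r; lra).
    assert (R1 : a * r = a + Rabs b + Rabs c) by (unfold r; field; lra).
    specialize (H r ltac:(lra)).
    pose proof (Rle_abs (- b)). pose proof (Rle_abs (- c)). rewrite !Rabs_Ropp in *.
    replace (a * r ^ 2) with (a * r * r) in H by ring. rewrite R1 in H. nra. }
  split; [assumption|]. split; [|assumption].
  assert (Hb : b <= 0).
  { destruct (Rle_or_lt b 0) as [L|L]; [assumption|exfalso].
    destruct (Req_dec a 0) as [E|E].
    - rewrite E in *. assert (b = 1) by nra. specialize (H (1 - c) ltac:(lra)). nra.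
    - specialize (H (b / (- 2 * a)) ltac:(apply Rdiv_lt_0_compat; nra)).
      replace (a * (b / (-2 * a)) ^ 2 + b * (b / (-2 * a)) + c)
        with ((b ^ 2 - 4 * a * c) / (- 4 * a)) in H by (field; assumption).
      rewrite D in H. assert (0 < 1 / (- 4 * a)) by (apply Rdiv_lt_0_compat; nra). lra. }
  nra.
Qed.

(** Disjointness from the right quadrant passes to the limit on the positive
    axis, where [side g] is a quadratic polynomial of discriminant [1]. *)
Lemma side_nonpos_right g : (forall w, 0 < Im w -> 0 < Re w -> side g w <= 0) ->
  - (md g * mc g) <= 0 /\ ma g * md g + mb g * mc g <= -1 /\ - (ma g * mb g) <= 0.
Proof.
  intros Hdisj. pose proof (sl2_det g) as D. apply quadratic_nonpos.
  - transitivity ((ma g * md g - mb g * mc g) ^ 2); [ring|]. rewrite D; ring.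
  - intros r Hr.
    set (a := - (md g * mc g)). set (b := ma g * md g + mb g * mc g). set (c := - (ma g * mb g)).
    destruct (Rle_or_lt (a * r ^ 2 + b * r + c) 0) as [L|L]; [assumption|exfalso].
    assert (C : continuous (fun t : R => side g (r, t)) 0).
    { unfold side; cbn [Re Im fst snd].
      assert (Ci : continuous (fun u : R => u) 0) by apply continuous_id. ct. }
    assert (P : 0 < side g (r, 0)).
    { unfold side; cbn [Re Im fst snd]. unfold a, b, c in L. lra. }
    destruct (continuous_pos_locally _ _ C P) as [eps Heps]. pose proof (cond_pos eps).
    assert (K : side g (r, eps / 2) <= 0) by (apply Hdisj; cbn [Re Im fst snd]; lra).
    assert (0 < side g (r, eps / 2)); [|lra].
    apply (Heps (eps / 2)). unfold ball; cbn. unfold AbsRing_ball, abs, minus, plus, opp; cbn.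
    rewrite Rabs_pos_eq; lra.
Qed.

(** In the chart where the arch runs from [0] to infinity, every crown is a
    model crown: up to a common sign, the disjointness of the arch from its
    translate fixes the signs of the entries of [hol X], and the direction of
    [hol X] fixes the sign of its trace. *)
Lemma normal_form X : exists p, chart (model p) X (arch X).
Proof.
  set (g := arch X). set (M := sl2_mul (sl2_mul (sl2_inv g) (hol X)) g).
  assert (HM : sl2_mul g M = sl2_mul (hol X) g).
  { unfold M. rewrite !sl2_mul_assoc, sl2_mul_invr, sl2_mul_1l. reflexivity. }
  pose proof (sl2_det M) as D.
  assert (Hdisj : forall w, 0 < Im w -> 0 < Re w -> side M w <= 0).
  { intros w Hw Hr. destruct (Rle_or_lt (side M w) 0) as [L|L]; [assumption|exfalso].
    apply (arch_disjoint X 1 (mob g w)); [lia| |].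
    - fold g. rewrite <- (sl2_mul_1r g) at 1. apply right_of_mob; [assumption|].
      apply right_of_side. rewrite side_one. split; assumption.
    - fold g. change (sl2_zpow (hol X) 1) with (sl2_mul (hol X) sl2_one).
      rewrite sl2_mul_1r, <- HM. apply right_of_mob; [assumption|].
      apply right_of_side. split; assumption. }
  destruct (side_nonpos_right M Hdisj) as (Q1 & Q2 & Q3).
  assert (BC : mb M * mc M <= -1) by lra. assert (AD : ma M * md M <= 0) by lra.
  assert (C0 : mc M <> 0) by (intros E; rewrite E in BC; lra).
  assert (HT : 4 <= (ma M + md M) ^ 2).
  { pose proof (hol_not_elliptic X) as T. unfold M; cbn [sl2_mul sl2_inv ma mb mc md].
    replace ((md g * ma (hol X) + - mb g * mc (hol X)) * ma g
      + (md g * mb (hol X) + - mb g * md (hol X)) * mc g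
      + ((- mc g * ma (hol X) + ma g * mc (hol X)) * mb g
      + (- mc g * mb (hol X) + ma g * md (hol X)) * md g))
    with ((ma g * md g - mb g * mc g) * (ma (hol X) + md (hol X))) by ring.
    rewrite sl2_det, Rmult_1_l. assumption. }
  assert (Dir : 0 < - (mc M * mc M * (mc M * (ma M + md M)))).
  { pose proof (hol_direction X) as K. fold g in K.
    assert (E : forall x, mob_ideal (hol X) (mob_ideal g x) = mob_ideal g (mob_ideal M x)).
    { intros x. rewrite <- !mob_ideal_mul, HM. reflexivity. }
    replace (gend g) with (mob_ideal g None) in K by reflexivity.
    rewrite !E in K. apply cyclic_mob in K.
    replace None with (line_of (1, 0)) in K
      by (unfold line_of; cbn; destruct (Req_EM_T 0 0); [reflexivity | lra]).
    assert (N1 : (1, 0) <> (0, 0)) by (intros F; injection F; lra).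
    rewrite !line_of_act in K by auto using act_nonzero.
    apply cyclic_line in K; auto using act_nonzero.
    rewrite det2_act in K. unfold det2, act in K; cbn [fst snd] in K.
    match type of K with 0 < ?u => replace u with (- (mc M * mc M * (mc M * (ma M + md M)))) in K by ring end.
    exact K. }
  assert (S : exists s, s ^ 2 = 1 /\ s * mc M < 0).
  { destruct (Rtotal_order (mc M) 0) as [L|[L|L]]; [exists 1 | tauto | exists (-1)]; split; lra. }
  destruct S as (s & Hs & Hsc).
  assert (Hc2 : 0 < mc M * mc M) by nra.
  assert (D1 : mc M * (ma M + md M) < 0) by nra.
  assert (B1 : 0 < s * mb M).
  { assert (s * mb M * (s * mc M) <= -1); [|nra]. replace (s * mb M * (s * mc M)) with (s ^ 2 * (mb M * mc M)) by ring. rewrite Hs; lra. }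
  assert (D2 : s * md M <= 0).
  { assert (0 <= s * md M * (s * mc M)); [|nra].
    replace (s * md M * (s * mc M)) with (s ^ 2 * (md M * mc M)) by ring. rewrite Hs; lra. }
  assert (T2 : 2 <= s * ma M - - (s * md M)).
  { assert (0 < s * ma M + s * md M).
    { assert (s * mc M * (s * ma M + s * md M) < 0); [|nra].
      replace (s * mc M * (s * ma M + s * md M)) with (s ^ 2 * (mc M * (ma M + md M))) by ring.
      rewrite Hs; lra. }
    assert (4 <= (s * ma M + s * md M) ^ 2); [|nra].
    replace ((s * ma M + s * md M) ^ 2) with (s ^ 2 * (ma M + md M) ^ 2) by ring. rewrite Hs; lra. }
  assert (Dt : s * mb M * - (s * mc M) - s * ma M * - (s * md M) = 1).
  { transitivity (s ^ 2 * (ma M * md M - mb M * mc M)); [ring|]. rewrite Hs, D; ring. }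
  exists (mkShape (s * ma M) (s * mb M) (- (s * mc M)) (- (s * md M)) B1 ltac:(lra) ltac:(lra) Dt T2).
  split.
  - replace (hol X) with (sl2_mul (sl2_mul g M) (sl2_inv g)).
    2:{ rewrite HM, <- sl2_mul_assoc, sl2_mul_invr, sl2_mul_1r. reflexivity. }
    apply peq_mul; [|apply peq_refl]. apply peq_mul; [apply peq_refl|].
    exists s. split; [assumption|]. cbn [model hol monodromy al be ga de ma mb mc md].
    rewrite !Ropp_involutive, <- !Rmult_assoc. replace (s * s) with (s ^ 2) by ring. rewrite Hs.
    repeat split; ring.
  - cbn [model arch]. rewrite sl2_mul_1r. apply peq_refl.
Qed.

(** * Strap length and neck length of a model crown *)

Lemma cosh_sinh_sq x : cosh x ^ 2 = 1 + sinh x ^ 2.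
Proof.
  unfold cosh, sinh. rewrite <- (exp_mul_opp x). field.
Qed.

Lemma cosh_pos x : 0 < cosh x.
Proof. unfold cosh. pose proof (exp_pos x). pose proof (exp_pos (- x)). lra. Qed.

Lemma cosh_ge_1 x : 1 <= cosh x.
Proof. pose proof (cosh_sinh_sq x). pose proof (cosh_pos x). pose proof (pow2_ge_0 (sinh x)). nra. Qed.

Lemma sinh_nonneg x : 0 <= x -> 0 <= sinh x.
Proof.
  intros [H|<-]; [|rewrite sinh_0; lra]. left. rewrite <- sinh_0. apply sinh_lt, H.
Qed.

Lemma sinh_pos x : 0 < x -> 0 < sinh x.
Proof. intros H. rewrite <- sinh_0. apply sinh_lt, H. Qed.

Lemma sinh_sq_inj x y : 0 <= x -> 0 <= y -> sinh x ^ 2 = sinh y ^ 2 -> x = y.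
Proof.
  intros Hx Hy E. rewrite <- (arcsinh_sinh x), <- (arcsinh_sinh y). f_equal.
  pose proof (sinh_nonneg x Hx). pose proof (sinh_nonneg y Hy). nra.
Qed.

Lemma model_tine p : is_tine (model p) <-> de p = 0.
Proof.
  unfold is_tine. cbn [model arch hol]. rewrite gend_line, gstart_line, line_of_act.
  - rewrite line_of_eq; [|apply col1_nonzero | apply act_nonzero, col2_nonzero].
    unfold det2, act; cbn [sl2_one monodromy ma mb mc md fst snd]. split; intros; lra.
  - apply col2_nonzero.
Qed.

Lemma quarter_det : / sqrt 2 * / sqrt 2 - / sqrt 2 * - / sqrt 2 = 1.
Proof.
  assert (S : 0 < sqrt 2) by (apply sqrt_lt_R0; lra).
  assert (E : sqrt 2 * sqrt 2 = 2) by (apply sqrt_sqrt; lra).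
  field_simplify_eq; lra.
Qed.

(** The geodesic from [exp t] to [- exp t], passing at time [0] through the
    point [i exp t], where it turns left of the imaginary axis. *)
Definition circle (t : R) : SL2 := sl2_mul (dil t) (mkSL2 _ _ _ _ quarter_det).

Lemma inv_sqrt2_sq : 2 * (/ sqrt 2) ^ 2 = 1.
Proof. pose proof quarter_det. lra. Qed.

Lemma geod_circle t u : geod (circle t) u =
  (exp t * (1 - exp u ^ 2) / (1 + exp u ^ 2), exp t * (2 * exp u) / (1 + exp u ^ 2)).
Proof.
  unfold circle. rewrite geod_mul, mob_dil, geod_coord. cbn [ma mb mc md Re Im fst snd].
  set (k := / sqrt 2). assert (Hk : 2 * k ^ 2 = 1) by apply inv_sqrt2_sq.
  pose proof (pow2_ge_0 (exp u)). clearbody k.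
  assert (E : (- k * exp u) ^ 2 + k ^ 2 = (1 + exp u ^ 2) / 2).
  { transitivity (2 * k ^ 2 * (exp u ^ 2 + 1) / 2); [field|]. rewrite Hk. field. }
  rewrite E. f_equal.
  - replace (k * - k * exp u ^ 2 + k * k) with (2 * k ^ 2 * (1 - exp u ^ 2) / 2) by field.
    rewrite Hk. field. lra.
  - field. lra.
Qed.

Lemma circle_side t z :
  side (circle t) z = (Re z ^ 2 + Im z ^ 2 - exp t ^ 2) / (2 * exp t).
Proof.
  pose proof (exp_half t) as E. pose proof (exp_pos (t / 2)) as P.
  pose proof inv_sqrt2_sq as Hk.
  unfold side, circle; cbn [sl2_mul dil ma mb mc md]. rewrite exp_Ropp, <- E.
  set (k := / sqrt 2) in *. clearbody k. set (X := exp (t / 2)) in *. clearbody X.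
  transitivity (2 * k ^ 2 * ((Re z ^ 2 + Im z ^ 2 - (X * X) ^ 2) / (2 * (X * X)))).
  - field. lra.
  - rewrite Hk. ring.
Qed.

Lemma circle_orthogonal t : orthogonal_at sl2_one t (circle t) 0.
Proof.
  apply orthogonal_at_dil. exists (/ sqrt 2), 1. split; [apply inv_sqrt2_sq|].
  split; [ring|]. cbn [circle sl2_mul sl2_one dil ma mb mc md].
  replace (0 / 2) with 0 by lra. rewrite Ropp_0, exp_0. repeat split; ring.
Qed.

(** Both ends of a strap are quarter turns of the arches, which gives the same
    matrix, up to signs and to the translation along the strap, in terms of the
    positions [t] and [t'] of its ends; eliminating them leaves its length and
    the radius [r] of the half-circle that it lies on. *)
Lemma model_strap p h s0 s1 : is_strap (model p) h s0 s1 ->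
  0 < de p /\ sinh ((s1 - s0) / 2) ^ 2 = al p * de p /\
  exists r, 0 < r /\ ga p * de p * r ^ 2 = al p * be p /\
    forall z, side h z = (Re z ^ 2 + Im z ^ 2 - r ^ 2) / (2 * r).
Proof.
  intros (NT & L & (t & O0) & (t' & O1)). rewrite model_tine in NT.
  pose proof (de_pos p) as Hde. assert (De : 0 < de p) by lra. clear NT Hde.
  apply orthogonal_at_dil, quarter_turn_sym in O0, O1. rewrite model_lift in O1.
  change (sl2_zpow (monodromy p) 1) with (sl2_mul (monodromy p) sl2_one) in O1.
  rewrite sl2_mul_1r in O1.
  destruct O0 as (k & e & Hk & He & A1 & A2 & A3 & A4).
  destruct O1 as (k' & e' & Hk' & He' & B1 & B2 & B3 & B4).
  cbn [model arch sl2_mul sl2_one dil monodromy ma mb mc md] in A1, A2, A3, A4, B1, B2, B3, B4.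
  rewrite ?Rmult_0_l, ?Rmult_0_r, ?Rplus_0_l, ?Rplus_0_r in *.
  set (E := exp (t / 2)) in *. set (F := exp (- (t / 2))) in *.
  set (E' := exp (t' / 2)) in *. set (F' := exp (- (t' / 2))) in *.
  assert (EF : E * F = 1) by apply exp_mul_opp.
  assert (EF' : E' * F' = 1) by apply exp_mul_opp.
  assert (E0 : 0 < E) by apply exp_pos. assert (F0 : 0 < F) by apply exp_pos.
  assert (E0' : 0 < E') by apply exp_pos. assert (F0' : 0 < F') by apply exp_pos.
  set (x := exp ((s1 - s0) / 2)). set (y := exp (- ((s1 - s0) / 2))).
  assert (x1 : 1 < x) by (unfold x; rewrite <- exp_0; apply exp_increasing; lra).
  assert (xy : x * y = 1) by apply exp_mul_opp.
  assert (y0 : 0 < y) by apply exp_pos. assert (y1 : y < 1) by nra.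
  assert (X1 : exp (s1 / 2) = exp (s0 / 2) * x) by (unfold x; rewrite <- exp_plus; f_equal; lra).
  assert (Y1 : exp (- (s1 / 2)) = exp (- (s0 / 2)) * y) by (unfold y; rewrite <- exp_plus; f_equal; lra).
  rewrite X1, <- Rmult_assoc, A1 in B1. rewrite Y1, <- Rmult_assoc, A2 in B2.
  rewrite X1, <- Rmult_assoc, A3 in B3. rewrite Y1, <- Rmult_assoc, A4 in B4.
  pose proof (al_pos p) as Ha. pose proof (be_pos p) as Hb. pose proof (ga_pos p) as Hg.
  assert (Es : e' = 1 \/ e' = -1).
  { assert (Z : (e' - 1) * (e' + 1) = 0) by nra. apply Rmult_integral in Z. destruct Z; [left|right]; lra. }
  assert (Ks : k' = k \/ k' = - k).
  { assert (Z : (k' - k) * (k' + k) = 0) by nra. apply Rmult_integral in Z. destruct Z; [left|right]; lra. }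
  assert (K0 : k <> 0) by (intros Z; rewrite Z in Hk; lra).
  assert (Es0 : e = 1 \/ e = -1).
  { assert (Z : (e - 1) * (e + 1) = 0) by nra. apply Rmult_integral in Z. destruct Z; [left|right]; lra. }
  (* the only consistent choice of signs *)
  assert (Signs : e = 1 /\ e' = -1 /\ k' = k).
  { assert (Z1 : 0 < al p * E') by (apply Rmult_lt_0_compat; lra).
    assert (Z2 : 0 < be p * F') by (apply Rmult_lt_0_compat; lra).
    assert (Z3 : 0 < ga p * E') by (apply Rmult_lt_0_compat; lra).
    assert (Z4 : 0 < de p * F') by (apply Rmult_lt_0_compat; lra).
    assert (G1 : 0 < E * x) by (apply Rmult_lt_0_compat; lra).
    assert (G2 : 0 < E * y) by (apply Rmult_lt_0_compat; lra).
    assert (G3 : 0 < F * x) by (apply Rmult_lt_0_compat; lra).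
    assert (G4 : 0 < F * y) by (apply Rmult_lt_0_compat; lra).
    assert (G5 : E * y < E * x) by (apply Rmult_lt_compat_l; lra).
    assert (G6 : F * y < F * x) by (apply Rmult_lt_compat_l; lra).
    assert (C : forall u v, k * u = k * v -> u = v)
      by (intros u v Q; apply (Rmult_eq_reg_l k); assumption).
    destruct Es as [-> | ->], Ks as [-> | ->], Es0 as [-> | ->]; exfalso + auto;
    (assert (Q1 := C (E * x)); assert (Q2 := C (E * y));
     assert (Q3 := C (F * x)); assert (Q4 := C (F * y));
     match type of B1 with _ = ?k0 * ?w => (specialize (Q1 w ltac:(lra)) || specialize (Q1 (- w) ltac:(lra))) end;
     match type of B4 with _ = ?k0 * ?w => (specialize (Q4 w ltac:(lra)) || specialize (Q4 (- w) ltac:(lra))) end;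
     match type of B2 with _ = ?k0 * ?w => (specialize (Q2 w ltac:(lra)) || specialize (Q2 (- w) ltac:(lra))) end;
     match type of B3 with _ = ?k0 * ?w => (specialize (Q3 w ltac:(lra)) || specialize (Q3 (- w) ltac:(lra))) end;
     lra). }
  destruct Signs as (-> & -> & ->). clear Es Ks Es0 He He' Hk'.
  assert (R1 : E * x = al p * E' + be p * F') by (apply (Rmult_eq_reg_l k); lra).
  assert (R2 : E * y = be p * F' - al p * E') by (apply (Rmult_eq_reg_l k); lra).
  assert (R3 : F * x = ga p * E' + de p * F') by (apply (Rmult_eq_reg_l k); lra).
  assert (R4 : F * y = ga p * E' - de p * F') by (apply (Rmult_eq_reg_l k); lra).
  split; [assumption|]. split.
  - unfold sinh. fold x y.
    assert (H1 : E * (x - y) = 2 * (al p * E')) by lra.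
    assert (H2 : F * (x - y) = 2 * (de p * F')) by lra.
    assert (H3 : E * F * (x - y) ^ 2 = 4 * (al p * de p) * (E' * F')).
    { transitivity ((E * (x - y)) * (F * (x - y))); [ring|]. rewrite H1, H2. ring. }
    rewrite EF, EF' in H3. lra.
  - exists (E * E). split; [nra|].
    assert (H1 : E * (x - y) = 2 * (al p * E')) by lra.
    assert (H2 : F * (x - y) = 2 * (de p * F')) by lra.
    assert (H3 : E * (x + y) = 2 * (be p * F')) by lra.
    assert (H4 : F * (x + y) = 2 * (ga p * E')) by lra.
    split.
    + assert (H5 : al p * be p * F ^ 2 = ga p * de p * E ^ 2).
      { apply (Rmult_eq_reg_l (4 * (E' * F'))); [|lra].
        transitivity ((2 * (al p * E')) * (2 * (be p * F')) * F ^ 2); [ring|].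
        rewrite <- H1, <- H3.
        transitivity ((F * (x - y)) * (F * (x + y)) * E ^ 2); [ring|].
        rewrite H2, H4. ring. }
      transitivity (ga p * de p * E ^ 2 * E ^ 2); [ring|]. rewrite <- H5.
      transitivity (al p * be p * (E * F) ^ 2); [ring|]. rewrite EF. ring.
    + intros z.
      set (S := exp (s0 / 2)) in *. set (S' := exp (- (s0 / 2))) in *.
      assert (SS : S * S' = 1) by apply exp_mul_opp.
      unfold side.
      assert (M1 : md h * mc h = - (F ^ 2 / 2)).
      { transitivity ((mc h * S) * (md h * S')); [rewrite <- (Rmult_1_r (md h * mc h)), <- SS; ring|].
        rewrite A3, A4. transitivity (- (F ^ 2 * (2 * k ^ 2) / 2)); [field|]. rewrite Hk. field. }
      assert (M2 : ma h * mb h = E ^ 2 / 2).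
      { transitivity ((ma h * S) * (mb h * S')); [rewrite <- (Rmult_1_r (ma h * mb h)), <- SS; ring|].
        rewrite A1, A2. transitivity (E ^ 2 * (2 * k ^ 2) / 2); [field|]. rewrite Hk. field. }
      assert (M3 : ma h * md h + mb h * mc h = 0).
      { transitivity ((ma h * S) * (md h * S') + (mb h * S') * (mc h * S)).
        - rewrite <- (Rmult_1_r (_ + _)), <- SS. ring.
        - rewrite A1, A2, A3, A4. ring. }
      rewrite M1, M2, M3. replace F with (/ E) by (field_simplify_eq; lra). field. lra.
Qed.

(** The positions of the ends of the common perpendicular are found by solving
    the equations in the proof of [model_strap]. *)
Lemma model_strap_exists p : 0 < de p ->
  exists t l, 0 < l /\ sinh (l / 2) ^ 2 = al p * de p /\
    ga p * de p * exp t ^ 2 = al p * be p /\ is_strap (model p) (circle t) 0 l.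
Proof.
  intros De. pose proof (al_pos p) as Ha. pose proof (be_pos p) as Hb. pose proof (ga_pos p) as Hg.
  assert (P : 0 < al p * de p) by nra. assert (P' : 0 < be p / ga p) by (apply Rdiv_lt_0_compat; lra).
  assert (P'' : 0 < al p / de p) by (apply Rdiv_lt_0_compat; lra).
  set (t := (ln (be p / ga p) + ln (al p / de p)) / 2).
  set (t' := (ln (be p / ga p) - ln (al p / de p)) / 2).
  set (l := 2 * arcsinh (sqrt (al p * de p))).
  assert (Sl : sinh (l / 2) = sqrt (al p * de p)).
  { unfold l. replace (2 * arcsinh (sqrt (al p * de p)) / 2) with (arcsinh (sqrt (al p * de p))) by field.
    apply sinh_arcsinh. }
  assert (S0 : 0 < sqrt (al p * de p)) by (apply sqrt_lt_R0; assumption).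
  assert (S2 : sqrt (al p * de p) ^ 2 = al p * de p) by (apply pow2_sqrt; lra).
  assert (Ll : 0 < l).
  { unfold l. rewrite <- arcsinh_0 at 1. pose proof (arcsinh_lt 0 (sqrt (al p * de p)) S0).
    rewrite arcsinh_0 in *. lra. }
  assert (Cl : cosh (l / 2) ^ 2 = be p * ga p).
  { rewrite cosh_sinh_sq, Sl, S2. pose proof (shape_det p). lra. }
  exists t, l. split; [assumption|]. split; [rewrite Sl; assumption|].
  set (E := exp (t / 2)). set (F := exp (- (t / 2))).
  set (E' := exp (t' / 2)). set (F' := exp (- (t' / 2))).
  assert (EF : E * F = 1) by apply exp_mul_opp.
  assert (EF' : E' * F' = 1) by apply exp_mul_opp.
  assert (E0 : 0 < E) by apply exp_pos. assert (F0 : 0 < F) by apply exp_pos.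
  assert (E0' : 0 < E') by apply exp_pos. assert (F0' : 0 < F') by apply exp_pos.
  assert (W1 : (E * E') ^ 2 = be p / ga p).
  { unfold E, E'. rewrite <- exp_plus.
    replace (t / 2 + t' / 2) with (ln (be p / ga p) / 2) by (unfold t, t'; lra).
    replace (exp (ln (be p / ga p) / 2) ^ 2) with (exp (ln (be p / ga p) / 2) * exp (ln (be p / ga p) / 2)) by ring.
    rewrite exp_half, exp_ln by assumption. reflexivity. }
  assert (W2 : (E * F') ^ 2 = al p / de p).
  { unfold E, F'. rewrite <- exp_plus.
    replace (t / 2 + - (t' / 2)) with (ln (al p / de p) / 2) by (unfold t, t'; lra).
    replace (exp (ln (al p / de p) / 2) ^ 2) with (exp (ln (al p / de p) / 2) * exp (ln (al p / de p) / 2)) by ring.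
    rewrite exp_half, exp_ln by assumption. reflexivity. }
  split.
  { replace (exp t ^ 2) with ((E * E') ^ 2 * (E * F') ^ 2).
    - rewrite W1, W2. field. lra.
    - transitivity ((E * E) ^ 2 * (E' * F') ^ 2); [ring|]. rewrite EF'. unfold E. rewrite exp_half. ring. }
  set (x := exp (l / 2)). set (y := exp (- (l / 2))).
  assert (x0 : 0 < x) by apply exp_pos. assert (y0 : 0 < y) by apply exp_pos.
  assert (D : x - y = 2 * sqrt (al p * de p)).
  { rewrite <- Sl. unfold sinh. fold x y. field. }
  assert (D' : (x + y) ^ 2 = 4 * (be p * ga p)).
  { rewrite <- Cl. unfold cosh. fold x y. field. }
  (* square roots of positive quantities are compared through their squares *)
  assert (Sq : forall u v, 0 < u -> 0 < v -> u ^ 2 = v ^ 2 -> u = v) by (intros; nra).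
  assert (R1 : E * (x - y) = 2 * (al p * E')).
  { apply Sq; [nra | nra |]. rewrite D.
    transitivity (4 * E ^ 2 * sqrt (al p * de p) ^ 2); [ring|]. rewrite S2.
    transitivity (4 * al p ^ 2 * E' ^ 2); [|ring].
    assert (E ^ 2 = al p / de p * E' ^ 2).
    { rewrite <- W2. transitivity (E ^ 2 * (E' * F') ^ 2); [rewrite EF'; ring | ring]. }
    rewrite H. field. lra. }
  assert (R2 : E * (x + y) = 2 * (be p * F')).
  { apply Sq; [nra | nra |].
    transitivity (E ^ 2 * (x + y) ^ 2); [ring|]. rewrite D'.
    assert (E ^ 2 = be p / ga p * F' ^ 2).
    { rewrite <- W1. transitivity (E ^ 2 * (E' * F') ^ 2); [rewrite EF'; ring | ring]. }
    rewrite H. field. lra. }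
  assert (R3 : F * (x - y) = 2 * (de p * F')).
  { apply Sq; [nra | nra |]. rewrite D.
    transitivity (4 * F ^ 2 * sqrt (al p * de p) ^ 2); [ring|]. rewrite S2.
    assert (F' ^ 2 = al p / de p * F ^ 2).
    { rewrite <- W2. transitivity (F' ^ 2 * (E * F) ^ 2); [rewrite EF; ring | ring]. }
    rewrite Rpow_mult_distr, (Rpow_mult_distr (de p)), H. field. lra. }
  assert (R4 : F * (x + y) = 2 * (ga p * E')).
  { apply Sq; [nra | nra |].
    transitivity (F ^ 2 * (x + y) ^ 2); [ring|]. rewrite D'.
    assert (E' ^ 2 = be p / ga p * F ^ 2).
    { rewrite <- W1. transitivity (E' ^ 2 * (E * F) ^ 2); [rewrite EF; ring | ring]. }
    rewrite Rpow_mult_distr, (Rpow_mult_distr (ga p)), H. field. lra. }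
  split; [rewrite model_tine; lra|]. split; [assumption|]. split.
  - exists t. apply orthogonal_at_dil, quarter_turn_sym, orthogonal_at_dil. apply circle_orthogonal.
  - exists t'. apply orthogonal_at_dil, quarter_turn_sym. rewrite model_lift.
    change (sl2_zpow (monodromy p) 1) with (sl2_mul (monodromy p) sl2_one). rewrite sl2_mul_1r.
    exists (/ sqrt 2), (-1). split; [apply inv_sqrt2_sq|]. split; [ring|].
    cbn [circle sl2_mul dil monodromy ma mb mc md]. fold E F E' F' x y.
    set (k := / sqrt 2). clearbody k.
    repeat split.
    + transitivity (k * (E * x)); [ring|]. replace (E * x) with (al p * E' + be p * F') by lra. ring.
    + transitivity (k * (E * y)); [ring|]. replace (E * y) with (be p * F' - al p * E') by lra. ring.
    + transitivity (- k * (F * x)); [ring|]. replace (F * x) with (ga p * E' + de p * F') by lra. ring.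
    + transitivity (k * (F * y)); [ring|]. replace (F * y) with (ga p * E' - de p * F') by lra. ring.
Qed.

Lemma model_strap_length p c : strap_length (model p) c <-> 0 <= c /\ sinh (c / 2) ^ 2 = al p * de p.
Proof.
  split.
  - intros [[T ->]|(h & s0 & s1 & S & ->)].
    + apply model_tine in T. rewrite T. split; [lra|]. replace (0 / 2) with 0 by lra. rewrite sinh_0. ring.
    + rewrite hdist_geod. assert (L : s0 < s1) by apply S.
      rewrite Rabs_left1, Ropp_minus_distr by lra. split; [lra|]. apply (model_strap p h s0 s1 S).
  - intros [Hc E]. destruct (Req_dec (de p) 0) as [D|D].
    + left. split; [apply model_tine, D|]. rewrite D, Rmult_0_r in E.
      assert (c / 2 = 0); [|lra]. apply sinh_sq_inj; [lra | lra |]. rewrite E, sinh_0. ring.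
    + pose proof (de_pos p). destruct (model_strap_exists p) as (t & l & Hl & El & _ & S); [lra|].
      right. exists (circle t), 0, l. split; [assumption|]. rewrite hdist_geod.
      rewrite Rabs_left1, Ropp_minus_distr, Rminus_0_r by lra.
      assert (c / 2 = l / 2); [|lra]. apply sinh_sq_inj; [lra | lra |]. congruence.
Qed.

(** The ends of the geodesic over the neck are the eigenvectors of the
    monodromy. *)
Lemma model_covers_neck p h l : covers_neck (model p) h l ->
  al p - de p = 2 * cosh (l / 2) /\
  act (monodromy p) (ma h, mc h) = (exp (l / 2) * ma h, exp (l / 2) * mc h) /\
  act (monodromy p) (mb h, md h) = (exp (- (l / 2)) * mb h, exp (- (l / 2)) * md h).
Proof.
  intros [Hl K]. cbn [model hol] in K.
  set (k := sl2_mul (sl2_mul (sl2_inv h) (monodromy p)) h).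
  assert (Hk : sl2_mul h k = sl2_mul (monodromy p) h).
  { unfold k. rewrite !sl2_mul_assoc, sl2_mul_invr, sl2_mul_1l. reflexivity. }
  assert (Tr : ma k + md k = al p - de p).
  { unfold k; cbn [sl2_mul sl2_inv monodromy ma mb mc md].
    transitivity ((ma h * md h - mb h * mc h) * (al p - de p)); [ring|]. rewrite sl2_det; ring. }
  clearbody k.
  assert (Kg : forall t, geod k t = (0, exp (t + l))).
  { intros t. apply (mob_inj h); [apply geod_im | apply exp_pos|].
    rewrite <- geod_mul, Hk, geod_mul, K. reflexivity. }
  assert (K0 := Kg 0). assert (K1 := Kg (ln 2)). rewrite geod_coord in K0, K1.
  rewrite exp_plus, exp_0 in K0. rewrite exp_plus, (exp_ln 2) in K1 by lra.
  pose proof (geod_den k 0) as N0. pose proof (geod_den k (ln 2)) as N1.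
  rewrite exp_0 in N0. rewrite (exp_ln 2) in N1 by lra.
  pose proof (sl2_det k) as Dk.
  assert (U0 := f_equal fst K0). assert (V0 := f_equal snd K0). assert (V1 := f_equal snd K1).
  cbn [fst snd] in U0, V0, V1. clear K0 K1 Kg.
  set (L := exp l) in *. assert (L0 : 0 < L) by apply exp_pos.
  assert (U0' : ma k * mc k * 1 ^ 2 + mb k * md k = 0 * ((mc k * 1) ^ 2 + md k ^ 2))
    by (rewrite <- U0; field; lra).
  assert (V0' : 1 = 1 * L * ((mc k * 1) ^ 2 + md k ^ 2))
    by (rewrite <- V0; field; lra).
  assert (V1' : 2 = 2 * L * ((mc k * 2) ^ 2 + md k ^ 2))
    by (rewrite <- V1; field; lra).
  assert (C0 : mc k = 0).
  { assert (H : L * mc k ^ 2 = 0) by lra. apply Rmult_integral in H. destruct H as [H|H]; [lra|].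
    destruct (Req_dec (mc k) 0) as [Z|Z]; [assumption|]. pose proof (pow2_gt_0 _ Z). lra. }
  clear U0 V0 V1 N0 N1.
  rewrite C0 in *.
  assert (D2 : L * md k ^ 2 = 1) by lra.
  assert (D0 : md k <> 0) by (intros Z; rewrite Z in D2; lra).
  assert (AD : ma k * md k = 1) by lra.
  assert (B0 : mb k = 0).
  { assert (Z : mb k * md k = 0) by lra. apply Rmult_integral in Z. tauto. }
  assert (A2 : ma k ^ 2 = L).
  { transitivity (ma k ^ 2 * (L * md k ^ 2)); [rewrite D2; ring|].
    transitivity (L * (ma k * md k) ^ 2); [ring|]. rewrite AD; ring. }
  pose proof (shape_trace p) as Tp.
  assert (Apos : 0 < ma k) by nra. assert (Dpos : 0 < md k) by nra.
  set (x := exp (l / 2)). set (y := exp (- (l / 2))).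
  assert (x0 : 0 < x) by apply exp_pos. assert (y0 : 0 < y) by apply exp_pos.
  assert (xx : x * x = L) by apply exp_half.
  assert (xy : x * y = 1) by apply exp_mul_opp.
  assert (Ax : ma k = x) by nra.
  assert (Dy : md k = y) by (apply (Rmult_eq_reg_l x); [rewrite <- Ax at 1; lra | lra]).
  split; [|split].
  - rewrite <- Tr, Ax, Dy. unfold cosh. fold x y. field.
  - assert (E1 := f_equal ma Hk). assert (E2 := f_equal mc Hk).
    cbn [sl2_mul ma mb mc md monodromy] in E1, E2. rewrite C0, Ax in E1, E2.
    unfold act; cbn [monodromy ma mb mc md fst snd]. f_equal; lra.
  - assert (E1 := f_equal mb Hk). assert (E2 := f_equal md Hk).
    cbn [sl2_mul ma mb mc md monodromy] in E1, E2. rewrite B0, Dy in E1, E2.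
    unfold act; cbn [monodromy ma mb mc md fst snd]. f_equal; lra.
Qed.

Lemma model_cusp p : is_cusp (model p) <-> al p - de p = 2.
Proof.
  unfold is_cusp; cbn [model hol monodromy ma md]. pose proof (shape_trace p). split; intros; nra.
Qed.

Lemma model_neck_exists p d : 0 < d -> al p - de p = 2 * cosh (d / 2) ->
  exists h, covers_neck (model p) h d.
Proof.
  intros Hd Tr.
  set (x := exp (d / 2)). set (y := exp (- (d / 2))).
  assert (Txy : al p - de p = x + y) by (rewrite Tr; unfold cosh; fold x y; field).
  assert (y0 : 0 < y) by apply exp_pos.
  assert (yx : y < x) by (apply exp_increasing; lra).
  assert (xy : x * y = 1) by apply exp_mul_opp.
  pose proof (be_pos p) as Hb. pose proof (shape_det p) as Dp.
  set (n := be p * (x - y)). assert (n0 : 0 < n) by (unfold n; nra).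
  assert (D : be p * ((al p - y) / n) - (- be p) * ((x - al p) / n) = 1).
  { unfold n. field. lra. }
  (* columns: the eigenvectors for the eigenvalues [x] and [y] *)
  set (h := mkSL2 (be p) (- be p / n) (x - al p) ((al p - y) / n)
     ltac:(rewrite <- D; field; lra)).
  exists h. split; [assumption|]. intros t. cbn [model hol].
  rewrite <- geod_mul. replace (t + d) with (d + t) by ring. rewrite <- geod_dil.
  apply geod_peq. exists 1. split; [ring|].
  assert (X2 : x * x = x * (al p - de p) - 1) by (rewrite Txy; lra).
  assert (Y2 : y * y = y * (al p - de p) - 1) by (rewrite Txy; lra).
  cbn [h sl2_mul dil monodromy ma mb mc md]. fold x y.
  rewrite !Rmult_1_l. repeat split.
  - ring.
  - field. lra.
  - lra.
  - field_simplify_eq; [|lra]. lra.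
Qed.

Lemma cosh_inj x y : 0 <= x -> 0 <= y -> cosh x = cosh y -> x = y.
Proof.
  intros Hx Hy E. apply sinh_sq_inj; try assumption.
  pose proof (cosh_sinh_sq x) as A. pose proof (cosh_sinh_sq y) as B. rewrite E in A. lra.
Qed.

Lemma model_neck_length p d : neck_length (model p) d <-> 0 <= d /\ al p - de p = 2 * cosh (d / 2).
Proof.
  split.
  - intros [[T ->]|(h & K)].
    + apply model_cusp in T. split; [lra|]. rewrite T. replace (0 / 2) with 0 by lra. rewrite cosh_0. lra.
    + split; [left; apply K|]. apply (model_covers_neck p h d K).
  - intros [Hd E]. destruct Hd as [Hd| <-].
    + right. apply model_neck_exists; assumption.
    + left. split; [|reflexivity]. apply model_cusp. rewrite E.
      replace (0 / 2) with 0 by lra. rewrite cosh_0. lra.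
Qed.

(** * The moduli space is a point *)

(** Half the sum of the diagonal parameters of a shape. *)
Definition half_sum (c d : R) : R := sqrt (cosh (c / 2) ^ 2 + sinh (d / 2) ^ 2).

Lemma half_sum_sq c d : half_sum c d ^ 2 = cosh (c / 2) ^ 2 + sinh (d / 2) ^ 2.
Proof.
  unfold half_sum. apply pow2_sqrt. pose proof (pow2_ge_0 (cosh (c / 2))). pose proof (pow2_ge_0 (sinh (d / 2))). lra.
Qed.

Lemma half_sum_pos c d : 0 < half_sum c d.
Proof.
  unfold half_sum. apply sqrt_lt_R0. pose proof (cosh_ge_1 (c / 2)). pose proof (pow2_ge_0 (sinh (d / 2))). nra.
Qed.

Lemma half_sum_ge c d : cosh (d / 2) <= half_sum c d.
Proof.
  pose proof (half_sum_sq c d). pose proof (half_sum_pos c d). pose proof (cosh_sinh_sq (d / 2)).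
  pose proof (cosh_ge_1 (c / 2)). pose proof (cosh_pos (d / 2)). nra.
Qed.

Lemma half_sum_gt c d : 0 < c -> cosh (d / 2) < half_sum c d.
Proof.
  intros Hc. pose proof (half_sum_sq c d). pose proof (half_sum_pos c d). pose proof (cosh_sinh_sq (d / 2)).
  pose proof (cosh_sinh_sq (c / 2)). pose proof (sinh_pos (c / 2) ltac:(lra)). pose proof (cosh_pos (d / 2)). nra.
Qed.

Lemma shape_half_sum p c d : in_moduli c d (model p) ->
  al p = half_sum c d + cosh (d / 2) /\ de p = half_sum c d - cosh (d / 2) /\
  be p * ga p = cosh (c / 2) ^ 2.
Proof.
  intros [S N]. apply model_strap_length in S. apply model_neck_length in N.
  destruct S as [_ S], N as [_ N].
  pose proof (half_sum_sq c d). pose proof (half_sum_pos c d).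
  pose proof (cosh_sinh_sq (c / 2)). pose proof (cosh_sinh_sq (d / 2)).
  pose proof (al_pos p). pose proof (de_pos p). pose proof (shape_det p).
  assert (E : (al p + de p) ^ 2 = (2 * half_sum c d) ^ 2).
  { transitivity ((al p - de p) ^ 2 + 4 * (al p * de p)); [ring|]. rewrite <- S, N.
    transitivity (4 * half_sum c d ^ 2); [rewrite H; lra | ring]. }
  assert (al p + de p = 2 * half_sum c d) by nra.
  repeat split; lra.
Qed.

Lemma canonical_det c d :
  cosh (c / 2) * cosh (c / 2)
  - (half_sum c d + cosh (d / 2)) * (half_sum c d - cosh (d / 2)) = 1.
Proof.
  pose proof (half_sum_sq c d). pose proof (cosh_sinh_sq (d / 2)). nra.
Qed.

Lemma canonical_de c d : 0 <= half_sum c d - cosh (d / 2).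
Proof. pose proof (half_sum_ge c d). lra. Qed.

Lemma canonical_trace c d : 2 <= half_sum c d + cosh (d / 2) - (half_sum c d - cosh (d / 2)).
Proof. pose proof (cosh_ge_1 (d / 2)). lra. Qed.

Definition canonical (c d : R) : shape :=
  mkShape _ _ _ _ (cosh_pos (c / 2)) (cosh_pos (c / 2)) (canonical_de c d)
          (canonical_det c d) (canonical_trace c d).

Lemma canonical_in_moduli c d : 0 <= c -> 0 <= d -> in_moduli c d (model (canonical c d)).
Proof.
  intros Hc Hd. split.
  - apply model_strap_length. split; [assumption|]. cbn [canonical al de].
    pose proof (canonical_det c d). pose proof (cosh_sinh_sq (c / 2)). lra.
  - apply model_neck_length. split; [assumption|]. cbn [canonical al de]. ring.
Qed.

(** Isometries need not respect the parametrisation of the arches. *)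
Lemma isometric_of_matching X Y g :
  (forall k, exists s, peq (lift_arch Y k) (sl2_mul (sl2_mul g (lift_arch X k)) (dil s))) ->
  (forall k, peq (sl2_mul (deck Y k) g) (sl2_mul g (deck X k))) -> isometric X Y.
Proof.
  intros HA HD. exists g. split; [|split].
  - intros z Hz. unfold cover.
    assert (E : forall k, right_of (lift_arch Y k) (mob g z) <-> right_of (lift_arch X k) z).
    { intros k. destruct (HA k) as [s Hs]. rewrite (right_of_peq _ _ _ Hs).
      rewrite <- (right_of_mob g (lift_arch X k)) by assumption.
      rewrite !right_of_side.
      replace (side (sl2_mul (sl2_mul g (lift_arch X k)) (dil s)) (mob g z))
        with (side (sl2_mul g (lift_arch X k)) (mob g z)); [reflexivity|].
      set (G := sl2_mul g (lift_arch X k)). unfold side; cbn [sl2_mul dil ma mb mc md].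
      assert (EE : exp (s / 2) * exp (- (s / 2)) = 1) by apply exp_mul_opp.
      set (u := exp (s / 2)) in *. set (v := exp (- (s / 2))) in *. clearbody u v.
      transitivity (u * v * (- (md G * mc G) * (Re (mob g z) ^ 2 + Im (mob g z) ^ 2) +
        (ma G * md G + mb G * mc G) * Re (mob g z) - ma G * mb G)); [rewrite EE; ring | ring]. }
    split; intros [_ K]; (split; [auto using mob_im_pos|]); intros k; specialize (K k); rewrite E in *; exact K.
  - intros k. exists k. intros z Hz. rewrite <- !mob_mul by assumption. symmetry.
    apply mob_peq; auto.
  - intros k. exists k. intros z Hz. rewrite <- !mob_mul by assumption. symmetry.
    apply mob_peq; auto.
Qed.

(** The lengths determine [al], [de] and the product of [be] and [ga]; a
    translation along the arch changes their ratio at will. *)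
Lemma moduli_point c d X Y : in_moduli c d X -> in_moduli c d Y -> isometric X Y.
Proof.
  intros HX HY. destruct (normal_form X) as [p Hp], (normal_form Y) as [q Hq].
  apply (chart_in_moduli _ _ _ _ _ (chart_sym _ _ _ Hp)) in HX.
  apply (chart_in_moduli _ _ _ _ _ (chart_sym _ _ _ Hq)) in HY.
  apply shape_half_sum in HX, HY. destruct HX as (A1 & D1 & B1), HY as (A2 & D2 & B2).
  pose proof (be_pos p) as bp. pose proof (be_pos q) as bq. pose proof (ga_pos p) as gp. pose proof (ga_pos q) as gq.
  assert (R0 : 0 < be q / be p) by (apply Rdiv_lt_0_compat; assumption).
  set (t := ln (be q / be p)).
  assert (Et : exp t = be q / be p) by (apply exp_ln; assumption).
  assert (Hmon : sl2_mul (monodromy q) (dil t) = sl2_mul (dil t) (monodromy p)).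
  { assert (Eh : exp (t / 2) = be q / be p * exp (- (t / 2))).
    { rewrite <- Et, <- exp_plus. f_equal. lra. }
    assert (Eg : ga q * be q = ga p * be p) by lra.
    apply sl2_ext; cbn [sl2_mul dil monodromy ma mb mc md]; rewrite ?Eh, ?A1, ?A2, ?D1, ?D2; try ring.
    - field. lra.
    - field_simplify_eq; [|lra].
      transitivity (- (ga q * be q) * exp (- (t / 2))); [ring|]. rewrite Eg. ring. }
  assert (Hconj : monodromy q = sl2_mul (sl2_mul (dil t) (monodromy p)) (sl2_inv (dil t))).
  { rewrite <- Hmon, <- sl2_mul_assoc, sl2_mul_invr, sl2_mul_1r. reflexivity. }
  assert (HD : forall k, sl2_mul (sl2_zpow (monodromy q) k) (dil t) = sl2_mul (dil t) (sl2_zpow (monodromy p) k)).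
  { intros k. rewrite Hconj, conj_zpow, <- sl2_mul_assoc, sl2_mul_invl, sl2_mul_1r. reflexivity. }
  set (g := sl2_mul (sl2_mul (arch Y) (dil t)) (sl2_inv (arch X))).
  assert (Hg : sl2_mul g (arch X) = sl2_mul (arch Y) (dil t)).
  { unfold g. rewrite <- sl2_mul_assoc, sl2_mul_invl, sl2_mul_1r. reflexivity. }
  apply (isometric_of_matching X Y g).
  - intros k. exists (- t).
    eapply peq_trans; [apply (chart_lift_arch _ _ _ k Hq)|].
    eapply peq_trans; [|apply peq_sym, peq_mul; [apply peq_mul; [apply peq_refl | apply (chart_lift_arch _ _ _ k Hp)] | apply peq_refl]].
    rewrite !model_lift, sl2_mul_assoc, Hg, <- !(sl2_mul_assoc (arch Y)), <- HD, <- sl2_mul_assoc.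
    replace (sl2_mul (dil t) (dil (- t))) with sl2_one; [rewrite sl2_mul_1r; apply peq_refl|].
    apply sl2_ext; cbn [sl2_one sl2_mul dil ma mb mc md]; try ring;
      rewrite ?Rmult_0_l, ?Rmult_0_r, ?Rplus_0_l, ?Rplus_0_r, <- exp_plus;
      replace (- t / 2) with (- (t / 2)) by lra; rewrite ?Ropp_involutive, ?Rplus_opp_r, ?Rplus_opp_l, exp_0; reflexivity.
  - intros k.
    (* compare both sides after composing with the chart of [X] *)
    assert (K : peq (sl2_mul (sl2_mul (deck Y k) g) (arch X)) (sl2_mul (sl2_mul g (deck X k)) (arch X))).
    { rewrite <- !sl2_mul_assoc, Hg.
      eapply peq_trans.
      - rewrite sl2_mul_assoc. apply peq_mul; [apply (chart_deck_mul _ _ _ k Hq) | apply peq_refl].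
      - apply peq_sym. eapply peq_trans.
        + apply peq_mul; [apply peq_refl | apply (chart_deck_mul _ _ _ k Hp)].
        + rewrite sl2_mul_assoc, Hg, <- !sl2_mul_assoc.
          unfold deck; cbn [model hol]. rewrite HD. apply peq_refl. }
    apply (fun H => peq_mul _ _ _ _ H (peq_refl (sl2_inv (arch X)))) in K.
    rewrite <- !sl2_mul_assoc, !sl2_mul_invr, !sl2_mul_1r in K. exact K.
Qed.

(** * The universal cover of a model crown *)

(** [0 <= right_edge p z] outside the half-plane removed along the next arch. *)
Definition right_edge (p : shape) (z : C) : R :=
  ga p * de p * nsq z + (al p * de p + be p * ga p) * Re z + al p * be p.

Lemma monodromy_side p z : side (monodromy p) z = - right_edge p z.
Proof. unfold side, right_edge, nsq; cbn [monodromy ma mb mc md]. ring. Qed.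

Lemma model_cover p z : cover (model p) z <->
  0 < Im z /\ forall k, side (sl2_zpow (monodromy p) k) z <= 0.
Proof.
  unfold cover. split; intros [Hz H]; (split; [assumption|]); intros k; specialize (H k);
    rewrite model_lift, right_of_side in *.
  - destruct (Rle_or_lt (side (sl2_zpow (monodromy p) k) z) 0); tauto.
  - lra.
Qed.

Lemma model_boundary p z : cover_boundary (model p) z <->
  0 < Im z /\ exists k, side (sl2_zpow (monodromy p) k) z = 0.
Proof.
  unfold cover_boundary. split.
  - intros (k & t & ->). split; [apply geod_im|]. exists k. rewrite model_lift. apply geod_side.
  - intros (Hz & k & H). exists k. destruct (side_geod _ _ Hz H) as [t Ht]. exists t.
    rewrite model_lift. exact Ht.
Qed.

Lemma mob_quadratic g w q1 q2 q3 : 0 < Im w ->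
  (q1 * nsq (mob g w) + q2 * Re (mob g w) + q3) * nrm g w
  = (q1 * ma g ^ 2 + q2 * (ma g * mc g) + q3 * mc g ^ 2) * nsq w
    + (2 * q1 * (ma g * mb g) + q2 * (ma g * md g + mb g * mc g) + 2 * q3 * (mc g * md g)) * Re w
    + (q1 * mb g ^ 2 + q2 * (mb g * md g) + q3 * md g ^ 2).
Proof.
  intros Hw. pose proof (nrm_pos g w Hw) as Hn. rewrite mob_coord by assumption.
  unfold nsq; cbn [Re Im fst snd].
  set (P := ma g * mc g * (Re w ^ 2 + Im w ^ 2)
              + (ma g * md g + mb g * mc g) * Re w + mb g * md g).
  assert (K : (P / nrm g w) ^ 2 + (Im w / nrm g w) ^ 2
     = ((ma g * Re w + mb g) ^ 2 + (ma g * Im w) ^ 2) / nrm g w).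
  { pose proof (sl2_det g) as Hd. field_simplify_eq; [|lra]. unfold nrm, P.
    transitivity ((ma g * mc g * (Re w ^ 2 + Im w ^ 2) +
       (ma g * md g + mb g * mc g) * Re w + mb g * md g) ^ 2
       + (ma g * md g - mb g * mc g) ^ 2 * Im w ^ 2); [rewrite Hd|]; ring. }
  rewrite K. field_simplify_eq; [|lra]. unfold nrm, P. ring.
Qed.

Lemma closed_right_preimage g z : 0 < Im z -> 0 <= side g z ->
  exists w, 0 < Im w /\ 0 <= Re w /\ z = mob g w.
Proof.
  intros Hz H. exists (mob (sl2_inv g) z). split; [apply mob_im_pos, Hz|]. split.
  - pose proof (side_mob_inv g z Hz). pose proof (nrm_pos (sl2_inv g) z Hz). nra.
  - symmetry. apply mob_invr, Hz.
Qed.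

(** All arches but two consecutive ones lie under the geodesic from the end of
    the second to the start of the first: for the powers of the monodromy, the
    quadratic function which vanishes on that geodesic has no positive
    coefficient.  Near the two arches, they alone bound the cover. *)
Lemma other_arches_below p k z : k <> 0%Z -> k <> 1%Z -> 0 < Im z ->
  0 <= side (sl2_zpow (monodromy p) k) z -> ga p * nsq z + al p * Re z < 0.
Proof.
  intros K0 K1 Hz Hs. destruct (closed_right_preimage _ _ Hz Hs) as (w & Hw & Hr & ->).
  pose proof (mob_quadratic (sl2_zpow (monodromy p) k) w (ga p) (al p) 0 Hw) as Q.
  pose proof (nrm_pos (sl2_zpow (monodromy p) k) w Hw) as Hn.
  rewrite Rplus_0_r in Q.
  cut ((ga p * nsq (mob (sl2_zpow (monodromy p) k) w) + al p * Re (mob (sl2_zpow (monodromy p) k) w)) * nrm (sl2_zpow (monodromy p) k) w < 0).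
  { intros. nra. }
  rewrite Q. pose proof (nsq_pos w Hw) as Hq. clear Q Hn Hs Hz.
  pose proof (al_pos p) as Ha. pose proof (be_pos p) as Hb. pose proof (ga_pos p) as Hg.
  pose proof (de_pos p) as Hd. pose proof (shape_det p) as Dt. pose proof (shape_trace p) as Tr.
  assert (BG : be p * ga p = 1 + al p * de p) by lra.
  destruct (Z.lt_trichotomy k 0) as [L|[L|L]]; [|lia|].
  - destruct (monodromy_zpow_neg p k ltac:(lia)) as (x & y & H1 & H2 & _ & E1 & E2 & E3 & E4).
    rewrite E1, E2, E3, E4.
    set (a := x * de p + y). assert (a0 : 0 <= a) by (unfold a; nra).
    set (m := (al p - de p) * x - y). assert (m0 : x < m) by (unfold m; nra).
    replace (ga p * (- (x * de p) - y) ^ 2 + al p * ((- (x * de p) - y) * (x * ga p)) + 0 * (x * ga p) ^ 2)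
      with (- (a * (ga p * m))) by (unfold a, m; ring).
    replace (ga p * (- (x * be p)) ^ 2 + al p * (- (x * be p) * (x * al p - y)) + 0 * (x * al p - y) ^ 2)
      with (- (x * be p * (al p * m - x))).
    2:{ unfold m. transitivity (x * be p * (x * (1 + al p * de p) - al p * (x * al p - y))); [ring|].
        rewrite <- BG. ring. }
    replace (2 * ga p * ((- (x * de p) - y) * - (x * be p)) + al p * ((- (x * de p) - y) * (x * al p - y) + - (x * be p) * (x * ga p)) + 2 * 0 * (x * ga p * (x * al p - y)))
      with (- (a * (al p * m - x) + x * be p * ga p * m)).
    2:{ unfold a, m. transitivity (- ((x * de p + y) * (x * (al p * (al p - de p) - 1) - al p * y) + x * (be p * ga p) * ((al p - de p) * x - y))); [ring|].
        transitivity (2 * (be p * ga p) * (x * de p + y) * x - al p * (x * de p + y) * (x * al p - y) - al p * x * x * (be p * ga p)); [|ring].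
        rewrite BG. ring. }
    assert (G1 : 0 < al p * m - x) by nra.
    assert (G2 : 0 < x * be p) by nra. assert (G3 : 0 < ga p * m) by nra.
    assert (G4 : 0 <= a * (ga p * m)) by nra. assert (G5 : 0 < x * be p * (al p * m - x)) by nra.
    assert (G6 : 0 <= a * (al p * m - x) + x * be p * ga p * m).
    { assert (0 <= a * (al p * m - x)) by nra. assert (0 < x * be p * (ga p * m)) by nra. lra. }
    assert (0 <= (a * (al p * m - x) + x * be p * ga p * m) * Re w) by (apply Rmult_le_pos; assumption).
    assert (0 <= a * (ga p * m) * nsq w) by (apply Rmult_le_pos; lra).
    lra.
  - destruct (monodromy_zpow_pos p k ltac:(lia)) as (x & y & H1 & H2 & H3 & E1 & E2 & E3 & E4).
    destruct (H3 ltac:(lia)) as [H4 H5].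
    rewrite E1, E2, E3, E4.
    assert (P1 : 0 < x * al p - y) by nra.
    assert (P2 : x <= al p * y) by nra.
    replace (ga p * (x * al p - y) ^ 2 + al p * ((x * al p - y) * - (x * ga p)) + 0 * (- (x * ga p)) ^ 2)
      with (- ((x * al p - y) * (ga p * y))) by ring.
    replace (ga p * (x * be p) ^ 2 + al p * (x * be p * (- (x * de p) - y)) + 0 * (- (x * de p) - y) ^ 2)
      with (- (x * be p * (al p * y - x))).
    2:{ transitivity (x * be p * (x * (1 + al p * de p) - al p * (x * de p + y))); [ring|].
        rewrite <- BG. ring. }
    replace (2 * ga p * ((x * al p - y) * (x * be p)) + al p * ((x * al p - y) * (- (x * de p) - y) + x * be p * - (x * ga p)) + 2 * 0 * (- (x * ga p) * (- (x * de p) - y)))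
      with (- ((x * al p - y) * (al p * y - x) + x * be p * ga p * y)).
    2:{ transitivity (- ((x * al p - y) * (al p * y - x) + x * (be p * ga p) * y)); [ring|].
        transitivity (2 * (be p * ga p) * (x * al p - y) * x - al p * (x * al p - y) * (x * de p + y) - al p * x * x * (be p * ga p)); [|ring].
        rewrite BG. ring. }
    assert (G2 : 0 < x * be p) by nra. assert (G3 : 0 < ga p * y) by nra.
    assert (G4 : 0 < (x * al p - y) * (ga p * y)) by nra.
    assert (G5 : 0 <= x * be p * (al p * y - x)) by nra.
    assert (G6 : 0 <= (x * al p - y) * (al p * y - x) + x * be p * ga p * y).
    { assert (0 <= (x * al p - y) * (al p * y - x)) by nra. assert (0 < x * be p * (ga p * y)) by nra. lra. }
    assert (0 <= ((x * al p - y) * (al p * y - x) + x * be p * ga p * y) * Re w) by (apply Rmult_le_pos; assumption).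
    assert (0 < (x * al p - y) * (ga p * y) * nsq w) by (apply Rmult_lt_0_compat; lra).
    lra.
Qed.

Lemma cover_by_edges p z : 0 < Im z -> Re z <= 0 -> 0 <= right_edge p z ->
  0 <= ga p * nsq z + al p * Re z -> cover (model p) z.
Proof.
  intros Hz H0 H1 H2. apply model_cover. split; [assumption|]. intros k.
  destruct (Z.eq_dec k 0) as [->|K0].
  - change (sl2_zpow (monodromy p) 0) with sl2_one. rewrite side_one. assumption.
  - destruct (Z.eq_dec k 1) as [->|K1].
    + rewrite zpow_1, monodromy_side. lra.
    + destruct (Rle_or_lt (side (sl2_zpow (monodromy p) k) z) 0) as [L|L]; [assumption|].
      pose proof (other_arches_below p k z K0 K1 Hz ltac:(lra)). lra.
Qed.

Lemma cover_edges p z : cover (model p) z -> 0 < Im z /\ Re z <= 0 /\ 0 <= right_edge p z.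
Proof.
  rewrite model_cover. intros [Hz H]. split; [assumption|]. split.
  - specialize (H 0%Z). change (sl2_zpow (monodromy p) 0) with sl2_one in H. rewrite side_one in H. assumption.
  - specialize (H 1%Z). rewrite zpow_1, monodromy_side in H. lra.
Qed.

Lemma boundary_left p z : 0 < Im z -> Re z = 0 -> cover_boundary (model p) z.
Proof.
  intros Hz H. apply model_boundary. split; [assumption|]. exists 0%Z.
  change (sl2_zpow (monodromy p) 0) with sl2_one. rewrite side_one. assumption.
Qed.

Lemma boundary_right p z : 0 < Im z -> right_edge p z = 0 -> cover_boundary (model p) z.
Proof.
  intros Hz H. apply model_boundary. split; [assumption|]. exists 1%Z.
  rewrite zpow_1, monodromy_side, H. ring.
Qed.

Lemma re_le_nsq z a : 0 <= a -> nsq z = a ^ 2 -> - a <= Re z.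
Proof. unfold nsq. intros. pose proof (pow2_ge_0 (Im z)). nra. Qed.

Lemma other_arches_inside p k z : k <> 0%Z -> k <> 1%Z -> 0 < Im z ->
  0 <= side (sl2_zpow (monodromy p) k) z -> ga p ^ 2 * nsq z < al p ^ 2.
Proof.
  intros K0 K1 Hz Hs. pose proof (other_arches_below p k z K0 K1 Hz Hs) as H.
  pose proof (ga_pos p). pose proof (al_pos p). pose proof (nsq_pos z Hz).
  assert (Re z < 0) by nra. assert (Re z ^ 2 < nsq z) by (unfold nsq; nra).
  set (n := nsq z) in *. set (x := - Re z) in *.
  assert (0 < x) by (unfold x; lra). assert (x ^ 2 < n) by (unfold x; nra).
  assert (ga p * n < al p * x) by (unfold x; lra).
  assert ((ga p * n) ^ 2 < (al p * x) ^ 2) by (assert (0 < ga p * n) by nra; nra).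
  assert (al p ^ 2 * x ^ 2 < al p ^ 2 * n) by (apply Rmult_lt_compat_l; nra).
  apply (Rmult_lt_reg_r n); [assumption|]. nra.
Qed.

Lemma next_arch_outside p z : 0 < Im z -> right_edge p z <= 0 -> al p ^ 2 <= ga p ^ 2 * nsq z.
Proof.
  intros Hz H. pose proof (ga_pos p) as Hg. pose proof (al_pos p) as Ha. pose proof (be_pos p) as Hb.
  pose proof (de_pos p) as Hd. pose proof (shape_det p) as Dt.
  pose proof (nsq_pos z Hz) as Hn.
  set (r := sqrt (nsq z)). assert (r0 : 0 < r) by (apply sqrt_lt_R0; assumption).
  assert (r2 : nsq z = r ^ 2) by (unfold r; rewrite pow2_sqrt; lra).
  pose proof (re_le_nsq z r ltac:(lra) r2) as Hr. rewrite r2 in *. unfold right_edge in H. rewrite r2 in H.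
  assert (K : (ga p * r - al p) * (de p * r - be p) <= 0).
  { assert ((al p * de p + be p * ga p) * - r <= (al p * de p + be p * ga p) * Re z).
    { apply Rmult_le_compat_l; [nra | assumption]. } nra. }
  destruct (Rle_or_lt (al p) (ga p * r)) as [L|L].
  - assert (al p ^ 2 <= (ga p * r) ^ 2) by nra. nra.
  - exfalso. assert (be p <= de p * r) by nra.
    assert (be p * ga p <= de p * r * ga p) by nra.
    assert (de p * (ga p * r) <= de p * al p) by nra. lra.
Qed.

(** A circle centred at [0] which crosses both the arch and the next one meets
    the cover along a compact arc on that side. *)
Lemma circle_compact p r : al p < ga p * r -> de p * r < be p ->
  exists m, 0 < m /\ forall z, cover (model p) z -> nsq z = r ^ 2 -> m <= Im z.
Proof.
  intros H1 H2. pose proof (ga_pos p) as Hg. pose proof (al_pos p) as Ha. pose proof (be_pos p) as Hb.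
  pose proof (de_pos p) as Hd. pose proof (shape_det p) as Dt.
  set (c := al p * de p + be p * ga p). assert (c0 : 0 < c) by (unfold c; nra).
  set (x := (ga p * de p * r ^ 2 + al p * be p) / c).
  assert (r0 : 0 < r) by nra.
  assert (cx : c * x = ga p * de p * r ^ 2 + al p * be p) by (unfold x; field; lra).
  assert (x0 : 0 <= x) by (apply Rdiv_le_0_compat; [assert (0 <= ga p * de p) by nra; nra | assumption]).
  assert (xr : x < r).
  { apply (Rmult_lt_reg_l c); [assumption|]. rewrite cx. unfold c.
    assert (0 < (ga p * r - al p) * (be p - de p * r)) by (apply Rmult_lt_0_compat; lra). nra. }
  exists (sqrt (r ^ 2 - x ^ 2)). split; [apply sqrt_lt_R0; nra|].
  intros z Hz E. apply cover_edges in Hz. destruct Hz as (Hz & L0 & L1).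
  unfold right_edge in L1. rewrite E in L1. fold c in L1.
  assert (- x <= Re z) by (apply (Rmult_le_reg_l c); [assumption|]; lra).
  rewrite <- (sqrt_pow2 (Im z)) by lra. apply sqrt_le_1_alt.
  unfold nsq in E. nra.
Qed.

(** * Reflection of a model crown *)

Lemma mirror_chord z w : 0 < Im z -> 0 < Im w -> chord (mirror z) (mirror w) = chord z w.
Proof.
  intros Hz Hw. pose proof (nsq_pos z Hz). pose proof (nsq_pos w Hw).
  unfold chord, mirror; cbn [Re Im fst snd]. unfold nsq in *. field. repeat split; lra.
Qed.

Lemma mirror_hdist z w : 0 < Im z -> 0 < Im w -> hdist (mirror z) (mirror w) = hdist z w.
Proof.
  intros Hz Hw. rewrite !hdist_chord, mirror_chord; auto using mirror_im.
Qed.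

Lemma flip_geod g t : geod (flip g) t = mirror (geod g (- t)).
Proof.
  pose proof (geod_den g (- t)) as N. pose proof (geod_den (flip g) t) as N'.
  pose proof (sl2_det g) as D. pose proof (exp_pos t) as Et.
  pose proof (nsq_pos (geod g (- t)) (geod_im g (- t))) as Q.
  rewrite !geod_coord in *. cbn [flip ma mb mc md] in *. rewrite exp_Ropp in *.
  set (E := exp t) in *. clearbody E.
  assert (Q' : nsq ((ma g * mc g * (/ E) ^ 2 + mb g * md g) / ((mc g * / E) ^ 2 + md g ^ 2),
      / E / ((mc g * / E) ^ 2 + md g ^ 2))
      = ((ma g * / E) ^ 2 + mb g ^ 2) / ((mc g * / E) ^ 2 + md g ^ 2)).
  { unfold nsq; cbn [Re Im fst snd].
    assert (Key : (ma g * mc g * (/ E) ^ 2 + mb g * md g) ^ 2 + (/ E) ^ 2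
      = ((ma g * / E) ^ 2 + mb g ^ 2) * ((mc g * / E) ^ 2 + md g ^ 2)).
    { transitivity ((ma g * mc g * (/ E) ^ 2 + mb g * md g) ^ 2 + (ma g * md g - mb g * mc g) ^ 2 * (/ E) ^ 2);
        [rewrite D|]; ring. }
    set (n := (mc g * / E) ^ 2 + md g ^ 2) in *.
    transitivity (((ma g * mc g * (/ E) ^ 2 + mb g * md g) ^ 2 + (/ E) ^ 2) / n ^ 2).
    - unfold Rdiv. rewrite !Rpow_mult_distr, <- (pow_inv n). ring.
    - rewrite Key. field. lra. }
  unfold mirror. rewrite Q'. rewrite Q' in Q. cbn [Re Im fst snd].
  assert (N2 : 0 < (ma g * / E) ^ 2 + mb g ^ 2).
  { apply (Rmult_lt_reg_r (/ ((mc g * / E) ^ 2 + md g ^ 2))); [apply Rinv_0_lt_compat, N|].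
    rewrite Rmult_0_l. exact Q. }
  assert (N3 : 0 < (md g * E) ^ 2 + mc g ^ 2).
  { replace ((md g * E) ^ 2 + mc g ^ 2) with (E ^ 2 * ((mc g * / E) ^ 2 + md g ^ 2)) by (field; lra).
    apply Rmult_lt_0_compat; [apply pow_lt; lra | assumption]. }
  assert (N4 : (ma g * / E) ^ 2 + mb g ^ 2 = ((mb g * E) ^ 2 + ma g ^ 2) / E ^ 2) by (field; lra).
  assert (N5 : (mc g * / E) ^ 2 + md g ^ 2 = ((md g * E) ^ 2 + mc g ^ 2) / E ^ 2) by (field; lra).
  rewrite N4, N5. f_equal; field; repeat split; lra.
Qed.

Lemma mirror_cover p z : 0 < Im z -> cover (model (swap p)) (mirror z) <-> cover (model p) z.
Proof.
  intros Hz. rewrite !model_cover. pose proof (nsq_pos z Hz) as Hn.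
  split; intros [_ H]; (split; [auto using mirror_im|]); intros k.
  - specialize (H (- k)%Z). rewrite <- flip_monodromy in H.
    pose proof (flip_side (sl2_zpow (monodromy p) k) z Hz). nra.
  - specialize (H (- k)%Z). pose proof (flip_side (sl2_zpow (monodromy p) (- k)) z Hz) as F.
    rewrite flip_monodromy, Z.opp_involutive in F. nra.
Qed.

Lemma mirror_boundary p z : cover_boundary (model p) z -> cover_boundary (model (swap p)) (mirror z).
Proof.
  rewrite !model_boundary. intros (Hz & k & H). split; [apply mirror_im, Hz|]. exists (- k)%Z.
  pose proof (flip_side (sl2_zpow (monodromy p) k) z Hz) as F. rewrite flip_monodromy, H in F.
  pose proof (nsq_pos z Hz). nra.
Qed.

Lemma mirror_far p r z : 0 < Im z -> far (model (swap p)) r (mirror z) <-> far (model p) r z.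
Proof.
  intros Hz. unfold far.
  assert (E : forall k, geod (lift_arch (model (swap p)) (- k)) 0 = mirror (geod (lift_arch (model p) k) 0)).
  { intros k. rewrite !model_lift, <- flip_monodromy, flip_geod, Ropp_0. reflexivity. }
  split; intros K k; specialize (K (- k)%Z).
  - rewrite E, mirror_hdist in K; auto using geod_im.
  - rewrite <- (Z.opp_involutive k), E, mirror_hdist; auto using geod_im.
Qed.

Lemma mirror_circle t u : geod (circle (- t)) u = mirror (geod (circle t) u).
Proof.
  rewrite !geod_circle. unfold mirror, nsq; cbn [Re Im fst snd]. rewrite exp_Ropp.
  pose proof (exp_pos t) as P. pose proof (exp_pos u) as U. set (E := exp t) in *. set (F := exp u) in *.
  assert (N : (E * (1 - F ^ 2) / (1 + F ^ 2)) ^ 2 + (E * (2 * F) / (1 + F ^ 2)) ^ 2 = E ^ 2).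
  { field_simplify_eq; [|nra]. ring. }
  rewrite N. f_equal; field; split; nra.
Qed.

Lemma mirror_orth_dom p t u :
  orth_dom (model (swap p)) (circle (- t)) u <-> orth_dom (model p) (circle t) u.
Proof.
  unfold orth_dom. split; intros [P K]; (split; [assumption|]); intros v Hv; specialize (K v Hv);
    rewrite mirror_circle, mirror_cover in *; auto using geod_im.
Qed.

Lemma continuous_mirror z : 0 < Im z -> continuous mirror z.
Proof.
  intros Hz. pose proof (nsq_pos z Hz) as N. unfold mirror, nsq in *.
  assert (Ci : continuous (fun u : C => u) z) by apply continuous_id.
  ct; cbv beta; lra.
Qed.

Lemma zpow_succ g k : sl2_zpow g (k + 1) = sl2_mul g (sl2_zpow g k).
Proof.
  destruct k as [|q|q].
  - reflexivity.
  - replace (Z.pos q + 1)%Z with (Z.pos (Pos.succ q)) by lia.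
    cbn [sl2_zpow]. rewrite Pos2Nat.inj_succ. reflexivity.
  - destruct (Pos.eq_dec q 1) as [->|N].
    + change (sl2_one = sl2_mul g (sl2_mul (sl2_inv g) sl2_one)).
      rewrite sl2_mul_1r, sl2_mul_invr. reflexivity.
    + replace (Z.neg q + 1)%Z with (Z.neg (Pos.pred q)) by lia.
      cbn [sl2_zpow]. replace (Pos.to_nat q) with (S (Pos.to_nat (Pos.pred q))) by lia.
      cbn [sl2_npow]. rewrite sl2_mul_assoc, sl2_mul_invr, sl2_mul_1l. reflexivity.
Qed.

Lemma zpow_add g j k : sl2_zpow g (j + k) = sl2_mul (sl2_zpow g j) (sl2_zpow g k).
Proof.
  revert j. apply (Z.bi_induction (fun j => sl2_zpow g (j + k) = sl2_mul (sl2_zpow g j) (sl2_zpow g k))).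
  - intros ? ? ->. reflexivity.
  - cbn [sl2_zpow]. rewrite sl2_mul_1l. reflexivity.
  - intros j. replace (Z.succ j + k)%Z with ((j + k) + 1)%Z by lia.
    replace (Z.succ j) with (j + 1)%Z by lia. rewrite !zpow_succ, <- sl2_mul_assoc.
    split; intros H.
    + rewrite H. reflexivity.
    + apply (f_equal (sl2_mul (sl2_inv g))) in H.
      rewrite !sl2_mul_assoc, sl2_mul_invl, !sl2_mul_1l in H. exact H.
Qed.

(** Reflected peripheral curves are peripheral, around the previous boundary
    puncture. *)
Lemma mirror_peripheral p t :
  is_peripheral (model p) (circle t) -> is_peripheral (model (swap p)) (circle (- t)).
Proof.
  intros (f & (s0 & s1 & L & (t0 & E0) & (t1 & E1)) & K).
  exists (sl2_mul (monodromy (swap p)) (flip f)).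
  assert (Q1 : sl2_mul (monodromy (swap p)) (flip (monodromy p)) = sl2_one).
  { apply sl2_ext; cbn [monodromy flip swap sl2_mul sl2_one al be ga de ma mb mc md];
      try rewrite <- (shape_det p); ring. }
  split.
  - exists (- s1), (- s0). split; [lra|]. split.
    + exists (- t1). rewrite geod_mul, flip_geod, Ropp_involutive, E1.
      rewrite <- (Ropp_involutive t1), <- flip_geod, Ropp_involutive.
      rewrite <- geod_mul, model_lift, zpow_1, Q1. reflexivity.
    + exists (- t0). rewrite geod_mul, flip_geod, Ropp_involutive, E0.
      rewrite <- (Ropp_involutive t0), <- flip_geod, Ropp_involutive.
      rewrite <- geod_mul, model_lift, zpow_1. cbn [model arch]. rewrite flip_one, sl2_mul_1r. reflexivity.
  - intros r. destruct (K r) as (H & PH & HH).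
    pose proof (mirror_orth_dom p t) as D.
    exists (fun s u => mirror (H s u)). split.
    + revert PH. apply proper_homotopy_image.
      * exact D.
      * apply mirror_circle.
      * apply continuous_mirror.
      * intros z Hz. apply mirror_cover; [apply (cover_im _ _ Hz) | exact Hz].
      * apply mirror_boundary.
      * intros r' z Hz. apply mirror_far, Hz.
    + intros u Hu. apply D in Hu. destruct (HH u Hu) as [F (k & R1)].
      assert (Im0 : 0 < Im (H 1 u)) by apply R1.
      split; [apply mirror_far; assumption|]. exists (- k - 1)%Z.
      replace (sl2_mul (deck (model (swap p)) (- k - 1)) (sl2_mul (monodromy (swap p)) (flip f)))
        with (flip (sl2_mul (deck (model p) k) f)); [apply flip_right; assumption|].
      rewrite flip_mul, sl2_mul_assoc. f_equal. unfold deck; cbn [model hol].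
      rewrite flip_monodromy. rewrite <- (zpow_1 (monodromy (swap p))) at 3.
      rewrite <- zpow_add. f_equal. lia.
Qed.

(** * Peripheral orthojectories *)

(** The left-hand side is twice the hyperbolic cosine of the distance to [i];
    along a geodesic, it is a combination of [exp t] and [exp (- t)]. *)
Lemma geod_escape h B t :
  (1 + nsq (geod h t)) / Im (geod h t) <= B -> t <= B / (ma h ^ 2 + mc h ^ 2).
Proof.
  intros H. pose proof (geod_den h t) as N. pose proof (exp_pos t) as P. pose proof (sl2_det h) as D.
  assert (M : 0 < ma h ^ 2 + mc h ^ 2).
  { pose proof (pow2_ge_0 (ma h)). pose proof (pow2_ge_0 (mc h)).
    destruct (Req_dec (ma h) 0) as [E|E]; [|pose proof (pow2_gt_0 _ E); lra].
    destruct (Req_dec (mc h) 0) as [F|F]; [rewrite E, F in D; lra|]. pose proof (pow2_gt_0 _ F). lra. }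
  assert (Q : (1 + nsq (geod h t)) / Im (geod h t)
     = (ma h ^ 2 + mc h ^ 2) * exp t + (mb h ^ 2 + md h ^ 2) / exp t).
  { rewrite geod_coord. unfold nsq; cbn [Re Im fst snd].
    set (n := (mc h * exp t) ^ 2 + md h ^ 2) in *.
    assert (K : (ma h * mc h * exp t ^ 2 + mb h * md h) ^ 2 + exp t ^ 2
      = n * ((ma h * exp t) ^ 2 + mb h ^ 2)).
    { unfold n. transitivity ((ma h * mc h * exp t ^ 2 + mb h * md h) ^ 2 + (ma h * md h - mb h * mc h) ^ 2 * exp t ^ 2);
        [rewrite D|]; ring. }
    transitivity ((n ^ 2 + ((ma h * mc h * exp t ^ 2 + mb h * md h) ^ 2 + exp t ^ 2)) / (n * exp t)).
    - field. lra.
    - rewrite K. transitivity ((n + ((ma h * exp t) ^ 2 + mb h ^ 2)) / exp t); [field; lra|].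
      unfold n. field. lra. }
  rewrite Q in H.
  assert (0 <= (mb h ^ 2 + md h ^ 2) / exp t).
  { apply Rdiv_le_0_compat; [|assumption]. pose proof (pow2_ge_0 (mb h)). pose proof (pow2_ge_0 (md h)). lra. }
  apply (Rmult_le_reg_l (ma h ^ 2 + mc h ^ 2)); [assumption|].
  replace ((ma h ^ 2 + mc h ^ 2) * (B / (ma h ^ 2 + mc h ^ 2))) with B by (field; lra).
  pose proof (exp_ineq1_le t).
  assert ((ma h ^ 2 + mc h ^ 2) * t <= (ma h ^ 2 + mc h ^ 2) * exp t) by (apply Rmult_le_compat_l; lra).
  lra.
Qed.

(** A semiflow that pushes a region of the cover, along its boundary, into a
    boundary puncture makes the orthojectories of that region peripheral; the
    function [e] measures the depth. *)
Lemma push_peripheral X h f (Phi : R -> C -> C) (U : C -> Prop) (e : C -> R) em :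
  cuts_off X f ->
  (forall t, orth_dom X h t -> U (geod h t)) ->
  (forall z, U z -> cover X z) ->
  (forall z s, U z -> 0 <= s -> U (Phi s z)) ->
  (forall z, U z -> Phi 0 z = z) ->
  (forall z s, U z -> 0 <= s -> continuous (fun q : R * C => Phi (fst q) (snd q)) (s, z)) ->
  (forall z s, U z -> 0 <= s -> cover_boundary X z -> cover_boundary X (Phi s z)) ->
  orth_dom X h 0 -> cover_boundary X (geod h 0) ->
  (forall T, orth_dom X h T -> (forall t, orth_dom X h t -> t <= T) -> cover_boundary X (geod h T)) ->
  (forall z s, U z -> 0 <= s -> e (Phi s z) = e z + s) ->
  (forall t, orth_dom X h t -> em <= e (geod h t)) ->
  (forall r, exists E, forall z, U z -> E < e z -> far X r z /\ right_of f z) ->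
  (forall E, exists B, forall z, U z -> em <= e z <= E -> (1 + nsq z) / Im z <= B) ->
  is_peripheral X h.
Proof.
  intros Hf HU Hcov Hst Hid Hct Hbd Hd0 Hb0 HbT He Hem Hfar Hesc.
  exists f. split; [assumption|]. intros r.
  destruct (Hfar r) as [E HE].
  set (L := Rmax 0 (E - em + 1)).
  assert (L0 : 0 <= L) by apply Rmax_l. assert (L1 : E - em + 1 <= L) by apply Rmax_r.
  exists (fun s t => Phi (s * L) (geod h t)). split.
  - split.
    + intros [s t] [Hs Ht]; cbn [fst snd] in *.
      apply (continuous_within (U := prod_UniformSpace R_UniformSpace R_UniformSpace)
        (V := C_UniformSpace) _ (fun q : R * R => Phi (fst q * L) (geod h (snd q))) (s, t)).
      apply (continuous_comp_2 (U := prod_UniformSpace R_UniformSpace R_UniformSpace)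
        (V := R_UniformSpace) (W := C_UniformSpace) (fun q => fst q * L) (fun q => geod h (snd q)) Phi).
      * apply (ct_mult fst (fun _ => L)); [|apply ct_const].
        apply (continuous_fst (U := R_UniformSpace) (V := R_UniformSpace)).
      * apply (continuous_comp (U := prod_UniformSpace R_UniformSpace R_UniformSpace) snd (geod h)).
        -- apply (continuous_snd (U := R_UniformSpace) (V := R_UniformSpace)).
        -- apply continuous_geod.
      * cbn [fst snd]. apply Hct; [apply HU, Ht | nra].
    + intros s t Hs Ht. apply Hcov, Hst; [apply HU, Ht | nra].
    + intros t Ht. rewrite Rmult_0_l. apply Hid, HU, Ht.
    + intros s Hs. apply Hbd; [apply HU, Hd0 | nra | assumption].
    + intros T HT Hmax s Hs. apply Hbd; [apply HU, HT | nra | apply HbT; assumption].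
    + intros r'. destruct (Hfar r') as [E' HE']. destruct (Hesc E') as [B HB].
      exists (B / (ma h ^ 2 + mc h ^ 2)). intros s t Hs Ht Hn. apply geod_escape, HB; [apply HU, Ht|].
      split; [apply Hem, Ht|].
      assert (sL : 0 <= s * L) by nra.
      destruct (Rle_or_lt (e (geod h t)) E') as [Q|Q]; [assumption|exfalso].
      apply Hn. apply HE'; [apply Hst; [apply HU, Ht | assumption]|].
      rewrite He; [lra | apply HU, Ht | assumption].
  - intros t Ht. rewrite Rmult_1_l. pose proof (Hem t Ht).
    destruct (HE (Phi L (geod h t))) as [F G].
    + apply Hst; [apply HU, Ht | assumption].
    + rewrite He; [lra | apply HU, Ht | assumption].
    + split; [assumption|]. exists 0%Z. change (deck X 0) with sl2_one. rewrite sl2_mul_1l. assumption.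
Qed.

(** ** The orthojectories towards the next arch *)

(** The part of the cover between the arch and the next one. *)
Definition gap (p : shape) (z : C) : Prop :=
  0 < Im z /\ Re z <= 0 /\ 0 <= right_edge p z /\ al p ^ 2 <= ga p ^ 2 * nsq z.

Lemma gap_above p z : gap p z -> 0 <= ga p * nsq z + al p * Re z.
Proof.
  intros (Hz & H0 & _ & H2). pose proof (ga_pos p) as Hg. pose proof (al_pos p) as Ha.
  pose proof (nsq_pos z Hz) as Hn.
  set (r := sqrt (nsq z)). assert (r0 : 0 < r) by (apply sqrt_lt_R0; assumption).
  assert (r2 : nsq z = r ^ 2) by (unfold r; rewrite pow2_sqrt; lra).
  pose proof (re_le_nsq z r ltac:(lra) r2) as Hr. rewrite r2 in *.
  assert (al p <= ga p * r) by (assert (0 < ga p * r) by nra; nra).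
  assert (al p * r <= ga p * r * r) by nra. nra.
Qed.

Lemma gap_cover p z : gap p z -> cover (model p) z.
Proof.
  intros H. pose proof (gap_above p z H) as Ab. destruct H as (H0 & H1 & H2 & H3).
  apply cover_by_edges; assumption.
Qed.

Lemma gap_boundary p z : gap p z -> cover_boundary (model p) z -> Re z = 0 \/ right_edge p z = 0.
Proof.
  intros (Hz & H1 & H2 & H3) B. apply model_boundary in B. destruct B as (_ & k & Hk).
  destruct (Z.eq_dec k 0) as [->|K0].
  - left. change (sl2_zpow (monodromy p) 0) with sl2_one in Hk. rewrite side_one in Hk. assumption.
  - destruct (Z.eq_dec k 1) as [->|K1].
    + right. rewrite zpow_1, monodromy_side in Hk. lra.
    + pose proof (other_arches_inside p k z K0 K1 Hz ltac:(lra)). lra.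
Qed.

Lemma circle_nsq t u : nsq (geod (circle t) u) = exp t ^ 2.
Proof.
  rewrite geod_circle. unfold nsq; cbn [Re Im fst snd]. pose proof (pow2_ge_0 (exp u)).
  field_simplify_eq; [ring | lra].
Qed.

Lemma circle_dom_gap p t u : al p <= ga p * exp t -> orth_dom (model p) (circle t) u ->
  gap p (geod (circle t) u).
Proof.
  intros H [Hu Hc]. pose proof (Hc u ltac:(lra)) as K. apply cover_edges in K.
  destruct K as (K0 & K1 & K2). repeat split; try assumption.
  rewrite circle_nsq. pose proof (al_pos p). nra.
Qed.

Lemma circle_dom_0 p t : al p <= ga p * exp t -> orth_dom (model p) (circle t) 0.
Proof.
  intros H. split; [lra|]. intros u Hu. replace u with 0 by lra. apply gap_cover.
  pose proof (al_pos p) as Ha. pose proof (be_pos p). pose proof (ga_pos p). pose proof (de_pos p).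
  pose proof (circle_nsq t 0) as N.
  assert (E : geod (circle t) 0 = (0, exp t)).
  { rewrite geod_circle, exp_0. f_equal; field. }
  rewrite E in *. unfold gap, right_edge. rewrite N. cbn [Re Im fst snd].
  pose proof (exp_pos t). split; [assumption|]. split; [lra|]. split; [|nra].
  assert (0 <= ga p * de p * exp t ^ 2) by (apply Rmult_le_pos; nra). nra.
Qed.

Lemma circle_boundary_0 p t : cover_boundary (model p) (geod (circle t) 0).
Proof.
  apply boundary_left; [apply geod_im|]. rewrite geod_circle, exp_0; cbn [Re fst]. field.
Qed.

Lemma circle_boundary_max p t T : al p <= ga p * exp t -> orth_dom (model p) (circle t) T ->
  (forall u, orth_dom (model p) (circle t) u -> u <= T) -> cover_boundary (model p) (geod (circle t) T).
Proof.
  intros H HT Hmax. pose proof (circle_dom_gap p t T H HT) as (G0 & G1 & G2 & G3).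
  destruct G1 as [G1|G1]; [|apply boundary_left; assumption].
  destruct G2 as [G2|G2]; [|apply boundary_right; auto].
  exfalso.
  assert (C1 : continuous (fun u => - Re (geod (circle t) u)) T).
  { apply (ct_opp (fun u => Re (geod (circle t) u))), (ct_re (geod (circle t))), continuous_geod. }
  assert (C2 : continuous (fun u => right_edge p (geod (circle t) u)) T).
  { unfold right_edge, nsq. assert (C := continuous_geod (circle t) T). ct. }
  pose proof (continuous_pos_locally _ _ C1 ltac:(lra)) as L1.
  pose proof (continuous_pos_locally _ _ C2 G2) as L2.
  destruct (filter_and _ _ L1 L2) as [eps Heps].
  assert (HTe : orth_dom (model p) (circle t) (T + eps / 2)).
  { destruct HT as [T0 HT]. pose proof (cond_pos eps). split; [lra|]. intros u Hu.
    destruct (Rle_or_lt u T) as [L|L]; [apply HT; lra|].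
    apply gap_cover. destruct (Heps u) as [K1 K2].
    - unfold ball; cbn. unfold AbsRing_ball, abs, minus, plus, opp; cbn. rewrite Rabs_pos_eq; lra.
    - repeat split; [apply geod_im | lra | lra |]. rewrite circle_nsq. pose proof (al_pos p). nra. }
  pose proof (Hmax _ HTe). pose proof (cond_pos eps). lra.
Qed.

(** Depth functions: the lifts of the base point of the arch have bounded
    depth, so that points of large depth are far. *)
Lemma model_far_by_depth p (e : C -> R) b :
  (forall k, k <> 0%Z -> k <> 1%Z -> forall t, e (geod (sl2_zpow (monodromy p) k) t) <= b) ->
  (forall S a, exists E, forall z w, 0 < Im z -> 0 < Im w -> E < e z -> e w <= a -> S < chord z w) ->
  forall r, exists E, forall z, 0 < Im z -> E < e z -> far (model p) r z.
Proof.
  intros Hb He r.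
  set (a := Rmax b (Rmax (e (geod sl2_one 0)) (e (geod (monodromy p) 0)))).
  destruct (He (4 * sinh (Rabs r / 2) ^ 2) a) as [E HE]. exists E. intros z Hz Ez k.
  apply hdist_gt; [assumption | apply geod_im|]. apply HE; auto using geod_im. rewrite model_lift.
  destruct (Z.eq_dec k 0) as [->|K0].
  - apply Rle_trans with (Rmax (e (geod sl2_one 0)) (e (geod (monodromy p) 0))); [apply Rmax_l | apply Rmax_r].
  - destruct (Z.eq_dec k 1) as [->|K1].
    + rewrite zpow_1.
      apply Rle_trans with (Rmax (e (geod sl2_one 0)) (e (geod (monodromy p) 0))); [apply Rmax_r | apply Rmax_r].
    + apply Rle_trans with b; [apply Hb; assumption | apply Rmax_l].
Qed.

(** ** Pushing into a flipper *)

(** Hyperbolic sine of the signed distance to the geodesic [|z| = r0], and the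
    hyperbolic cosine of the distance to the point [i r0] if [Re z = 0]. *)
Definition depth (r0 : R) (z : C) : R := (nsq z - r0 ^ 2) / (2 * r0 * Im z).
Definition width (r0 : R) (z : C) : R := (nsq z + r0 ^ 2) / (2 * r0 * Im z).

(** The point with given [Re z / Im z], [width] and [depth]. *)
Definition band_point (r0 x f e : R) : C := (x * (r0 / (f - e)), r0 / (f - e)).

Lemma width_depth r0 z : 0 < r0 -> 0 < Im z ->
  width r0 z ^ 2 = 1 + (Re z / Im z) ^ 2 + depth r0 z ^ 2.
Proof. intros. unfold width, depth, nsq. field. lra. Qed.

Lemma width_pos r0 z : 0 < r0 -> 0 < Im z -> 0 < width r0 z.
Proof.
  intros. pose proof (nsq_pos z H0). apply Rdiv_lt_0_compat; [nra|]. nra.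
Qed.

Lemma band_point_spec r0 x f e : 0 < r0 -> 0 < f -> f ^ 2 = 1 + x ^ 2 + e ^ 2 ->
  let z := band_point r0 x f e in
  0 < Im z /\ Re z / Im z = x /\ width r0 z = f /\ depth r0 z = e.
Proof.
  intros Hr Hf E z. assert (P : 0 < f - e) by nra.
  assert (I : 0 < Im z) by (apply Rdiv_lt_0_compat; assumption).
  split; [assumption|].
  assert (N : nsq z = r0 ^ 2 * (f + e) / (f - e)).
  { unfold z, band_point, nsq; cbn [Re Im fst snd].
    transitivity (r0 ^ 2 * (1 + x ^ 2) / (f - e) ^ 2); [field; lra|].
    replace (1 + x ^ 2) with ((f - e) * (f + e)) by (ring_simplify; lra). field. lra. }
  repeat split.
  - unfold z, band_point; cbn [Re Im fst snd]. field. lra.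
  - unfold width. rewrite N. unfold z, band_point; cbn [Re Im fst snd]. field. lra.
  - unfold depth. rewrite N. unfold z, band_point; cbn [Re Im fst snd]. field. lra.
Qed.

Lemma band_point_id r0 z : 0 < r0 -> 0 < Im z ->
  band_point r0 (Re z / Im z) (width r0 z) (depth r0 z) = z.
Proof.
  intros Hr Hz. unfold band_point.
  replace (r0 / (width r0 z - depth r0 z)) with (Im z).
  - destruct z as [x y]; cbn [Re Im fst snd] in *. f_equal. field. lra.
  - replace (width r0 z - depth r0 z) with (r0 / Im z); [field; lra|].
    unfold width, depth. field. lra.
Qed.

(** The factor by which [Re z / Im z] and [width] grow when [depth] increases
    by [s], in view of [width_depth]. *)
Definition stretch (e s : R) : R := sqrt ((1 + (e + s) ^ 2) / (1 + e ^ 2)).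

(** The flow along the geodesics orthogonal to the strap, which preserves all
    geodesics orthogonal to those. *)
Definition band_flow (r0 s : R) (z : C) : C :=
  let m := stretch (depth r0 z) s in
  band_point r0 (m * (Re z / Im z)) (m * width r0 z) (depth r0 z + s).

Lemma stretch_sq e s : stretch e s ^ 2 * (1 + e ^ 2) = 1 + (e + s) ^ 2.
Proof.
  pose proof (pow2_ge_0 e). pose proof (pow2_ge_0 (e + s)).
  unfold stretch. rewrite pow2_sqrt; [field; lra|]. apply Rdiv_le_0_compat; lra.
Qed.

Lemma stretch_pos e s : 0 < stretch e s.
Proof.
  pose proof (pow2_ge_0 e). pose proof (pow2_ge_0 (e + s)).
  apply sqrt_lt_R0, Rdiv_lt_0_compat; lra.
Qed.

Lemma band_flow_spec r0 s z : 0 < r0 -> 0 < Im z ->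
  let m := stretch (depth r0 z) s in let z' := band_flow r0 s z in
  0 < Im z' /\ Re z' / Im z' = m * (Re z / Im z) /\ width r0 z' = m * width r0 z /\
  depth r0 z' = depth r0 z + s.
Proof.
  intros Hr Hz m z'. apply band_point_spec; [assumption | |].
  - apply Rmult_lt_0_compat; [apply stretch_pos | apply width_pos; assumption].
  - rewrite !Rpow_mult_distr, width_depth by assumption.
    transitivity (m ^ 2 * (1 + depth r0 z ^ 2) + m ^ 2 * (Re z / Im z) ^ 2); [ring|].
    unfold m. rewrite stretch_sq. ring.
Qed.

Lemma band_flow_id r0 z : 0 < r0 -> 0 < Im z -> band_flow r0 0 z = z.
Proof.
  intros Hr Hz. unfold band_flow.
  replace (stretch (depth r0 z) 0) with 1.
  - rewrite !Rmult_1_l, Rplus_0_r. apply band_point_id; assumption.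
  - unfold stretch. rewrite Rplus_0_r. symmetry.
    replace ((1 + depth r0 z ^ 2) / (1 + depth r0 z ^ 2)) with 1; [apply sqrt_1|].
    field. pose proof (pow2_ge_0 (depth r0 z)). lra.
Qed.

Lemma band_flow_continuous r0 s z : 0 < r0 -> 0 < Im z ->
  continuous (fun q : R * C => band_flow r0 (fst q) (snd q)) (s, z).
Proof.
  intros Hr Hz.
  assert (C1 : continuous (fun q : prod_UniformSpace R_UniformSpace C_UniformSpace => fst q) (s, z))
    by apply continuous_fst.
  assert (C2 : continuous (fun q : prod_UniformSpace R_UniformSpace C_UniformSpace => snd q) (s, z))
    by apply continuous_snd.
  destruct (band_flow_spec r0 s z Hr Hz) as (I & _).
  assert (D : stretch (depth r0 z) s * width r0 z - (depth r0 z + s) <> 0).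
  { unfold band_flow, band_point in I; cbn [Im snd] in I. intros E. rewrite E in I.
    unfold Rdiv in I. rewrite Rinv_0 in I. lra. }
  pose proof (pow2_ge_0 (depth r0 z)) as P.
  unfold band_flow, band_point, stretch, width, depth, nsq in *.
  ct; cbn [fst snd]; try assumption; try lra; apply Rmult_integral_contrapositive_currified; lra.
Qed.

Lemma depth_chord r0 z w : 0 < r0 -> 0 < Im z -> 0 < Im w ->
  chord z w + 2 = 2 * (width r0 z * width r0 w - depth r0 z * depth r0 w - (Re z / Im z) * (Re w / Im w)).
Proof. intros. unfold chord, width, depth, nsq. field. lra. Qed.

Lemma depth_separates r0 : 0 < r0 ->
  forall S a, exists E, forall z w, 0 < Im z -> 0 < Im w -> E < depth r0 z -> depth r0 w <= a -> S < chord z w.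
Proof.
  intros Hr S a. set (b := Rmax a 0). assert (b0 : 0 <= b) by apply Rmax_r.
  set (B := sqrt (1 + b ^ 2)). assert (B2 : B ^ 2 = 1 + b ^ 2) by (apply pow2_sqrt; nra).
  assert (B1 : 1 <= B) by (pose proof (sqrt_pos (1 + b ^ 2)); fold B in H; nra).
  assert (eta0 : 0 < B - b) by nra.
  exists (Rmax 0 ((S + 2) / (2 * (B - b)))). intros z w Hz Hw He Ha.
  set (e := depth r0 z) in *. set (e' := depth r0 w) in *.
  assert (e0 : 0 < e) by (apply Rle_lt_trans with (2 := He); apply Rmax_l).
  assert (e1 : (S + 2) / (2 * (B - b)) < e) by (apply Rle_lt_trans with (2 := He); apply Rmax_r).
  assert (e1' : S + 2 < 2 * (B - b) * e).
  { apply (Rmult_lt_compat_l (2 * (B - b))) in e1; [|lra].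
    replace (2 * (B - b) * ((S + 2) / (2 * (B - b)))) with (S + 2) in e1 by (field; lra). lra. }
  assert (Ha' : e' <= b) by (apply Rle_trans with a; [assumption | apply Rmax_l]).
  pose proof (depth_chord r0 z w Hr Hz Hw) as K. fold e e' in K.
  pose proof (width_depth r0 z Hr Hz) as W1. pose proof (width_depth r0 w Hr Hw) as W2. fold e in W1. fold e' in W2.
  pose proof (width_pos r0 z Hr Hz) as f0. pose proof (width_pos r0 w Hr Hw) as f0'.
  set (f := width r0 z) in *. set (f' := width r0 w) in *.
  set (x := Re z / Im z) in *. set (x' := Re w / Im w) in *. clearbody e e' f f' x x'.
  set (A := sqrt (1 + e ^ 2)). set (A' := sqrt (1 + e' ^ 2)).
  assert (A2 : A ^ 2 = 1 + e ^ 2) by (apply pow2_sqrt; nra).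
  assert (A2' : A' ^ 2 = 1 + e' ^ 2) by (apply pow2_sqrt; nra).
  assert (A0 : 0 <= A) by apply sqrt_pos. assert (A0' : 0 <= A') by apply sqrt_pos. clearbody A A'.
  (* Cauchy-Schwarz *)
  assert (CS : A * A' + x * x' <= f * f').
  { assert (f0f : 0 < f * f') by nra.
    assert ((A * A' + x * x') ^ 2 <= (f * f') ^ 2).
    { rewrite (Rpow_mult_distr f), W1, W2.
      replace ((1 + x ^ 2 + e ^ 2) * (1 + x' ^ 2 + e' ^ 2)) with ((A ^ 2 + x ^ 2) * (A' ^ 2 + x' ^ 2)) by (rewrite A2, A2'; ring).
      pose proof (pow2_ge_0 (A * x' - x * A')). nra. }
    destruct (Rle_or_lt (A * A' + x * x') (f * f')); [assumption|]. nra. }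
  assert (Ae : e <= A) by nra.
  assert (M : B - b <= A' - e').
  { destruct (Rle_or_lt e' 0) as [L|L].
    - assert (1 <= A') by nra. assert (B <= 1 + b) by nra. lra.
    - assert (A' <= B) by nra.
      assert (S1 : (A' - e') * (A' + e') = 1) by lra. assert (S2 : (B - b) * (B + b) = 1) by lra.
      assert (A' + e' <= B + b) by lra.
      apply (Rmult_le_reg_r (B + b)); [lra|]. rewrite S2, <- S1.
      apply Rmult_le_compat_l; nra. }
  assert (e * (A' - e') <= A * A' - e * e') by nra.
  assert ((B - b) * e <= e * (A' - e')) by nra.
  lra.
Qed.

(** A flipper swallows the orthojectories towards the next arch and those
    which run into the flipper itself, pushed by the flow across its strap; the
    arches on both sides are orthogonal to the strap, hence invariant. *)
Lemma flipper_peripheral p t : 0 < de p -> al p < ga p * exp t ->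
  is_peripheral (model p) (circle t).
Proof.
  intros De Ht.
  pose proof (al_pos p) as Ha. pose proof (be_pos p) as Hb. pose proof (ga_pos p) as Hg.
  pose proof (shape_det p) as Dt.
  destruct (model_strap_exists p De) as (t0 & l & Hl & _ & Er & Hstrap).
  set (r0 := exp t0) in *. assert (Hr : 0 < r0) by apply exp_pos.
  set (k := ga p * de p * r0). set (c := al p * de p + be p * ga p).
  assert (k0 : 0 < k) by (unfold k; apply Rmult_lt_0_compat; [nra | assumption]).
  assert (kr : al p * be p = k * r0) by (unfold k; lra).
  assert (kc : c ^ 2 = 1 + 4 * k ^ 2).
  { unfold c, k. transitivity ((be p * ga p - al p * de p) ^ 2 + 4 * (al p * be p) * (ga p * de p)); [ring|].
    rewrite Dt, <- Er. ring. }
  set (k1 := ga p ^ 2 * r0 - al p ^ 2 / r0). set (k2 := ga p ^ 2 * r0 + al p ^ 2 / r0).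
  assert (k1pos : 0 < k1).
  { assert (al p ^ 2 < ga p ^ 2 * r0 ^ 2).
    { apply (Rmult_lt_reg_l (de p)); [assumption|].
      replace (de p * (ga p ^ 2 * r0 ^ 2)) with (ga p * (ga p * de p * r0 ^ 2)) by ring. rewrite Er. nra. }
    unfold k1. apply (Rmult_lt_reg_r r0); [assumption|]. rewrite Rmult_0_l.
    replace ((ga p ^ 2 * r0 - al p ^ 2 / r0) * r0) with (ga p ^ 2 * r0 ^ 2 - al p ^ 2) by (field; lra). lra. }
  assert (k2pos : 0 < k2).
  { unfold k2. assert (0 < al p ^ 2 / r0) by (apply Rdiv_lt_0_compat; nra). nra. }
  assert (FE : forall z, 0 < Im z -> right_edge p z = Im z * (2 * k * width r0 z + c * (Re z / Im z))).
  { intros z Hz. unfold right_edge. rewrite kr. fold c. replace (ga p * de p) with (k / r0) by (unfold k; field; lra).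
    unfold width. field. lra. }
  assert (FN : forall z, 0 < Im z -> ga p ^ 2 * nsq z - al p ^ 2 = Im z * (k1 * width r0 z + k2 * depth r0 z)).
  { intros z Hz. unfold width, depth, k1, k2. field. lra. }
  assert (Hem : exists em, forall u, orth_dom (model p) (circle t) u -> em <= depth r0 (geod (circle t) u)).
  { destruct (Rle_or_lt r0 (exp t)) as [L|L].
    - exists 0. intros u _. unfold depth. rewrite circle_nsq. pose proof (geod_im (circle t) u).
      apply Rdiv_le_0_compat; [|nra]. assert (r0 ^ 2 <= exp t ^ 2) by (apply pow_incr; lra). lra.
    - assert (Q : de p * exp t < be p).
      { apply Rlt_trans with (de p * r0); [apply Rmult_lt_compat_l; assumption|].
        assert (ga p * (de p * r0) < ga p * be p); [|nra].
        assert ((ga p * de p * r0) ^ 2 < (ga p * be p) ^ 2).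
        { replace ((ga p * de p * r0) ^ 2) with (ga p * de p * (ga p * de p * r0 ^ 2)) by ring.
          rewrite Er. replace (ga p * de p * (al p * be p)) with ((be p * ga p) * (al p * de p)) by ring.
          replace ((ga p * be p) ^ 2) with ((be p * ga p) * (be p * ga p)) by ring.
          apply Rmult_lt_compat_l; nra. }
        assert (0 < ga p * be p) by nra. fold k in H |- *. replace (ga p * (de p * r0)) with k by (unfold k; ring). nra. }
      destruct (circle_compact p (exp t) Ht Q) as (m & Hm & Km).
      exists (- (r0 ^ 2 - exp t ^ 2) / (2 * r0 * m)). intros u [Hu Hc].
      specialize (Hc u ltac:(lra)). specialize (Km _ Hc (circle_nsq t u)).
      unfold depth. rewrite circle_nsq.
      assert (0 < r0 ^ 2 - exp t ^ 2) by (pose proof (exp_pos t); nra).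
      set (I := Im (geod (circle t) u)) in *.
      replace ((exp t ^ 2 - r0 ^ 2) / (2 * r0 * I)) with (- ((r0 ^ 2 - exp t ^ 2) / (2 * r0)) * / I) by (field; lra).
      replace (- (r0 ^ 2 - exp t ^ 2) / (2 * r0 * m)) with (- ((r0 ^ 2 - exp t ^ 2) / (2 * r0)) * / m) by (field; lra).
      assert (/ I <= / m) by (apply Rinv_le_contravar; assumption).
      assert (0 < (r0 ^ 2 - exp t ^ 2) / (2 * r0)) by (apply Rdiv_lt_0_compat; lra). nra. }
  destruct Hem as [em Hem].
  assert (Stable : forall z s, 0 < Im z -> 0 <= s ->
     0 <= k1 * width r0 z + k2 * depth r0 z ->
     0 <= k1 * (stretch (depth r0 z) s * width r0 z) + k2 * (depth r0 z + s)).
  { intros z s Hz Hs H. pose proof (stretch_pos (depth r0 z) s) as m0.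
    pose proof (stretch_sq (depth r0 z) s) as m2. pose proof (width_pos r0 z Hr Hz) as f0.
    set (m := stretch (depth r0 z) s) in *. set (e := depth r0 z) in *. set (f := width r0 z) in *. clearbody m e f.
    assert (0 < k1 * (m * f)) by (apply Rmult_lt_0_compat; [|apply Rmult_lt_0_compat]; assumption).
    destruct (Rle_or_lt 0 (e + s)) as [L|L].
    - assert (0 <= k2 * (e + s)) by nra. lra.
    - assert (M : - (e + s) <= m * (- e)).
      { assert ((- (e + s)) ^ 2 <= (m * - e) ^ 2).
        { assert ((e + s) ^ 2 <= e ^ 2) by nra.
          assert (m ^ 2 * e ^ 2 + m ^ 2 = 1 + (e + s) ^ 2) by lra.
          assert (m ^ 2 <= 1).
          { apply (Rmult_le_reg_r (1 + e ^ 2)); [nra|]. lra. }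
          replace ((m * - e) ^ 2) with (m ^ 2 * e ^ 2) by ring.
          replace ((- (e + s)) ^ 2) with ((e + s) ^ 2) by ring. lra. }
        assert (0 < m * - e) by nra. nra. }
      assert (0 <= m * (k1 * f + k2 * e)) by nra.
      assert (k2 * (- (e + s)) <= k2 * (m * - e)) by (apply Rmult_le_compat_l; lra). lra. }
  apply (push_peripheral (model p) (circle t) (circle t0) (band_flow r0) (gap p) (depth r0) em).
  - destruct Hstrap as (_ & _ & (u0 & O0) & (u1 & O1)). exists 0, l. split; [assumption|].
    split; [exists u0; apply O0 | exists u1; apply O1].
  - intros u Hu. apply circle_dom_gap; [lra | assumption].
  - apply gap_cover.
  - intros z s (Hz & G1 & G2 & G3) Hs.
    destruct (band_flow_spec r0 s z Hr Hz) as (I & X1 & X2 & X3).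
    pose proof (stretch_pos (depth r0 z) s) as m0.
    set (z' := band_flow r0 s z) in *.
    rewrite FE in G2 by assumption.
    assert (G3' : 0 <= Im z * (k1 * width r0 z + k2 * depth r0 z)) by (rewrite <- FN; lra).
    assert (G2' : 0 <= 2 * k * width r0 z + c * (Re z / Im z)) by nra.
    assert (G3'' : 0 <= k1 * width r0 z + k2 * depth r0 z) by nra.
    split; [assumption|]. split; [|split].
    + assert (Re z / Im z <= 0).
      { apply (Rmult_le_reg_r (Im z)); [assumption|]. unfold Rdiv. rewrite Rmult_assoc, Rinv_l; lra. }
      replace (Re z') with (Re z' / Im z' * Im z') by (field; lra). rewrite X1.
      assert (stretch (depth r0 z) s * (Re z / Im z) <= 0) by nra. nra.
    + rewrite FE, X1, X2 by assumption. apply Rmult_le_pos; [lra|].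
      replace (2 * k * (stretch (depth r0 z) s * width r0 z) + c * (stretch (depth r0 z) s * (Re z / Im z)))
        with (stretch (depth r0 z) s * (2 * k * width r0 z + c * (Re z / Im z))) by ring.
      apply Rmult_le_pos; lra.
    + assert (0 <= Im z' * (k1 * width r0 z' + k2 * depth r0 z')); [|rewrite <- FN in H; lra].
      rewrite X2, X3. apply Rmult_le_pos; [lra|]. apply Stable; assumption.
  - intros z (Hz & _). apply band_flow_id; assumption.
  - intros z s (Hz & _) _. apply band_flow_continuous; assumption.
  - intros z s G Hs Hb0. apply (gap_boundary p z G) in Hb0. destruct G as (Hz & _).
    destruct (band_flow_spec r0 s z Hr Hz) as (I & X1 & X2 & X3).
    set (z' := band_flow r0 s z) in *. destruct Hb0 as [E|E].
    + apply boundary_left; [assumption|].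
      replace (Re z') with (Re z' / Im z' * Im z') by (field; lra). rewrite X1, E. unfold Rdiv. ring.
    + apply boundary_right; [assumption|]. rewrite FE in E by assumption.
      assert (2 * k * width r0 z + c * (Re z / Im z) = 0) by nra.
      rewrite FE, X1, X2 by assumption.
      replace (2 * k * (stretch (depth r0 z) s * width r0 z) + c * (stretch (depth r0 z) s * (Re z / Im z)))
        with (stretch (depth r0 z) s * (2 * k * width r0 z + c * (Re z / Im z))) by ring.
      rewrite H. ring.
  - apply circle_dom_0. lra.
  - apply circle_boundary_0.
  - intros T. apply circle_boundary_max. lra.
  - intros z s (Hz & _) Hs. apply band_flow_spec; assumption.
  - apply Hem.
  - intros r.
    destruct (model_far_by_depth p (depth r0) 0) with (r := r) as [E HE].
    + intros j J0 J1 u.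
      pose proof (geod_im (sl2_zpow (monodromy p) j) u) as I.
      pose proof (other_arches_inside p j _ J0 J1 I ltac:(rewrite geod_side; lra)) as Q.
      unfold depth. set (w := geod (sl2_zpow (monodromy p) j) u) in *.
      assert (nsq w <= r0 ^ 2).
      { assert (0 < k1 * r0) by nra. unfold k1 in H.
        replace ((ga p ^ 2 * r0 - al p ^ 2 / r0) * r0) with (ga p ^ 2 * r0 ^ 2 - al p ^ 2) in H by (field; lra).
        apply (Rmult_le_reg_l (ga p ^ 2)); [nra|]. lra. }
      assert (0 < / (2 * r0 * Im w)) by (apply Rinv_0_lt_compat; nra). unfold Rdiv. nra.
    + apply depth_separates, Hr.
    + exists (Rmax 0 E). intros z (Hz & _) He. split.
      * apply HE; [assumption|]. apply Rle_lt_trans with (2 := He). apply Rmax_r.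
      * apply right_of_side. split; [assumption|]. rewrite circle_side. fold r0.
        assert (D : 0 < depth r0 z) by (apply Rle_lt_trans with (2 := He); apply Rmax_l).
        change (Re z ^ 2 + Im z ^ 2) with (nsq z). apply Rdiv_lt_0_compat; [|lra].
        replace (nsq z - r0 ^ 2) with (depth r0 z * (2 * r0 * Im z)) by (unfold depth; field; lra).
        apply Rmult_lt_0_compat; [assumption | nra].
  - intros E. set (M := em ^ 2 + E ^ 2).
    exists (2 * (r0 + / r0) * (sqrt (c ^ 2 * (1 + M)))).
    intros z (Hz & G1 & G2 & _) He.
    rewrite FE in G2 by assumption.
    pose proof (width_depth r0 z Hr Hz) as W. pose proof (width_pos r0 z Hr Hz) as f0.
    assert (R1 : (1 + nsq z) / Im z = r0 * (width r0 z + depth r0 z) + / r0 * (width r0 z - depth r0 z)).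
    { unfold width, depth. field. lra. }
    assert (X0 : Re z / Im z <= 0).
    { apply (Rmult_le_reg_r (Im z)); [assumption|]. unfold Rdiv. rewrite Rmult_assoc, Rinv_l; lra. }
    assert (G2' : 0 <= 2 * k * width r0 z + c * (Re z / Im z)) by nra.
    set (f := width r0 z) in *. set (e := depth r0 z) in *. set (x := Re z / Im z) in *.
    assert (c0 : 0 < c) by (unfold c; nra).
    assert (Q1 : (c * x) ^ 2 <= (2 * k * f) ^ 2).
    { assert (0 < k * f) by nra. assert (c * x <= 0) by nra. nra. }
    assert (Q2 : e ^ 2 <= M).
    { unfold M. pose proof (pow2_ge_0 em). pose proof (pow2_ge_0 E).
      destruct (Rle_or_lt 0 e); nra. }
    assert (Q3 : f ^ 2 <= c ^ 2 * (1 + M)).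
    { assert (c ^ 2 * f ^ 2 - 4 * k ^ 2 * f ^ 2 <= c ^ 2 * (1 + e ^ 2)).
      { rewrite W at 1. ring_simplify. ring_simplify in Q1. nra. }
      rewrite kc in H at 1. assert (c ^ 2 * (1 + e ^ 2) <= c ^ 2 * (1 + M)) by (apply Rmult_le_compat_l; nra). lra. }
    assert (Q4 : f <= sqrt (c ^ 2 * (1 + M))).
    { rewrite <- (sqrt_pow2 f) by lra. apply sqrt_le_1_alt, Q3. }
    assert (Q5 : - f <= e <= f) by (clearbody f e x; split; nra).
    assert (i0 : 0 < / r0) by (apply Rinv_0_lt_compat; assumption).
    rewrite R1. nra.
Qed.

(** ** Pushing into a tine *)

Lemma im_separates S a : exists E, forall z w : C,
  0 < Im z -> 0 < Im w -> E < Im z -> Im w <= a -> S < chord z w.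
Proof.
  exists ((Rabs S + 2) * Rabs a). intros z w Hz Hw HE Ha. unfold chord.
  assert (a0 : 0 < a) by lra. rewrite (Rabs_pos_eq a) in HE by lra.
  assert ((Rabs S + 2) * Im w < Im z).
  { apply Rle_lt_trans with (2 := HE). apply Rmult_le_compat_l; [pose proof (Rabs_pos S); lra | assumption]. }
  apply Rlt_le_trans with (((Im z - Im w) ^ 2) / (Im z * Im w)).
  - apply Rle_lt_trans with (1 := Rle_abs S).
    apply (Rmult_lt_reg_r (Im z * Im w)); [nra|].
    replace ((Im z - Im w) ^ 2 / (Im z * Im w) * (Im z * Im w)) with ((Im z - Im w) ^ 2) by (field; lra).
    assert ((Rabs S + 2) * Im w * Im z < Im z * Im z) by (apply Rmult_lt_compat_r; assumption). nra.
  - apply Rmult_le_compat_r; [left; apply Rinv_0_lt_compat; nra|].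
    pose proof (pow2_ge_0 (Re z - Re w)). lra.
Qed.

(** A tine swallows the orthojectories towards the next arch; with vertical
    arches, it is approached by upward translations. *)
Lemma tine_peripheral p t : de p = 0 -> al p < ga p * exp t ->
  is_peripheral (model p) (circle t).
Proof.
  intros De Ht.
  pose proof (al_pos p) as Ha. pose proof (be_pos p) as Hb. pose proof (ga_pos p) as Hg.
  pose proof (shape_det p) as Dt. rewrite De, Rmult_0_r, Rminus_0_r in Dt.
  set (b := al p * be p). assert (b0 : 0 < b) by (unfold b; nra).
  assert (bg : al p = b * ga p) by (unfold b; rewrite Rmult_assoc, Dt; ring).
  assert (FE : forall z, right_edge p z = Re z + b).
  { intros z. unfold right_edge. rewrite De, Dt. fold b. ring. }
  destruct (circle_compact p (exp t) Ht ltac:(rewrite De; lra)) as (m & Hm & Km).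
  set (t0 := ln (5 * b / 3)). assert (Et0 : exp t0 = 5 * b / 3) by (apply exp_ln; lra).
  assert (Im' : forall z s, Im ((Re z, Im z + s) : C) = Im z + s) by reflexivity.
  apply (push_peripheral (model p) (circle t) (circle t0) (fun s z => (Re z, Im z + s)) (gap p) Im m).
  - (* the crossing with the next arch is a 3-4-5 triangle *)
    exists 0, (ln 2). split; [rewrite <- ln_1; apply ln_increasing; lra|]. split.
    + exists t0. apply eq_sym, circle_orthogonal.
    + assert (Q : side (sl2_zpow (monodromy p) 1) (geod (circle t0) (ln 2)) = 0).
      { rewrite zpow_1, monodromy_side, FE, geod_circle, exp_ln, Et0 by lra. cbn [Re fst]. field. }
      destruct (side_geod _ _ (geod_im _ _) Q) as [u Hu]. exists u. rewrite model_lift. exact Hu.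
  - intros u Hu. apply circle_dom_gap; [lra | assumption].
  - apply gap_cover.
  - intros z s (Hz & G1 & G2 & G3) Hs. unfold gap. rewrite FE in *. unfold nsq in *. cbn [Re Im fst snd].
    repeat split; try lra.
    apply Rle_trans with (1 := G3). apply Rmult_le_compat_l; nra.
  - intros z _. rewrite Rplus_0_r. destruct z; reflexivity.
  - intros z s _ _.
    assert (C1 : continuous (fun q : prod_UniformSpace R_UniformSpace C_UniformSpace => fst q) (s, z))
      by apply continuous_fst.
    assert (C2 : continuous (fun q : prod_UniformSpace R_UniformSpace C_UniformSpace => snd q) (s, z))
      by apply continuous_snd.
    ct.
  - intros z s G Hs Hb0. apply (gap_boundary p z G) in Hb0. destruct G as (Hz & _).
    destruct Hb0 as [E|E].
    + apply boundary_left; cbn [Re Im fst snd]; lra.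
    + rewrite FE in E. apply boundary_right; [cbn [Im snd]; lra|]. rewrite FE. cbn [Re fst]. exact E.
  - apply circle_dom_0. lra.
  - apply circle_boundary_0.
  - intros T. apply circle_boundary_max. lra.
  - intros z s _ _. reflexivity.
  - intros u [Hu Hc]. apply Km; [apply Hc; lra | apply circle_nsq].
  - intros r. destruct (model_far_by_depth p Im b) with (r := r) as [E HE].
    + intros j J0 J1 u.
      pose proof (geod_im (sl2_zpow (monodromy p) j) u) as I.
      pose proof (other_arches_inside p j _ J0 J1 I ltac:(rewrite geod_side; lra)) as Q.
      set (w := geod (sl2_zpow (monodromy p) j) u) in *. unfold nsq in Q. rewrite bg in Q.
      assert (Im w ^ 2 < b ^ 2).
      { apply (Rmult_lt_reg_l (ga p ^ 2)); [nra|].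
        assert (0 <= ga p ^ 2 * Re w ^ 2) by (apply Rmult_le_pos; nra). lra. }
      nra.
    + intros S a. destruct (im_separates S a) as [E HE]. exists E. exact HE.
    + exists (Rmax (5 * b / 3) E). intros z (Hz & _) He. split.
      * apply HE; [assumption|]. apply Rle_lt_trans with (2 := He). apply Rmax_r.
      * apply right_of_side. split; [assumption|]. rewrite circle_side, Et0.
        assert (D : 5 * b / 3 < Im z) by (apply Rle_lt_trans with (2 := He); apply Rmax_l).
        apply Rdiv_lt_0_compat; [|lra]. pose proof (pow2_ge_0 (Re z)). nra.
  - intros E. exists ((1 + b ^ 2 + E ^ 2) / m). intros z (Hz & G1 & G2 & _) [He1 He2].
    rewrite FE in G2.
    apply Rle_trans with ((1 + nsq z) / m).
    + apply Rmult_le_compat_l; [unfold nsq; nra|]. apply Rinv_le_contravar; assumption.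
    + apply Rmult_le_compat_r; [left; apply Rinv_0_lt_compat; assumption|]. unfold nsq. nra.
Qed.

Lemma forward_peripheral p t : ln (al p / ga p) < t -> is_peripheral (model p) (circle t).
Proof.
  intros H. pose proof (al_pos p) as Ha. pose proof (ga_pos p) as Hg. pose proof (de_pos p) as Hd.
  assert (Q : al p < ga p * exp t).
  { apply exp_increasing in H. rewrite exp_ln in H by (apply Rdiv_lt_0_compat; lra).
    apply (Rmult_lt_compat_l (ga p)) in H; [|assumption].
    replace (ga p * (al p / ga p)) with (al p) in H by (field; lra). assumption. }
  destruct (Req_dec (de p) 0) as [E|E]; [apply tine_peripheral | apply flipper_peripheral]; lra.
Qed.

Lemma ln_div x y : 0 < x -> 0 < y -> ln (x / y) = ln x - ln y.
Proof. intros. unfold Rdiv. rewrite ln_mult, ln_Rinv; auto using Rinv_0_lt_compat. Qed.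

Lemma peripheral_peq X h h' : peq h h' -> is_peripheral X h -> is_peripheral X h'.
Proof.
  intros E (f & Hf & K). exists f. split; [assumption|]. intros r.
  destruct (K r) as (H & PH & HH). exists H.
  assert (G : forall t, geod h' t = geod h t) by (intros t; symmetry; apply geod_peq, E).
  assert (D : forall t, orth_dom X h' t <-> orth_dom X h t).
  { intros t. unfold orth_dom. split; intros [P Q]; (split; [assumption|]); intros u Hu; specialize (Q u Hu);
      rewrite G in *; assumption. }
  split.
  - apply (proper_homotopy_image X X h h' (fun z => z) H); auto. intros z _. apply continuous_id.
  - intros t Ht. apply HH, D, Ht.
Qed.

Lemma swap_involutive p : swap (swap p) = p.
Proof. destruct p as [a b c d h1 h2 h3 h4 h5]. unfold swap; cbn. f_equal. apply Eqdep_dec.UIP_dec, Req_EM_T. Qed.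

Lemma backward_peripheral p t : t < ln (be p / al p) -> is_peripheral (model p) (circle t).
Proof.
  intros H. pose proof (al_pos p) as Ha. pose proof (be_pos p) as Hb.
  rewrite <- (swap_involutive p), <- (Ropp_involutive t). apply mirror_peripheral, forward_peripheral.
  cbn [swap al ga]. rewrite ln_div in * by lra. lra.
Qed.

(** Orthojectories are the geodesics that turn to the left of the arch. *)
Lemma orthojectory_circle p t h : is_orthojectory (model p) t h -> peq (circle t) h.
Proof.
  intros [O (e & He & Hc)]. cbn [model arch] in O. apply orthogonal_at_dil in O.
  destruct O as (k & s & Hk & Hs & H1 & H2 & H3 & H4).
  cbn [sl2_mul sl2_one dil ma mb mc md] in H1, H2, H3, H4.
  replace (0 / 2) with 0 in * by lra. rewrite Ropp_0, exp_0 in *.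
  set (E := exp (t / 2)) in *. set (F := exp (- (t / 2))) in *.
  assert (EF : E * F = 1) by apply exp_mul_opp.
  assert (E0 : 0 < E) by apply exp_pos. assert (F0 : 0 < F) by apply exp_pos.
  assert (Ss : s = 1 \/ s = -1).
  { assert (Z : (s - 1) * (s + 1) = 0) by lra. apply Rmult_integral in Z. destruct Z; [left|right]; lra. }
  destruct Ss as [-> | ->].
  - exists (k * sqrt 2).
    assert (S2 : sqrt 2 * sqrt 2 = 2) by (apply sqrt_sqrt; lra).
    assert (S0 : sqrt 2 <> 0) by (intros Z; rewrite Z in S2; lra).
    split; [replace ((k * sqrt 2) ^ 2) with (k ^ 2 * (sqrt 2 * sqrt 2)) by ring; rewrite S2; lra|].
    assert (Q : k * sqrt 2 * k = / sqrt 2).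
    { apply (Rmult_eq_reg_r (sqrt 2)); [|assumption]. rewrite Rinv_l by assumption.
      transitivity (k ^ 2 * (sqrt 2 * sqrt 2)); [ring|]. rewrite S2. lra. }
    cbn [circle sl2_mul dil ma mb mc md]. fold E F.
    replace (ma h) with (k * E) by lra. replace (mb h) with (k * E) by lra.
    replace (mc h) with (- (k * F)) by lra. replace (md h) with (k * F) by lra.
    rewrite <- Q. repeat split; ring.
  - exfalso. apply cover_edges in Hc. destruct Hc as (_ & Hr & _).
    rewrite geod_coord in Hr. pose proof (geod_den h e) as N. cbn [Re fst] in Hr.
    assert (K : ma h * mc h * exp e ^ 2 + mb h * md h = k ^ 2 * (exp e ^ 2 - 1)).
    { replace (ma h) with (k * E) by lra. replace (mb h) with (- (k * E)) by lra.
      replace (mc h) with (k * F) by lra. replace (md h) with (k * F) by lra.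
      transitivity (k ^ 2 * (E * F) * (exp e ^ 2 - 1)); [ring|]. rewrite EF. ring. }
    rewrite K in Hr.
    assert (1 < exp e) by (rewrite <- exp_0; apply exp_increasing; assumption).
    assert (0 < k ^ 2 * (exp e ^ 2 - 1)) by (apply Rmult_lt_0_compat; nra).
    pose proof (Rdiv_lt_0_compat _ _ H0 N). lra.
Qed.

(** * Essential orthojectories *)

(** A half-circle around the start of the arch that separates the next boundary
    puncture from the essential orthojectories, and meets the cover in a
    bounded set. *)
Lemma forward_barrier p : exists u B, al p < ga p * u /\
  forall z, cover (model p) z -> nsq z = u ^ 2 -> chord z (0, 1) <= B.
Proof.
  pose proof (al_pos p) as Ha. pose proof (be_pos p) as Hb. pose proof (ga_pos p) as Hg.
  pose proof (de_pos p) as Hd. pose proof (shape_det p) as Dt.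
  set (c := al p * de p + be p * ga p). assert (c0 : 0 < c) by (unfold c; nra).
  assert (ad : 0 <= al p * de p) by nra.
  set (u := 2 * (al p * be p) / c).
  assert (cu : c * u = 2 * (al p * be p)) by (unfold u; field; lra).
  assert (H1 : al p < ga p * u).
  { apply (Rmult_lt_reg_l c); [assumption|].
    replace (c * (ga p * u)) with (al p * (2 * (be p * ga p))) by (transitivity (ga p * (c * u)); [rewrite cu|]; ring).
    replace (c * al p) with (al p * c) by ring. apply Rmult_lt_compat_l; unfold c; lra. }
  assert (H2 : de p * u < be p).
  { apply (Rmult_lt_reg_l c); [assumption|].
    replace (c * (de p * u)) with (be p * (2 * (al p * de p))) by (transitivity (de p * (c * u)); [rewrite cu|]; ring).
    replace (c * be p) with (be p * c) by ring. apply Rmult_lt_compat_l; unfold c; lra. }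
  destruct (circle_compact p u H1 H2) as (m & Hm & Km).
  exists u, ((1 + u ^ 2) / m). split; [assumption|]. intros z Hz E.
  specialize (Km z Hz E). unfold chord; cbn [Re Im fst snd]. rewrite Rmult_1_r.
  apply Rle_trans with ((1 + u ^ 2) / Im z).
  - apply Rmult_le_compat_r; [left; apply Rinv_0_lt_compat; lra|]. rewrite <- E. unfold nsq. lra.
  - apply Rmult_le_compat_l; [nra|]. apply Rinv_le_contravar; assumption.
Qed.

Lemma backward_barrier p : exists u B, 0 < u /\ al p * u < be p /\
  forall z, cover (model p) z -> nsq z = u ^ 2 -> chord z (0, 1) <= B.
Proof.
  destruct (forward_barrier (swap p)) as (v & B & Hv & K). cbn [swap al ga] in Hv.
  pose proof (al_pos p) as Ha. pose proof (be_pos p) as Hb.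
  assert (v0 : 0 < v) by nra.
  exists (/ v), B. split; [apply Rinv_0_lt_compat; assumption|]. split.
  - apply (Rmult_lt_reg_r v); [assumption|]. rewrite Rmult_assoc, Rinv_l; lra.
  - intros z Hz E. assert (I := cover_im _ _ Hz).
    replace (0, 1) with (mirror (0, 1)).
    2:{ unfold mirror, nsq; cbn [Re Im fst snd]. f_equal; field. }
    rewrite <- (mirror_mirror z) by assumption. rewrite mirror_chord; [| apply mirror_im, I | cbn; lra].
    apply K; [apply mirror_cover; assumption|]. rewrite mirror_nsq, E by assumption. field. lra.
Qed.

Lemma previous_arch_inside p z : 0 < Im z -> 0 <= side (sl2_zpow (monodromy p) (-1)) z ->
  al p ^ 2 * nsq z <= be p ^ 2.
Proof.
  intros Hz H. pose proof (flip_side (sl2_zpow (monodromy p) (-1)) z Hz) as F.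
  rewrite flip_monodromy in F. change (- -1)%Z with 1%Z in F. rewrite zpow_1, monodromy_side in F.
  pose proof (nsq_pos z Hz) as N.
  pose proof (next_arch_outside (swap p) (mirror z) (mirror_im z Hz) ltac:(nra)) as Q.
  rewrite mirror_nsq in Q by assumption. cbn [swap al ga] in Q.
  apply (Rmult_le_compat_r (nsq z)) in Q; [|lra]. rewrite (Rmult_assoc (be p ^ 2)), Rinv_l in Q; lra.
Qed.

Lemma other_arches_outside p k z : k <> 0%Z -> k <> (-1)%Z -> 0 < Im z ->
  0 <= side (sl2_zpow (monodromy p) k) z -> be p ^ 2 < al p ^ 2 * nsq z.
Proof.
  intros K0 K1 Hz H. pose proof (flip_side (sl2_zpow (monodromy p) k) z Hz) as F.
  rewrite flip_monodromy in F. pose proof (nsq_pos z Hz) as N.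
  pose proof (other_arches_inside (swap p) (- k) (mirror z) ltac:(lia) ltac:(lia) (mirror_im z Hz) ltac:(nra)) as Q.
  rewrite mirror_nsq in Q by assumption. cbn [swap al ga] in Q.
  apply (Rmult_lt_compat_r (nsq z)) in Q; [|assumption]. rewrite (Rmult_assoc (be p ^ 2)), Rinv_l in Q; lra.
Qed.

(** The arch is separated from all others by the zeros of a continuous
    function. *)
Lemma boundary_path_0 p (w : R -> C) :
  (forall s, 0 <= s <= 1 -> filterlim w (within (fun u => 0 <= u <= 1) (locally s)) (locally (w s))) ->
  (forall s, 0 <= s <= 1 -> cover_boundary (model p) (w s)) ->
  Re (w 0) = 0 -> Re (w 1) = 0.
Proof.
  intros Hw Hb H0.
  pose proof (al_pos p) as Ha. pose proof (be_pos p) as Hbe. pose proof (ga_pos p) as Hg.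
  pose proof (de_pos p) as Hd. pose proof (shape_det p) as Dt.
  set (c := al p * de p + be p * ga p). assert (c0 : 0 < c) by (unfold c; nra).
  set (a := al p * be p / c). assert (a0 : 0 < a) by (unfold a; apply Rdiv_lt_0_compat; nra).
  set (b := ga p / al p). assert (b0 : 0 < b) by (apply Rdiv_lt_0_compat; lra).
  (* the other arches lie to the left of [- a] or of [- b nsq z] *)
  set (g := fun z : C => Re z + a * (b * nsq z) / (2 * (a + b * nsq z))).
  assert (Gap : forall z, cover_boundary (model p) z -> Re z = 0 \/ Re z <= - a \/ Re z < - (b * nsq z)).
  { intros z Bz. apply model_boundary in Bz. destruct Bz as (Hz & k & Hk).
    destruct (Z.eq_dec k 0) as [->|K0].
    - left. change (sl2_zpow (monodromy p) 0) with sl2_one in Hk. rewrite side_one in Hk. assumption.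
    - right. destruct (Z.eq_dec k 1) as [->|K1].
      + left. rewrite zpow_1, monodromy_side in Hk. unfold right_edge in Hk. fold c in Hk.
        assert (ca : c * a = al p * be p) by (unfold a; field; lra).
        pose proof (nsq_pos z Hz). assert (0 <= ga p * de p * nsq z) by (apply Rmult_le_pos; nra).
        apply (Rmult_le_reg_l c); [assumption|]. lra.
      + right. pose proof (other_arches_below p k z K0 K1 Hz ltac:(lra)) as Q.
        apply (Rmult_lt_reg_l (al p)); [lra|].
        replace (al p * - (b * nsq z)) with (- (ga p * nsq z)) by (unfold b; field; lra). lra. }
  assert (Pos : forall z, 0 < Im z -> 0 < a * (b * nsq z) / (2 * (a + b * nsq z)) /\
     a * (b * nsq z) / (2 * (a + b * nsq z)) < a /\ a * (b * nsq z) / (2 * (a + b * nsq z)) < b * nsq z).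
  { intros z Hz. pose proof (nsq_pos z Hz) as N. set (n := b * nsq z).
    assert (n0 : 0 < n) by (unfold n; nra).
    split; [apply Rdiv_lt_0_compat; nra|]. split.
    - apply (Rmult_lt_reg_r (2 * (a + n))); [lra|].
      replace (a * n / (2 * (a + n)) * (2 * (a + n))) with (a * n) by (field; lra). nra.
    - apply (Rmult_lt_reg_r (2 * (a + n))); [lra|].
      replace (a * n / (2 * (a + n)) * (2 * (a + n))) with (a * n) by (field; lra). nra. }
  assert (Bim : forall z, cover_boundary (model p) z -> 0 < Im z).
  { intros z Bz. apply model_boundary in Bz. apply Bz. }
  assert (G1 : 0 < g (w 1)).
  { apply (continuous_on_sign (fun s => g (w s)) 0 1); [lra | | |].
    - intros s Hs. apply (filterlim_comp _ _ _ w g _ _ _ (Hw s Hs)).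
      change (continuous g (w s)). pose proof (Pos _ (Bim _ (Hb s Hs))) as P.
      pose proof (nsq_pos _ (Bim _ (Hb s Hs))) as N.
      assert (Ci : continuous (fun u : C => u) (w s)) by apply continuous_id.
      assert (0 < b * nsq (w s)) by nra.
      unfold g, nsq in *. ct; cbv beta; lra.
    - intros s Hs. pose proof (Pos _ (Bim _ (Hb s Hs))) as P.
      destruct (Gap _ (Hb s Hs)) as [E|[E|E]]; unfold g; lra.
    - pose proof (Pos _ (Bim _ (Hb 0 ltac:(lra)))) as P. unfold g. lra. }
  pose proof (Pos _ (Bim _ (Hb 1 ltac:(lra)))) as P.
  destruct (Gap _ (Hb 1 ltac:(lra))) as [E|[E|E]]; unfold g in G1; lra.
Qed.

Lemma boundary_translate p k z : cover_boundary (model p) z ->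
  cover_boundary (model p) (mob (sl2_zpow (monodromy p) k) z).
Proof.
  intros (j & t & ->). exists (k + j)%Z, t. rewrite !model_lift, zpow_add. symmetry. apply geod_mul.
Qed.

Lemma boundary_path p k (w : R -> C) :
  (forall s, 0 <= s <= 1 -> filterlim w (within (fun u => 0 <= u <= 1) (locally s)) (locally (w s))) ->
  (forall s, 0 <= s <= 1 -> cover_boundary (model p) (w s)) ->
  side (sl2_zpow (monodromy p) k) (w 0) = 0 -> side (sl2_zpow (monodromy p) k) (w 1) = 0.
Proof.
  intros Hw Hb H0.
  assert (Bim : forall z, cover_boundary (model p) z -> 0 < Im z).
  { intros z Bz. apply model_boundary in Bz. apply Bz. }
  set (G := sl2_zpow (monodromy p) (- k)).
  assert (GK : sl2_mul G (sl2_zpow (monodromy p) k) = sl2_one).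
  { unfold G. rewrite <- zpow_add. replace (- k + k)%Z with 0%Z by lia. reflexivity. }
  assert (S : forall z, 0 < Im z -> Re (mob G z) * nrm G z = side (sl2_zpow (monodromy p) k) z).
  { intros z Hz. rewrite <- (side_mob G _ z Hz), GK, side_one. reflexivity. }
  assert (R1 : Re (mob G (w 1)) = 0).
  { apply (boundary_path_0 p (fun s => mob G (w s))).
    - intros s Hs. apply (filterlim_comp _ _ _ w (mob G) _ _ _ (Hw s Hs)).
      apply continuous_mob, Bim, Hb, Hs.
    - intros s Hs. apply boundary_translate, Hb, Hs.
    - pose proof (Bim _ (Hb 0 ltac:(lra))) as I. pose proof (S _ I) as E. rewrite H0 in E.
      pose proof (nrm_pos G _ I). nra. }
  rewrite <- S by (apply Bim, Hb; lra). rewrite R1. ring.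
Qed.

(** The domain of an orthojectory is a closed interval. *)
Lemma orth_dom_dichotomy p h : orth_dom (model p) h 0 ->
  (exists T, orth_dom (model p) h T /\ forall t, orth_dom (model p) h t -> t <= T) \/
  (forall M, exists T, M < T /\ orth_dom (model p) h T).
Proof.
  intros D0. destruct (classic (exists M, forall t, orth_dom (model p) h t -> t <= M)) as [[M HM]|N].
  - left. destruct (completeness (orth_dom (model p) h)) as [T [T1 T2]].
    + exists M. exact HM.
    + exists 0. exact D0.
    + exists T. split; [|exact T1]. split; [apply T1, D0|]. intros u Hu.
      assert (Below : forall v, 0 <= v < T -> cover (model p) (geod h v)).
      { intros v Hv. destruct (classic (exists t, v < t /\ orth_dom (model p) h t)) as [(t & Lt & Dt)|Nt].
        - apply Dt. lra.
        - exfalso. assert (T <= v); [|lra]. apply T2. intros t Dt.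
          destruct (Rle_or_lt t v) as [L|L]; [assumption|]. exfalso. apply Nt. exists t. split; assumption. }
      destruct (Rlt_or_le u T) as [L|L]; [apply Below; lra|].
      destruct (Req_dec u 0) as [U0|U0]; [rewrite U0; apply D0; lra|].
      apply model_cover. split; [apply geod_im|]. intros k.
      destruct (Rle_or_lt (side (sl2_zpow (monodromy p) k) (geod h u)) 0) as [S|S]; [assumption|exfalso].
      assert (C : continuous (fun v => side (sl2_zpow (monodromy p) k) (geod h v)) u).
      { assert (C0 := continuous_geod h u). unfold side. ct. }
      destruct (continuous_pos_locally _ _ C S) as [eps Heps].
      set (v := Rmax (u / 2) (u - eps / 2)). pose proof (cond_pos eps) as Pe.
      assert (V1 : v < u) by (unfold v; apply Rmax_lub_lt; lra).
      assert (V2 : u / 2 <= v) by apply Rmax_l. assert (V3 : u - eps / 2 <= v) by apply Rmax_r.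
      specialize (Heps v). assert (Sv : 0 < side (sl2_zpow (monodromy p) k) (geod h v)).
      { apply Heps. unfold ball; cbn. unfold AbsRing_ball, abs, minus, plus, opp; cbn.
        apply Rabs_def1; lra. }
      assert (Cv := Below v ltac:(lra)). apply model_cover in Cv. destruct Cv as [_ Cv].
      specialize (Cv k). lra.
  - right. intros M. apply NNPP. intros Q. apply N. exists M. intros t Dt.
    destruct (Rle_or_lt t M) as [L|L]; [assumption|]. exfalso. apply Q. exists t. split; assumption.
Qed.

Lemma circle_starts p t : exists e, 0 < e /\ orth_dom (model p) (circle t) e.
Proof.
  pose proof (al_pos p) as Ha. pose proof (be_pos p) as Hbe. pose proof (ga_pos p) as Hg.
  pose proof (de_pos p) as Hd. pose proof (exp_pos t) as Et.
  assert (Cz := continuous_geod (circle t) 0).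
  assert (E0 : geod (circle t) 0 = (0, exp t)).
  { rewrite geod_circle, exp_0. f_equal; field. }
  assert (C1 : continuous (fun u => right_edge p (geod (circle t) u)) 0).
  { unfold right_edge, nsq. ct. }
  assert (C2 : continuous (fun u => ga p * nsq (geod (circle t) u) + al p * Re (geod (circle t) u)) 0).
  { unfold nsq. ct. }
  assert (P1 : 0 < right_edge p (geod (circle t) 0)).
  { rewrite E0. unfold right_edge, nsq; cbn [Re Im fst snd].
    assert (0 <= ga p * de p * (0 ^ 2 + exp t ^ 2)) by (apply Rmult_le_pos; nra).
    assert (0 < al p * be p) by (apply Rmult_lt_0_compat; lra). lra. }
  assert (P2 : 0 < ga p * nsq (geod (circle t) 0) + al p * Re (geod (circle t) 0)).
  { rewrite E0. unfold nsq; cbn [Re Im fst snd].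
    assert (0 < ga p * exp t ^ 2) by (apply Rmult_lt_0_compat; [|apply pow_lt]; assumption). lra. }
  destruct (filter_and _ _ (continuous_pos_locally _ _ C1 P1) (continuous_pos_locally _ _ C2 P2)) as [eps Heps].
  pose proof (cond_pos eps) as Pe. exists (eps / 2). split; [lra|]. split; [lra|]. intros u Hu.
  destruct (Heps u) as [Q1 Q2].
  - unfold ball; cbn. unfold AbsRing_ball, abs, minus, plus, opp; cbn. rewrite Rabs_pos_eq; lra.
  - apply cover_by_edges; [apply geod_im | | lra | lra].
    rewrite geod_circle; cbn [Re fst].
    assert (1 <= exp u) by (rewrite <- exp_0; destruct (proj1 Hu) as [L|<-]; [left; apply exp_increasing; assumption | lra]).
    pose proof (pow2_ge_0 (exp u)).
    replace (exp t * (1 - exp u ^ 2) / (1 + exp u ^ 2)) with (- (exp t * (exp u ^ 2 - 1) / (1 + exp u ^ 2)))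
      by (field; lra).
    assert (0 <= exp t * (exp u ^ 2 - 1) / (1 + exp u ^ 2)); [|lra].
    apply Rdiv_le_0_compat; [apply Rmult_le_pos; [lra|]; nra | lra].
Qed.

(** An orthojectory that meets neither neighbouring arch nor ends in a
    neighbouring flipper is essential: a homotopy into a boundary puncture
    would have to cross one of the two barriers. *)
Lemma between_not_peripheral p t : be p < al p * exp t -> ga p * exp t < al p ->
  ~ is_peripheral (model p) (circle t).
Proof.
  intros H1 H2 (f & _ & K).
  pose proof (al_pos p) as Ha. pose proof (be_pos p) as Hbe. pose proof (ga_pos p) as Hg.
  pose proof (exp_pos t) as Et.
  destruct (forward_barrier p) as (u & B & Hu & HB). destruct (backward_barrier p) as (v & B' & v0 & Hv & HB').
  assert (tu : exp t < u) by nra. assert (vt : v < exp t) by nra.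
  set (M := Rmax (Rmax B B') ((u + 1) ^ 2 / v)).
  set (r := 2 * arcsinh (sqrt M / 2)).
  assert (Far : forall z, 0 < Im z -> far (model p) r z -> M < chord z (0, 1)).
  { intros z Hz F. destruct (Rle_or_lt (chord z (0, 1)) M) as [L|L]; [exfalso|assumption].
    specialize (F 0%Z). rewrite model_lift in F. change (sl2_zpow (monodromy p) 0) with sl2_one in F.
    replace (geod sl2_one 0) with ((0, 1) : C) in F.
    2:{ unfold geod. rewrite mob_one, exp_0. reflexivity. }
    pose proof (hdist_le M z (0, 1) Hz ltac:(cbn; lra) L). unfold r in F. lra. }
  assert (MB : B <= M) by (unfold M; apply Rle_trans with (Rmax B B'); apply Rmax_l).
  assert (MB' : B' <= M) by (unfold M; apply Rle_trans with (Rmax B B'); [apply Rmax_r | apply Rmax_l]).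
  assert (MB'' : (u + 1) ^ 2 / v <= M) by apply Rmax_r.
  (* positive between the two barriers, zero on them *)
  set (phi := fun z : C => (u ^ 2 - nsq z) * (nsq z - v ^ 2)).
  assert (Cphi : forall z, continuous phi z).
  { intros z. unfold phi, nsq. assert (Ci : continuous (fun u : C => u) z) by apply continuous_id. ct. }
  assert (Avoid : forall z, cover (model p) z -> far (model p) r z -> phi z <> 0).
  { intros z Cz F E. apply Rmult_integral in E. pose proof (Far z (cover_im _ _ Cz) F).
    destruct E as [E|E]; [specialize (HB z Cz ltac:(lra)) | specialize (HB' z Cz ltac:(lra))]; lra. }
  assert (Between : forall z, 0 < Im z -> 0 < phi z -> v ^ 2 < nsq z < u ^ 2).
  { intros z Hz P. unfold phi in P. assert (v ^ 2 < u ^ 2) by nra. nra. }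
  assert (Phi0 : forall T, 0 < phi (geod (circle t) T)).
  { intros T. unfold phi. rewrite circle_nsq. apply Rmult_lt_0_compat; nra. }
  destruct (K r) as (H & [P1 P2 P3 P4 P5 P6] & HH).
  destruct (circle_starts p t) as (e & He & De).
  assert (D0 : orth_dom (model p) (circle t) 0).
  { destruct De as [_ De]. split; [lra|]. intros w Hw. apply De. lra. }
  assert (Sub : forall T w, orth_dom (model p) (circle t) T -> 0 <= w <= T -> orth_dom (model p) (circle t) w).
  { intros T w [_ DT] Hw. split; [lra|]. intros x Hx. apply DT. lra. }
  (* continuity of the homotopy along horizontal and vertical segments *)
  assert (Hor : forall T, orth_dom (model p) (circle t) T -> forall s, 0 <= s <= 1 ->
    filterlim (fun s => H s T) (within (fun x => 0 <= x <= 1) (locally s)) (locally (H s T))).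
  { intros T DT s Hs Q HQ. specialize (P1 (s, T) (conj Hs DT) Q HQ). unfold filtermap, within in *.
    destruct P1 as [eps Heps]. exists eps. intros x Hx Hx1. apply (Heps (x, T)).
    - split; [exact Hx | apply ball_center].
    - split; assumption. }
  assert (Ver : forall T, orth_dom (model p) (circle t) T -> forall w, 0 <= w <= T ->
    filterlim (fun w => H 1 (T - w)) (within (fun x => 0 <= x <= T) (locally w)) (locally (H 1 (T - w)))).
  { intros T DT w Hw Q HQ.
    assert (Dw : orth_dom (model p) (circle t) (T - w)) by (apply (Sub T); [assumption | lra]).
    assert (D1 : 0 <= fst (1, T - w) <= 1) by (cbn [fst]; lra).
    specialize (P1 (1, T - w) (conj D1 Dw) Q HQ). unfold filtermap, within in *.
    destruct P1 as [eps Heps]. exists eps. intros x Hx Hx1. apply (Heps (1, T - x)).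
    - split; [apply ball_center|]. cbn [snd]. unfold ball in *; cbn in *.
      unfold AbsRing_ball, abs, minus, plus, opp in *; cbn in *.
      replace (T - x + - (T - w)) with (- (x + - w)) by ring. rewrite Rabs_Ropp. exact Hx.
    - cbn [fst snd]. split; [lra|]. apply (Sub T); [assumption | lra]. }
  assert (End : exists T, orth_dom (model p) (circle t) T /\ 0 < phi (H 1 T)).
  { destruct (orth_dom_dichotomy p (circle t) D0) as [(T & DT & Tmax)|Unb].
    - exists T. split; [assumption|].
      assert (T0 : 0 < T) by (apply Rlt_le_trans with e; [assumption | apply Tmax, De]).
      assert (Q := P5 T DT Tmax 0 ltac:(lra)). rewrite P3 in Q by assumption.
      apply model_boundary in Q. destruct Q as (Iz & k & Hk).
      assert (K0 : k <> 0%Z).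
      { intros ->. change (sl2_zpow (monodromy p) 0) with sl2_one in Hk. rewrite side_one, geod_circle in Hk.
        cbn [Re fst] in Hk. assert (1 < exp T) by (rewrite <- exp_0; apply exp_increasing; assumption).
        assert (X : 0 < exp t * (exp T ^ 2 - 1) / (1 + exp T ^ 2)).
        { pose proof (pow2_ge_0 (exp T)).
          apply Rdiv_lt_0_compat; [apply Rmult_lt_0_compat; [assumption | nra] | lra]. }
        replace (exp t * (1 - exp T ^ 2) / (1 + exp T ^ 2)) with (- (exp t * (exp T ^ 2 - 1) / (1 + exp T ^ 2))) in Hk
          by (field; pose proof (pow2_ge_0 (exp T)); lra). lra. }
      assert (K1 : k <> 1%Z).
      { intros ->. rewrite zpow_1, monodromy_side in Hk.
        pose proof (next_arch_outside p _ Iz ltac:(lra)) as Q. rewrite circle_nsq in Q.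
        assert (0 < ga p * exp t) by nra. nra. }
      assert (K2 : k <> (-1)%Z).
      { intros ->. pose proof (previous_arch_inside p _ Iz ltac:(lra)) as Q. rewrite circle_nsq in Q. nra. }
      assert (E1 : side (sl2_zpow (monodromy p) k) (H 1 T) = 0).
      { apply (boundary_path p k (fun s => H s T)); [apply Hor, DT | |].
        - intros s Hs. apply (P5 T DT Tmax s Hs).
        - rewrite P3 by assumption. assumption. }
      assert (I1 : 0 < Im (H 1 T)) by (apply (cover_im (model p)), P2; [lra | assumption]).
      pose proof (other_arches_inside p k _ K0 K1 I1 ltac:(lra)) as Q1.
      pose proof (other_arches_outside p k _ K0 K2 I1 ltac:(lra)) as Q2.
      unfold phi. apply Rmult_lt_0_compat.
      + assert (nsq (H 1 T) < u ^ 2); [|lra]. apply (Rmult_lt_reg_l (ga p ^ 2)); [nra|].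
        rewrite <- (Rpow_mult_distr (ga p)).
        apply Rlt_trans with (1 := Q1). clear - Hu Ha. nra.
      + assert (v ^ 2 < nsq (H 1 T)); [|lra]. apply (Rmult_lt_reg_l (al p ^ 2)); [nra|].
        rewrite <- (Rpow_mult_distr (al p)).
        apply Rlt_trans with (2 := Q2). assert (0 < al p * v) by nra. clear - H0 Hv. nra.
    - destruct (P6 r) as [M0 HM0]. destruct (Unb M0) as (T & LT & DT). exists T. split; [assumption|].
      apply (continuous_on_sign (fun s => phi (H s T)) 0 1); [lra | | |].
      + intros s Hs. apply (filterlim_comp _ _ _ (fun s => H s T) phi _ _ _ (Hor T DT s Hs)). apply Cphi.
      + intros s Hs. apply Avoid; [apply P2; assumption|]. apply NNPP. intros N.
        pose proof (HM0 s T Hs DT N). lra.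
      + rewrite P3 by assumption. apply Phi0. }
  destruct End as (T & DT & PT).
  assert (PB : 0 < phi (H 1 0)).
  { replace 0 with (T - T) at 2 by ring.
    apply (continuous_on_sign (fun w => phi (H 1 (T - w))) 0 T); [apply DT | | |].
    - intros w Hw. apply (filterlim_comp _ _ _ (fun w => H 1 (T - w)) phi _ _ _ (Ver T DT w Hw)). apply Cphi.
    - intros w Hw. assert (Dw : orth_dom (model p) (circle t) (T - w)) by (apply (Sub T); [assumption | lra]).
      apply Avoid; [apply P2; [lra | assumption] | apply (HH _ Dw)].
    - rewrite Rminus_0_r. assumption. }
  assert (RB : Re (H 1 0) = 0).
  { apply (boundary_path_0 p (fun s => H s 0)); [apply Hor, D0 | apply P4 |].
    rewrite P3 by assumption. rewrite geod_circle, exp_0; cbn [Re fst]. field. }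
  assert (CB : cover (model p) (H 1 0)) by (apply P2; [lra | assumption]).
  assert (IB := cover_im _ _ CB).
  pose proof (Far _ IB (proj1 (HH 0 D0))) as FB.
  pose proof (Between _ IB PB) as NB. unfold nsq in NB. rewrite RB in NB.
  assert (v < Im (H 1 0) < u) by nra.
  unfold chord in FB; cbn [Re Im fst snd] in FB. rewrite RB in FB.
  assert (((0 - 0) ^ 2 + (Im (H 1 0) - 1) ^ 2) / (Im (H 1 0) * 1) <= (u + 1) ^ 2 / v); [|lra].
  rewrite Rmult_1_r. apply Rle_trans with ((u + 1) ^ 2 / Im (H 1 0)).
  - apply Rmult_le_compat_r; [left; apply Rinv_0_lt_compat; lra | nra].
  - apply Rmult_le_compat_l; [nra|]. apply Rinv_le_contravar; lra.
Qed.

Lemma between_essential p t : ln (be p / al p) < t < ln (al p / ga p) -> essential_base (model p) t.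
Proof.
  intros [H1 H2]. pose proof (al_pos p) as Ha. pose proof (be_pos p) as Hbe. pose proof (ga_pos p) as Hg.
  apply exp_increasing in H1, H2. rewrite exp_ln in H1, H2 by (apply Rdiv_lt_0_compat; lra).
  exists (circle t). split.
  - split; [apply circle_orthogonal|]. destruct (circle_starts p t) as (e & He & De).
    exists e. split; [assumption|]. apply De. lra.
  - apply between_not_peripheral.
    + apply (Rmult_lt_compat_l (al p)) in H1; [|lra].
      replace (al p * (be p / al p)) with (be p) in H1 by (field; lra). assumption.
    + apply (Rmult_lt_compat_l (ga p)) in H2; [|lra].
      replace (ga p * (al p / ga p)) with (al p) in H2 by (field; lra). assumption.
Qed.

Lemma essential_between p t : essential_base (model p) t -> ln (be p / al p) <= t <= ln (al p / ga p).
Proof.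
  intros (h & O & N). apply orthojectory_circle in O. split.
  - destruct (Rle_or_lt (ln (be p / al p)) t) as [L|L]; [assumption|]. exfalso.
    apply N, (peripheral_peq _ _ _ O), backward_peripheral, L.
  - destruct (Rle_or_lt t (ln (al p / ga p))) as [L|L]; [assumption|]. exfalso.
    apply N, (peripheral_peq _ _ _ O), forward_peripheral, L.
Qed.

Lemma model_interval_lt p : ln (be p / al p) < ln (al p / ga p).
Proof.
  pose proof (al_pos p) as Ha. pose proof (be_pos p) as Hb. pose proof (ga_pos p) as Hg.
  pose proof (shape_det p). pose proof (shape_trace p). pose proof (de_pos p).
  apply ln_increasing; [apply Rdiv_lt_0_compat; lra|].
  apply (Rmult_lt_reg_r (al p * ga p)); [nra|].
  replace (be p / al p * (al p * ga p)) with (be p * ga p) by (field; lra).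
  replace (al p / ga p * (al p * ga p)) with (al p * al p) by (field; lra).
  assert (al p * (de p + 2) <= al p * al p) by (apply Rmult_le_compat_l; lra). lra.
Qed.

Lemma model_essential_interval p t1 t2 : essential_interval (model p) t1 t2 <->
  t1 = ln (be p / al p) /\ t2 = ln (al p / ga p).
Proof.
  pose proof (model_interval_lt p) as L.
  assert (Min : forall u1 u2, (forall t, essential_base (model p) t -> u1 <= t <= u2) ->
     u1 <= ln (be p / al p) /\ ln (al p / ga p) <= u2).
  { intros u1 u2 Hu. split; apply Rnot_lt_le; intros Q.
    - set (m := Rmin u1 (ln (al p / ga p))).
      assert (ln (be p / al p) < m) by (unfold m; apply Rmin_glb_lt; assumption).
      assert (m <= u1) by apply Rmin_l. assert (m <= ln (al p / ga p)) by apply Rmin_r.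
      pose proof (Hu _ (between_essential p ((ln (be p / al p) + m) / 2) ltac:(lra))). lra.
    - set (m := Rmax u2 (ln (be p / al p))).
      assert (m < ln (al p / ga p)) by (unfold m; apply Rmax_lub_lt; assumption).
      assert (u2 <= m) by apply Rmax_l. assert (ln (be p / al p) <= m) by apply Rmax_r.
      pose proof (Hu _ (between_essential p ((ln (al p / ga p) + m) / 2) ltac:(lra))). lra. }
  split.
  - intros (_ & E1 & E2). destruct (Min _ _ E1) as [A1 A2].
    destruct (E2 _ _ (essential_between p)) as [B1 B2]. split; lra.
  - intros [-> ->]. split; [lra|]. split; [apply essential_between | apply Min].
Qed.

(** The essential interval has length [2 ln al - ln (be ga)], and the strap
    term is half of [ln (be ga)]. *)
Lemma model_action p c d S : in_moduli c d (model p) ->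
  chekhov_action (model p) S <-> exp (- S) = / (half_sum c d + cosh (d / 2)).
Proof.
  intros HM. destruct (shape_half_sum p c d HM) as (Ea & _ & Ebg). rewrite <- Ea.
  pose proof (al_pos p) as Ha. pose proof (be_pos p) as Hb. pose proof (ga_pos p) as Hg.
  destruct HM as [HS _]. pose proof (cosh_pos (c / 2)) as Hc.
  assert (V : (ln (al p / ga p) - ln (be p / al p)) / 2 + ln (cosh (c / 2)) = ln (al p)).
  { rewrite !ln_div by lra.
    assert (ln (be p) + ln (ga p) = 2 * ln (cosh (c / 2))).
    { rewrite <- ln_mult, Ebg by lra. replace (cosh (c / 2) ^ 2) with (cosh (c / 2) * cosh (c / 2)) by ring.
      rewrite ln_mult by assumption. ring. }
    lra. }
  split.
  - intros (t1 & t2 & c' & E & L & ->). apply model_essential_interval in E. destruct E as [-> ->].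
    assert (c' = c) as ->.
    { apply model_strap_length in L, HS. destruct L as [L1 L2], HS as [S1 S2].
      assert (c' / 2 = c / 2); [|lra]. apply sinh_sq_inj; lra. }
    rewrite V, exp_Ropp, exp_ln by lra. reflexivity.
  - intros ES. exists (ln (be p / al p)), (ln (al p / ga p)), c.
    split; [apply model_essential_interval; split; reflexivity|]. split; [assumption|].
    rewrite V. rewrite <- (Ropp_involutive S), <- (ln_exp (- S)), ES, ln_Rinv by lra. ring.
Qed.

(** * Clipping the flipper *)

Lemma limit_nonneg K V y : 0 < y -> (forall n, 0 < n <= y -> 0 <= K * n ^ 2 + V) -> 0 <= V.
Proof.
  intros Hy H. destruct (Rle_or_lt 0 V) as [L|L]; [assumption|exfalso].
  set (n := Rmin (Rmin y 1) (- V / (2 * (Rabs K + 1)))).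
  pose proof (Rabs_pos K) as Kp.
  assert (Q : 0 < - V / (2 * (Rabs K + 1))) by (apply Rdiv_lt_0_compat; lra).
  assert (n0 : 0 < n) by (unfold n; repeat apply Rmin_glb_lt; lra).
  assert (n1 : n <= y) by (unfold n; eapply Rle_trans; [apply Rmin_l | apply Rmin_l]).
  assert (n2 : n <= 1) by (unfold n; eapply Rle_trans; [apply Rmin_l | apply Rmin_r]).
  assert (n3 : n <= - V / (2 * (Rabs K + 1))) by apply Rmin_r.
  apply (Rmult_le_compat_r (2 * (Rabs K + 1))) in n3; [|lra].
  replace (- V / (2 * (Rabs K + 1)) * (2 * (Rabs K + 1))) with (- V) in n3 by (field; lra).
  specialize (H n ltac:(lra)). pose proof (Rle_abs K).
  assert (K * n ^ 2 <= Rabs K * n ^ 2) by (apply Rmult_le_compat_r; nra).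
  assert (Rabs K * n ^ 2 <= Rabs K * n) by (apply Rmult_le_compat_l; nra).
  nra.
Qed.

Lemma right_edge_factor p z :
  right_edge p z = ga p * de p * Im z ^ 2 + (ga p * Re z + al p) * (de p * Re z + be p).
Proof. unfold right_edge, nsq. ring. Qed.

(** Going down from a point of the half-plane on the wrong side of the vertical
    line at the start of the next arch, one would stay in the half-plane, as it
    avoids the right quadrant, but leave the flipper. *)
Lemma half_plane_in_flipper p g r : 0 < de p -> 0 < r -> ga p * de p * r ^ 2 = al p * be p ->
  (forall z, right_of g z -> cover (model p) z /\ r ^ 2 < nsq z) ->
  forall z, right_of g z -> de p * Re z + be p < 0.
Proof.
  intros De Hr Er H.
  pose proof (al_pos p) as Ha. pose proof (be_pos p) as Hb. pose proof (ga_pos p) as Hg.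
  pose proof (shape_det p) as Dt.
  assert (Ar : al p < ga p * r).
  { assert (al p ^ 2 < (ga p * r) ^ 2); [|assert (0 < ga p * r) by nra; nra].
    apply (Rmult_lt_reg_l (de p)); [assumption|].
    replace (de p * (ga p * r) ^ 2) with (ga p * (ga p * de p * r ^ 2)) by ring. rewrite Er. nra. }
  destruct (side_nonpos_right g) as (A0 & _).
  { intros w Hw Rw. destruct (Rle_or_lt (side g w) 0) as [L|L]; [assumption|exfalso].
    destruct (H w) as [C _]; [apply right_of_side; split; assumption|].
    apply cover_edges in C. lra. }
  assert (Strict : forall z, right_of g z -> de p * Re z + be p <= 0).
  { intros z Hz. apply right_of_side in Hz. destruct Hz as [Iz Sz].
    destruct (Rle_or_lt (de p * Re z + be p) 0) as [L|L]; [assumption|exfalso].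
    assert (V : forall n, 0 < n <= Im z -> cover (model p) (Re z, n) /\ r ^ 2 < nsq (Re z, n)).
    { intros n Hn. apply H, right_of_side. cbn [Im snd]. split; [lra|].
      apply Rlt_le_trans with (1 := Sz). unfold side; cbn [Re Im fst snd].
      assert (n ^ 2 <= Im z ^ 2) by nra. nra. }
    assert (V1 : 0 <= (ga p * Re z + al p) * (de p * Re z + be p)).
    { apply (limit_nonneg (ga p * de p) _ (Im z) Iz). intros n Hn.
      destruct (V n Hn) as [C _]. apply cover_edges in C. destruct C as (_ & _ & C).
      rewrite right_edge_factor in C. cbn [Re Im fst snd] in C. lra. }
    assert (V2 : 0 <= Re z ^ 2 - r ^ 2).
    { apply (limit_nonneg 1 _ (Im z) Iz). intros n Hn. destruct (V n Hn) as [_ C].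
      unfold nsq in C; cbn [Re Im fst snd] in C. lra. }
    assert (V3 : Re z <= 0).
    { destruct (V (Im z) ltac:(lra)) as [C _]. apply cover_edges in C. apply C. }
    assert (ga p * Re z + al p < 0) by nra. nra. }
  intros z Hz. destruct (Rle_lt_or_eq_dec _ _ (Strict z Hz)) as [L|L]; [assumption|exfalso].
  apply right_of_side in Hz. destruct Hz as [Iz Sz].
  assert (C : forall x y, continuous (fun x : R => side g (x, y)) x).
  { intros x y. unfold side; cbn [Re Im fst snd].
    assert (Ci : continuous (fun u : R => u) x) by apply continuous_id. ct. }
  assert (P : 0 < side g (Re z, Im z)) by (destruct z; exact Sz).
  destruct (continuous_pos_locally _ _ (C _ _) P) as [eps Heps]. pose proof (cond_pos eps).
  assert (K : 0 < side g (Re z + eps / 2, Im z)).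
  { apply (Heps (Re z + eps / 2)). unfold ball; cbn. unfold AbsRing_ball, abs, minus, plus, opp; cbn.
    rewrite Rabs_pos_eq; lra. }
  assert (Q := Strict (Re z + eps / 2, Im z) ltac:(apply right_of_side; split; assumption)).
  cbn [Re fst] in Q. change (fst z) with (Re z) in Q. nra.
Qed.

Lemma clip_det p : - (be p / de p) * 0 - -1 * 1 = 1.
Proof. ring. Qed.

(** The geodesic from the end of the arch to the start of the next one. *)
Definition clip (p : shape) : SL2 := mkSL2 _ _ _ _ (clip_det p).

Lemma clip_right p z : 0 < de p -> right_of (clip p) z <-> 0 < Im z /\ de p * Re z + be p < 0.
Proof.
  intros De. rewrite right_of_side.
  assert (E : side (clip p) z = - (de p * Re z + be p) / de p).
  { unfold side; cbn [clip ma mb mc md]. field. lra. }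
  rewrite E. split; intros [Hz H]; (split; [assumption|]).
  - apply (Rmult_lt_compat_r (de p)) in H; [|assumption].
    replace (- (de p * Re z + be p) / de p * de p) with (- (de p * Re z + be p)) in H by (field; lra). lra.
  - apply Rdiv_lt_0_compat; lra.
Qed.

Lemma clip_in_flipper p r z : 0 < de p -> 0 < r -> ga p * de p * r ^ 2 = al p * be p ->
  right_of (clip p) z -> cover (model p) z /\ r ^ 2 < nsq z.
Proof.
  intros De Hr Er H. apply clip_right in H; [|assumption]. destruct H as [Iz H].
  pose proof (al_pos p) as Ha. pose proof (be_pos p) as Hb. pose proof (ga_pos p) as Hg.
  pose proof (shape_det p) as Dt.
  assert (X0 : Re z < 0) by nra.
  assert (X1 : ga p * Re z + al p < 0).
  { apply (Rmult_lt_reg_l (de p)); [assumption|]. nra. }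
  split.
  - apply cover_by_edges; [assumption | lra | |].
    + rewrite right_edge_factor.
      assert (0 <= ga p * de p * Im z ^ 2) by (apply Rmult_le_pos; nra).
      assert (0 < - (ga p * Re z + al p) * - (de p * Re z + be p)) by (apply Rmult_lt_0_compat; lra). lra.
    + unfold nsq. assert (0 < - Re z * - (ga p * Re z + al p)) by (apply Rmult_lt_0_compat; lra).
      assert (0 < ga p * Im z ^ 2) by (apply Rmult_lt_0_compat; [|apply pow_lt]; assumption). lra.
  - assert (r ^ 2 <= Re z ^ 2); [|unfold nsq; nra].
    apply (Rmult_le_reg_l (ga p * de p)); [apply Rmult_lt_0_compat; assumption|]. rewrite Er.
    assert (0 < (- (ga p * Re z) - al p) * (- (de p * Re z))) by (apply Rmult_lt_0_compat; nra).
    assert (0 < al p * (- (de p * Re z) - be p)) by (apply Rmult_lt_0_compat; lra). nra.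
Qed.

Lemma model_clip_exists p : 0 < de p -> is_clip (model p) (clip p).
Proof.
  intros De. destruct (model_strap_exists p De) as (t & l & _ & _ & Er & S).
  assert (Hr := exp_pos t). exists (circle t), 0, l. split; [assumption|].
  assert (R1 : forall z, right_of (circle t) z <-> 0 < Im z /\ exp t ^ 2 < nsq z).
  { intros z. rewrite right_of_side, circle_side. change (Re z ^ 2 + Im z ^ 2) with (nsq z).
    split; intros [Iz H]; (split; [assumption|]).
    - apply (Rmult_lt_compat_r (2 * exp t)) in H; [|lra].
      replace ((nsq z - exp t ^ 2) / (2 * exp t) * (2 * exp t)) with (nsq z - exp t ^ 2) in H by (field; lra). lra.
    - apply Rdiv_lt_0_compat; lra. }
  split.
  - intros z Hz. rewrite R1. destruct (clip_in_flipper p (exp t) z De Hr Er Hz) as [C N].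
    split; [assumption|]. split; [apply Hz | assumption].
  - intros g' Hg' z Hz. apply clip_right; [assumption|]. split; [apply Hz|].
    apply (half_plane_in_flipper p g' (exp t) De Hr Er); [|assumption].
    intros w Hw. destruct (Hg' w Hw) as [C R]. apply R1 in R. tauto.
Qed.

(** By maximality, the half-plane is the one bounded by [clip p]; this
    determines its quadratic function. *)
Lemma model_clip_unique p g : is_clip (model p) g -> 0 < de p /\
  gstart g = line_of (1, 0) /\ gend g = line_of (be p, - de p).
Proof.
  intros (h & s0 & s1 & S & K & M). destruct (model_strap p h s0 s1 S) as (De & _ & r & Hr & Er & Sh).
  split; [assumption|].
  pose proof (be_pos p) as Hb.
  assert (R1 : forall z, right_of h z <-> 0 < Im z /\ r ^ 2 < nsq z).
  { intros z. rewrite right_of_side, Sh. change (Re z ^ 2 + Im z ^ 2) with (nsq z).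
    split; intros [Iz H]; (split; [assumption|]).
    - apply (Rmult_lt_compat_r (2 * r)) in H; [|lra].
      replace ((nsq z - r ^ 2) / (2 * r) * (2 * r)) with (nsq z - r ^ 2) in H by (field; lra). lra.
    - apply Rdiv_lt_0_compat; lra. }
  assert (Same : forall z, 0 < Im z -> 0 < side g z <-> de p * Re z + be p < 0).
  { intros z Iz. split; intros H.
    - apply (half_plane_in_flipper p g r De Hr Er); [|apply right_of_side; split; assumption].
      intros w Hw. destruct (K w Hw) as [C R]. apply R1 in R. tauto.
    - apply (right_of_side g z), (M (clip p)); [|apply clip_right; [assumption | split; assumption]].
      intros w Hw. destruct (clip_in_flipper p r w De Hr Er Hw) as [C N]. rewrite R1.
      split; [assumption|]. split; [apply Hw | assumption]. }
  destruct (side_nonpos_right g) as (A0 & B0 & _).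
  { intros w Hw Rw. destruct (Rle_or_lt (side g w) 0) as [L|L]; [assumption|exfalso].
    apply (Same w Hw) in L. nra. }
  pose proof (sl2_det g) as Dg.
  (* points far up in the half-plane *)
  set (x := - (be p / de p) - 1).
  assert (Hx : de p * x + be p < 0) by (unfold x; replace (de p * (- (be p / de p) - 1) + be p) with (- de p) by (field; lra); lra).
  assert (A1 : 0 <= - (md g * mc g)).
  { destruct (Rle_or_lt 0 (- (md g * mc g))) as [L|L]; [assumption|exfalso].
    set (a := - (md g * mc g)) in *.
    set (c := (ma g * md g + mb g * mc g) * x - ma g * mb g + a * x ^ 2).
    set (y := 1 + Rabs c / - a). pose proof (Rabs_pos c) as Cp.
    assert (0 <= Rabs c / - a) by (apply Rdiv_le_0_compat; lra).
    assert (y1 : 1 <= y) by (unfold y; lra).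
    assert (Y : a * y = a - Rabs c) by (unfold y; field; lra).
    assert (Sy : 0 < side g (x, y)) by (apply Same; cbn [Re Im fst snd]; lra).
    unfold side in Sy; cbn [Re Im fst snd] in Sy. fold a in Sy.
    assert (E : a * (x ^ 2 + y ^ 2) + (ma g * md g + mb g * mc g) * x - ma g * mb g = a * y * y + c)
      by (unfold c; ring).
    rewrite E, Y in Sy. pose proof (Rle_abs c). nra. }
  assert (A2 : md g * mc g = 0) by lra.
  assert (B1 : ma g * md g + mb g * mc g = -1).
  { assert ((ma g * md g + mb g * mc g) ^ 2 = 1); [|nra].
    transitivity ((ma g * md g - mb g * mc g) ^ 2 + 4 * (ma g * mb g) * (md g * mc g)); [ring|].
    rewrite Dg, A2. ring. }
  assert (BC : mb g * mc g = -1) by lra.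
  assert (D0 : md g = 0).
  { apply Rmult_integral in A2. destruct A2 as [Z|Z]; [assumption|]. rewrite Z in BC. lra. }
  assert (Sg : forall y, side g (y, 1) = - y - ma g * mb g).
  { intros y. unfold side; cbn [Re Im fst snd]. rewrite A2, B1. ring. }
  assert (AB : de p * (ma g * mb g) = be p).
  { assert (Q1 : ~ 0 < side g (- (be p / de p), 1)).
    { rewrite Same by (cbn; lra). cbn [Re fst]. replace (de p * - (be p / de p) + be p) with 0 by (field; lra). lra. }
    rewrite Sg in Q1.
    assert (Q2 : be p / de p <= ma g * mb g) by lra.
    destruct Q2 as [Q2|Q2]; [exfalso | rewrite <- Q2; field; lra].
    set (y := - (be p / de p + ma g * mb g) / 2).
    assert (Q3 : 0 < side g (y, 1)).
    { apply Same; [cbn; lra|]. cbn [Re fst]. unfold y.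
      assert (de p * (be p / de p) < de p * (ma g * mb g)) by (apply Rmult_lt_compat_l; assumption).
      replace (de p * (be p / de p)) with (be p) in H by (field; lra).
      replace (de p * (- (be p / de p + ma g * mb g) / 2) + be p) with ((be p - de p * (ma g * mb g)) / 2) by (field; lra). lra. }
    rewrite Sg in Q3. unfold y in Q3. lra. }
  split.
  - rewrite gstart_line, line_of_eq; [unfold det2; cbn [fst snd]; rewrite D0; ring | apply col2_nonzero |].
    intros E; injection E; lra.
  - rewrite gend_line, line_of_eq; [unfold det2; cbn [fst snd] | apply col1_nonzero | intros E; injection E; lra].
    assert (mb g <> 0) by (intros Z; rewrite Z in BC; lra).
    apply (Rmult_eq_reg_l (mb g)); [|assumption].
    transitivity (- (de p * (ma g * mb g)) - be p * (mb g * mc g)); [ring|]. rewrite AB, BC. ring.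
Qed.

(** * The end of the spiralling arcs *)

(** The eigenvalue of the monodromy at the spiralling end. *)
Definition multiplier (fwd : bool) (d : R) : R := exp (if fwd then d / 2 else - (d / 2)).

(** The eigenvector for this eigenvalue. *)
Definition axis (p : shape) (fwd : bool) (d : R) : R * R := (be p, multiplier fwd d - al p).

Lemma multiplier_pos fwd d : 0 < multiplier fwd d.
Proof. apply exp_pos. Qed.

Lemma multiplier_trace p fwd d : al p - de p = 2 * cosh (d / 2) ->
  al p - de p = multiplier fwd d + / multiplier fwd d.
Proof.
  intros ->. unfold multiplier, cosh. rewrite <- exp_Ropp.
  destruct fwd; rewrite ?Ropp_involutive; field.
Qed.

Lemma axis_nonzero p fwd d : axis p fwd d <> (0, 0).
Proof. pose proof (be_pos p). intros E. injection E. lra. Qed.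

Lemma axis_eigen p fwd d : al p - de p = 2 * cosh (d / 2) ->
  act (monodromy p) (axis p fwd d)
  = (multiplier fwd d * fst (axis p fwd d), multiplier fwd d * snd (axis p fwd d)).
Proof.
  intros H. apply (multiplier_trace p fwd d) in H. pose proof (multiplier_pos fwd d) as M.
  pose proof (shape_det p) as Dt. set (m := multiplier fwd d) in *.
  unfold act, axis; cbn [monodromy ma mb mc md fst snd]. fold m. f_equal; [ring|].
  assert (E : m * m = m * (al p - de p) - 1) by (rewrite H; field; lra).
  transitivity (- (be p * ga p) - de p * (m - al p)); [ring|].
  transitivity (m * m - m * al p); [|ring]. rewrite E. lra.
Qed.

Lemma model_spiral_point p fwd d P : neck_length (model p) d ->
  spiral_point (model p) fwd P <-> P = line_of (axis p fwd d).
Proof.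
  intros N. apply model_neck_length in N. destruct N as [Hd Tr].
  pose proof (be_pos p) as Hb. pose proof (shape_det p) as Dt.
  assert (Fun : forall h l, covers_neck (model p) h l ->
    (if fwd then gend h else gstart h) = line_of (axis p fwd d)).
  { intros h l K. assert (Hl : 0 < l) by apply K.
    destruct (model_covers_neck p h l K) as (Tr' & E1 & E2).
    assert (l / 2 = d / 2) by (apply cosh_inj; lra). assert (l = d) as -> by lra.
    unfold act in E1, E2; cbn [monodromy ma mb mc md fst snd] in E1, E2.
    injection E1 as E1 _. injection E2 as E2 _.
    unfold axis, multiplier. destruct fwd.
    - rewrite gend_line. apply line_of_eq; [apply col1_nonzero | apply (axis_nonzero p true d) |].
      unfold det2; cbn [fst snd]. lra.
    - rewrite gstart_line. apply line_of_eq; [apply col2_nonzero | apply (axis_nonzero p false d) |].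
      unfold det2; cbn [fst snd]. lra. }
  split.
  - intros [[T K]|(h & l & K & ->)]; [|apply (Fun h l K)].
    apply model_cusp in T. assert (Hc : cosh (d / 2) = cosh 0) by (rewrite cosh_0; lra).
    assert (D0 : d / 2 = 0) by (apply cosh_inj; [lra | lra | assumption]).
    cbn [model hol] in K. rewrite mob_ideal_line in K. rewrite <- (line_of_vec P) in K at 2.
    apply line_of_eq in K; [|apply act_nonzero, vec_nonzero | apply vec_nonzero].
    rewrite <- (line_of_vec P). apply line_of_eq; [apply vec_nonzero | apply axis_nonzero |].
    assert (M1 : multiplier fwd d = 1).
    { unfold multiplier. rewrite D0, Ropp_0. destruct fwd; apply exp_0. }
    unfold axis. rewrite M1. set (v := vec P) in *. clearbody v. destruct v as [x y].
    unfold det2, act in *; cbn [monodromy ma mb mc md fst snd] in *.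
    assert (Q : ((al p - 1) * x + be p * y) ^ 2 = 0).
    { transitivity (be p * ((al p * x + be p * y) * y - (- ga p * x + - de p * y) * x)
        + (al p ^ 2 - 2 * al p + 1 - be p * ga p) * x ^ 2 + (al p - de p - 2) * be p * x * y); [ring|].
      rewrite K. replace (be p * ga p) with (1 + al p * de p) by lra.
      replace (de p) with (al p - 2) by lra. ring. }
    assert ((al p - 1) * x + be p * y = 0) by nra. lra.
  - intros ->. destruct Hd as [Hd| <-].
    + right. destruct (model_neck_exists p d Hd Tr) as [h Hh]. exists h, d. split; [assumption|].
      symmetry. apply (Fun h d Hh).
    + left. replace (0 / 2) with 0 in Tr by lra. rewrite cosh_0 in Tr. split; [apply model_cusp; lra|].
      cbn [model hol]. rewrite line_of_act by apply axis_nonzero.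
      rewrite axis_eigen by (replace (0 / 2) with 0 by lra; rewrite cosh_0; assumption).
      apply line_of_scale. pose proof (multiplier_pos fwd 0). lra.
Qed.

(** * Vertices of the clipped crown *)

Definition tine_vertex (p : shape) (k : Z) : R * R := act (sl2_zpow (monodromy p) k) (0, 1).

Definition flipper_vertex (p : shape) (k : Z) : R * R :=
  act (sl2_zpow (monodromy p) (k / 2)) (if Z.even k then (1, 0) else (be p, - de p)).

Lemma model_tine_vertices p V : de p = 0 ->
  clip_vertices (model p) 1 V <-> forall k, V k = line_of (tine_vertex p k).
Proof.
  intros De.
  assert (E : forall k, mob_ideal (deck (model p) k) (gstart (arch (model p))) = line_of (tine_vertex p k)).
  { intros k. cbn [model arch]. rewrite gstart_line, line_of_act by apply col2_nonzero. reflexivity. }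
  split.
  - intros [(_ & _ & H)|(H & _)]; [|discriminate]. intros k. rewrite H. apply E.
  - intros H. left. split; [reflexivity|]. split; [apply model_tine; assumption|]. intros k. rewrite H, E. reflexivity.
Qed.

Lemma even_div k : (2 * k / 2 = k)%Z /\ Z.even (2 * k) = true /\
  ((2 * k + 1) / 2 = k)%Z /\ Z.even (2 * k + 1) = false.
Proof.
  repeat split.
  - rewrite Z.mul_comm. apply Z.div_mul. lia.
  - apply Z.even_mul.
  - symmetry. apply (Z.div_unique _ _ _ 1); lia.
  - rewrite Z.even_add, Z.even_mul. reflexivity.
Qed.

Lemma clip_start_nonzero : ((1, 0) : R * R) <> (0, 0).
Proof. intros E; injection E; lra. Qed.

Lemma clip_end_nonzero p : (be p, - de p) <> (0, 0).
Proof. pose proof (be_pos p). intros E; injection E; lra. Qed.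

Lemma model_flipper_vertices p V : 0 < de p ->
  clip_vertices (model p) 2 V <-> forall k, V k = line_of (flipper_vertex p k).
Proof.
  intros De.
  assert (Gen : forall g, gstart g = line_of (1, 0) -> gend g = line_of (be p, - de p) -> forall k,
    mob_ideal (deck (model p) k) (gstart g) = line_of (flipper_vertex p (2 * k)) /\
    mob_ideal (deck (model p) k) (gend g) = line_of (flipper_vertex p (2 * k + 1))).
  { intros g -> -> k. destruct (even_div k) as (E1 & E2 & E3 & E4).
    unfold flipper_vertex. rewrite E1, E2, E3, E4.
    rewrite !line_of_act by (apply clip_start_nonzero || apply clip_end_nonzero). split; reflexivity. }
  split.
  - intros [(H & _)|(_ & g & C & H)]; [discriminate|]. apply model_clip_unique in C.
    destruct C as (_ & C1 & C2). intros k.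
    pose proof (Z.div_mod k 2 ltac:(lia)) as DM. pose proof (Z.mod_pos_bound k 2 ltac:(lia)) as B.
    destruct (Gen g C1 C2 (k / 2)%Z) as [G1 G2]. destruct (H (k / 2)%Z) as [H1 H2].
    assert (Cs : (k = 2 * (k / 2) \/ k = 2 * (k / 2) + 1)%Z) by lia.
    destruct Cs as [-> | ->]; congruence.
  - intros H. right. split; [reflexivity|]. exists (clip p). split; [apply model_clip_exists; assumption|].
    intros k. rewrite !H. destruct (model_clip_unique p _ (model_clip_exists p De)) as (_ & C1 & C2).
    destruct (Gen _ C1 C2 k) as [G1 G2]. split; congruence.
Qed.

Lemma flipper_vertex_shift p k : flipper_vertex p (k + 2) = act (monodromy p) (flipper_vertex p k).
Proof.
  unfold flipper_vertex. replace ((k + 2) / 2)%Z with (k / 2 + 1)%Z.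
  - rewrite zpow_succ, act_mul, Z.even_add. destruct (Z.even k); reflexivity.
  - replace (k + 2)%Z with (k + 1 * 2)%Z by lia. rewrite Z.div_add; lia.
Qed.

Lemma tine_vertex_succ p k : tine_vertex p (k + 1) = act (monodromy p) (tine_vertex p k).
Proof. unfold tine_vertex. rewrite zpow_succ, act_mul. reflexivity. Qed.

Lemma flipper_vertex_nonzero p k : flipper_vertex p k <> (0, 0).
Proof.
  unfold flipper_vertex. apply act_nonzero. destruct (Z.even k); [apply clip_start_nonzero | apply clip_end_nonzero].
Qed.

Lemma tine_vertex_nonzero p k : tine_vertex p k <> (0, 0).
Proof. apply act_nonzero. intros E; injection E; lra. Qed.

Lemma Z_parity_ind (P : Z -> Prop) :
  (forall k, P k <-> P (k + 2)%Z) -> P 0%Z -> P 1%Z -> forall k, P k.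
Proof.
  intros S P0 P1.
  assert (Ev : forall k, P (2 * k)%Z).
  { apply Z.bi_induction; [intros ? ? ->; reflexivity | exact P0|].
    intros k. replace (2 * Z.succ k)%Z with (2 * k + 2)%Z by lia. apply S. }
  assert (Od : forall k, P (2 * k + 1)%Z).
  { apply Z.bi_induction; [intros ? ? ->; reflexivity | exact P1|].
    intros k. replace (2 * Z.succ k + 1)%Z with (2 * k + 1 + 2)%Z by lia. apply S. }
  intros k. pose proof (Z.div_mod k 2 ltac:(lia)) as DM. pose proof (Z.mod_pos_bound k 2 ltac:(lia)) as B.
  assert (Cs : (k = 2 * (k / 2) \/ k = 2 * (k / 2) + 1)%Z) by lia.
  destruct Cs as [-> | ->]; auto.
Qed.

(** The area spanned by consecutive vertices: [de] across a flipper, [1] across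
    an arch. *)
Definition side_area (p : shape) (k : Z) : R := if Z.even k then de p else 1.

Lemma side_area_shift p k : side_area p (k + 2) = side_area p k.
Proof. unfold side_area. rewrite Z.even_add. destruct (Z.even k); reflexivity. Qed.

Lemma flipper_det_succ p k :
  det2 (flipper_vertex p k) (flipper_vertex p (k + 1)) = - side_area p k.
Proof.
  revert k. apply Z_parity_ind.
  - intros k. replace (k + 2 + 1)%Z with (k + 1 + 2)%Z by lia.
    rewrite !flipper_vertex_shift, det2_act, side_area_shift. reflexivity.
  - unfold flipper_vertex, side_area, det2, act; cbn. ring.
  - unfold flipper_vertex, side_area, det2, act.
    change (1 / 2)%Z with 0%Z. change ((1 + 1) / 2)%Z with 1%Z. rewrite zpow_1.
    change (Z.even 1) with false. change (Z.even (1 + 1)) with true.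
    cbn [sl2_zpow sl2_one monodromy ma mb mc md fst snd]. pose proof (shape_det p). lra.
Qed.

Lemma flipper_det_shift2 p k : det2 (flipper_vertex p k) (flipper_vertex p (k + 2)) <> 0.
Proof.
  revert k. apply Z_parity_ind.
  - intros k. rewrite !flipper_vertex_shift, det2_act. reflexivity.
  - pose proof (ga_pos p). rewrite flipper_vertex_shift. unfold flipper_vertex, det2, act.
    change (0 / 2)%Z with 0%Z. change (Z.even 0) with true.
    cbn [sl2_zpow sl2_one monodromy ma mb mc md fst snd]. lra.
  - pose proof (be_pos p). rewrite flipper_vertex_shift. unfold flipper_vertex, det2, act.
    change (1 / 2)%Z with 0%Z. change (Z.even 1) with false.
    cbn [sl2_zpow sl2_one monodromy ma mb mc md fst snd]. pose proof (shape_det p) as D.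
    replace ((1 * be p + 0 * - de p) * (- ga p * (1 * be p + 0 * - de p) + - de p * (0 * be p + 1 * - de p)) -
      (0 * be p + 1 * - de p) * (al p * (1 * be p + 0 * - de p) + be p * (0 * be p + 1 * - de p)))
    with (- be p * (be p * ga p - al p * de p)) by ring. rewrite D. lra.
Qed.

Lemma axis_det_shift p fwd d v : al p - de p = 2 * cosh (d / 2) ->
  det2 v (axis p fwd d) = multiplier fwd d * det2 (act (monodromy p) v) (axis p fwd d).
Proof.
  intros H. rewrite <- (det2_act (monodromy p)), axis_eigen by assumption.
  unfold det2; cbn [fst snd]. ring.
Qed.

Lemma tine_axis_det p fwd d k : al p - de p = 2 * cosh (d / 2) ->
  det2 (tine_vertex p k) (axis p fwd d) <> 0.
Proof.
  intros H. pose proof (multiplier_pos fwd d) as M. pose proof (be_pos p) as Hb. revert k. apply Z.bi_induction.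
  - intros ? ? ->. reflexivity.
  - unfold tine_vertex, det2, act, axis; cbn [sl2_zpow sl2_one ma mb mc md fst snd]. lra.
  - intros k. replace (Z.succ k) with (k + 1)%Z by lia. rewrite tine_vertex_succ.
    rewrite (axis_det_shift p fwd d (tine_vertex p k) H). split; intros Q E; apply Q.
    + rewrite E; ring.
    + apply Rmult_integral in E. destruct E; [lra | assumption].
Qed.

Lemma flipper_axis_det p fwd d k : al p - de p = 2 * cosh (d / 2) ->
  det2 (flipper_vertex p k) (axis p fwd d) <> 0.
Proof.
  intros H. pose proof (multiplier_pos fwd d) as M. pose proof (be_pos p) as Hb.
  pose proof (multiplier_trace p fwd d H) as Tr. pose proof (de_pos p) as Hd.
  assert (I : 0 < / multiplier fwd d) by (apply Rinv_0_lt_compat, M).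
  revert k. apply Z_parity_ind.
  - intros k. rewrite flipper_vertex_shift.
    rewrite (axis_det_shift p fwd d (flipper_vertex p k) H). split; intros Q E; apply Q.
    + rewrite E; ring.
    + apply Rmult_integral in E. destruct E; [lra | assumption].
  - unfold flipper_vertex, det2, act, axis.
    change (0 / 2)%Z with 0%Z. change (Z.even 0) with true.
    cbn [sl2_zpow sl2_one ma mb mc md fst snd]. lra.
  - unfold flipper_vertex, det2, act, axis.
    change (1 / 2)%Z with 0%Z. change (Z.even 1) with false.
    cbn [sl2_zpow sl2_one ma mb mc md fst snd].
    replace ((1 * be p + 0 * - de p) * (multiplier fwd d - al p) - (0 * be p + 1 * - de p) * be p)
      with (- (be p * (al p - de p - multiplier fwd d))) by ring.
    rewrite Tr. intros E. assert (0 < be p * (multiplier fwd d + / multiplier fwd d - multiplier fwd d)) by (apply Rmult_lt_0_compat; lra). lra.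
Qed.

(** * Arcs of the once-punctured monogon and bigon *)

Lemma shift_invariant N T k a b : arc_system N T -> T a b -> T (shift (k * N) a) (shift (k * N) b).
Proof.
  intros S. revert k.
  assert (E0 : forall x, shift (0 * N) x = x) by (intros [j|]; reflexivity).
  assert (ES : forall k x, shift (Z.succ k * N) x = shift N (shift (k * N) x)).
  { intros k [j|]; [|reflexivity]. unfold shift; cbn [option_map]. f_equal. lia. }
  intros k H. revert k. apply Z.bi_induction.
  - intros ? ? ->. reflexivity.
  - rewrite !E0. assumption.
  - intros k. rewrite !ES. apply (as_invariant N T S).
Qed.

(** Such an arc would cross its translate by [N]. *)
Lemma no_long_arc N T i j : (1 <= N)%Z -> arc_system N T -> T (Some i) (Some j) -> (i + N < j)%Z -> False.
Proof.
  intros HN S H L. pose proof (proj1 (as_invariant N T S _ _) H) as H'. cbn [shift option_map] in H'.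
  apply (as_noncrossing N T S _ _ _ _ H H'). left. unfold cyclic, opt_lt. lia.
Qed.

Lemma monogon_arc T a b : arc_system 1 T -> T a b ->
  exists i, (a = Some i /\ b = None) \/ (a = None /\ b = Some i).
Proof.
  intros S H. destruct (as_essential 1 T S _ _ H) as [Ne Ns]. destruct a as [i|], b as [j|].
  - exfalso. cbn in Ns. assert (i <> j) by congruence.
    destruct (Z.lt_ge_cases i j) as [L|L].
    + apply (no_long_arc 1 T i j); [lia | assumption | assumption | lia].
    + apply (no_long_arc 1 T j i); [lia | assumption | apply (as_sym 1 T S), H | lia].
  - exists i. left. split; reflexivity.
  - exists j. right. split; reflexivity.
  - congruence.
Qed.

Lemma bigon_arc T a b : arc_system 2 T -> T a b ->
  (exists i, (a = Some i /\ b = None) \/ (a = None /\ b = Some i)) \/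
  (exists i, (a = Some i /\ b = Some (i + 2)%Z) \/ (a = Some (i + 2)%Z /\ b = Some i)).
Proof.
  intros S H. destruct (as_essential 2 T S _ _ H) as [Ne Ns]. destruct a as [i|], b as [j|].
  - right. cbn in Ns. assert (i <> j) by congruence.
    destruct (Z.lt_ge_cases i j) as [L|L].
    + exists i. left. split; [reflexivity|]. f_equal.
      destruct (Z.eq_dec j (i + 2)) as [E|E]; [assumption|exfalso].
      apply (no_long_arc 2 T i j); [lia | assumption | assumption | lia].
    + exists j. right. split; [|reflexivity]. f_equal.
      destruct (Z.eq_dec i (j + 2)) as [E|E]; [assumption|exfalso].
      apply (no_long_arc 2 T j i); [lia | assumption | apply (as_sym 2 T S), H | lia].
  - left. exists i. left. split; reflexivity.
  - left. exists j. right. split; reflexivity.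
  - congruence.
Qed.

Definition cone (a b : vertex) : Prop :=
  match a, b with Some _, None => True | None, Some _ => True | _, _ => False end.

(** An arc between boundary punctures separates another one, between its ends,
    from the interior puncture. *)
Lemma cone_triangulation N : (1 <= N)%Z -> ideal_triangulation N cone.
Proof.
  intros HN. split.
  - split.
    + intros [i|] [j|]; cbn; tauto.
    + intros [i|] [j|]; cbn; tauto.
    + intros [i|] [j|]; cbn; try tauto; intros _; split; (congruence || tauto).
    + intros [i|] [j|] [k|] [l|]; cbn; try tauto; intros _ _; unfold crossing, cyclic, opt_lt; lia.
  - intros T' S Sub [i|] [j|] H; cbn; try exact I.
    + destruct (as_essential N T' S _ _ H) as [Ne Ns]. cbn in Ns. assert (i <> j) by congruence.
      destruct (Z.lt_ge_cases i j) as [L|L].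
      * apply (as_noncrossing N T' S _ _ _ _ H (Sub (Some (i + 1)%Z) None I)).
        left. unfold cyclic, opt_lt. lia.
      * apply (as_noncrossing N T' S _ _ _ _ H (Sub (Some (j + 1)%Z) None I)).
        right. unfold cyclic, opt_lt. lia.
    + destruct (as_essential N T' S _ _ H) as [Ne _]. congruence.
Qed.

(** * Shearing coordinates of a model crown *)

Lemma foot_reverse g g' x t : ma g' = mb g -> mb g' = - ma g -> mc g' = md g -> md g' = - mc g ->
  foot g x t -> foot g' x (- t).
Proof.
  intros E1 E2 E3 E4. rewrite !foot_det2, !gstart_line, !gend_line, E1, E2, E3, E4.
  replace (- ma g, - mc g) with (-1 * fst (ma g, mc g), -1 * snd (ma g, mc g)) by (cbn; f_equal; ring).
  rewrite line_of_scale by lra. intros (H1 & H2 & H3). repeat split; try assumption.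
  replace (det2 (-1 * fst (ma g, mc g), -1 * snd (ma g, mc g)) (vec x)) with (- det2 (ma g, mc g) (vec x))
    by (unfold det2; cbn [fst snd]; ring).
  rewrite Rabs_Ropp, exp_Ropp, H3. field. apply exp_pos_neq.
Qed.

Lemma reverse_det g : mb g * - mc g - - ma g * md g = 1.
Proof. rewrite <- (sl2_det g). ring. Qed.

(** Reversing an arc exchanges the two triangles and reverses the time on the
    geodesic. *)
Lemma is_shear_reverse X N T fwd a b s : is_shear X N T fwd (a, b) s -> is_shear X N T fwd (b, a) s.
Proof.
  intros (V & P & HV & HP & u & u' & K1 & K2 & K3 & K4 & K5 & K6 & g & t & t' & G1 & G2 & F1 & F2 & ->).
  exists V, P. do 2 (split; [assumption|]). exists u', u. do 6 (split; [assumption|]).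
  exists (mkSL2 _ _ _ _ (reverse_det g)), (- t'), (- t).
  split; [|split; [|split; [|split; [|ring]]]].
  - rewrite gstart_line. cbn [mb md]. rewrite <- G2, gend_line.
    rewrite <- (line_of_scale (-1) (ma g, mc g)) by lra. f_equal. cbn. f_equal; ring.
  - rewrite gend_line. cbn [ma mc]. rewrite <- G1, gstart_line. reflexivity.
  - apply (foot_reverse g); [reflexivity .. | assumption].
  - apply (foot_reverse g); [reflexivity .. | assumption].
Qed.

(** Representatives of the ideal points at the vertices of a triangulation. *)
Definition corner (v : Z -> R * R) (w : R * R) (a : vertex) : R * R :=
  match a with Some k => v k | None => w end.

Definition cross_ratio (a b u u' : R * R) : R :=
  Rabs (det2 a u' * det2 b u / (det2 a u * det2 b u')).

Lemma realise_corner v w V P a :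
  (forall k, V k = line_of (v k)) -> P = line_of w -> realise V P a = line_of (corner v w a).
Proof. intros HV ->. destruct a; cbn; auto. Qed.

Lemma corner_nonzero v w a : (forall k, v k <> (0, 0)) -> w <> (0, 0) -> corner v w a <> (0, 0).
Proof. intros Hv Hw. destruct a; cbn; auto. Qed.

Lemma ln_cross_ratio a b u u' r : 0 < r -> det2 a u <> 0 -> det2 b u' <> 0 ->
  Rabs (det2 a u' * det2 b u) = r * Rabs (det2 a u * det2 b u') ->
  ln (cross_ratio a b u u') = ln r.
Proof.
  intros Hr H1 H2 E. unfold cross_ratio. f_equal.
  assert (N : det2 a u * det2 b u' <> 0) by (apply Rmult_integral_contrapositive_currified; assumption).
  rewrite Rabs_div by assumption. rewrite E. field. apply Rabs_no_R0. assumption.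
Qed.

(** A shearing coordinate is computed from any two ideal triangles adjacent to
    the arc. *)
Lemma shear_intro p N T fwd d v a b u u' r : neck_length (model p) d ->
  (forall V, clip_vertices (model p) N V <-> forall k, V k = line_of (v k)) ->
  (forall k, v k <> (0, 0)) ->
  let c := corner v (axis p fwd d) in
  let edge x y := T x y \/ is_side x y in
  edge a u -> edge b u -> cyclic Z.lt b u a -> edge a u' -> edge b u' -> cyclic Z.lt a u' b ->
  det2 (c a) (c b) <> 0 -> det2 (c a) (c u) <> 0 -> det2 (c b) (c u) <> 0 ->
  det2 (c a) (c u') <> 0 -> det2 (c b) (c u') <> 0 -> 0 < r ->
  Rabs (det2 (c a) (c u') * det2 (c b) (c u)) = r * Rabs (det2 (c a) (c u) * det2 (c b) (c u')) ->
  is_shear (model p) N T fwd (a, b) (ln r).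
Proof.
  intros HN HV Hv c edge K1 K2 K3 K4 K5 K6 D1 D2 D3 D4 D5 Hr E.
  set (V := fun k => line_of (v k)). set (P := line_of (axis p fwd d)).
  assert (Hc : forall x, c x <> (0, 0))
    by (intros x; apply corner_nonzero; [assumption | apply axis_nonzero]).
  exists V, P. split; [apply HV; reflexivity|].
  split; [apply (model_spiral_point p fwd d P HN); reflexivity|].
  exists u, u'. do 6 (split; [assumption|]).
  rewrite !(realise_corner v (axis p fwd d) V P) by reflexivity.
  apply shear_cross_ratio; auto. symmetry. apply ln_cross_ratio; assumption.
Qed.

(** When all arcs end at the interior puncture, the two triangles at an arc are
    unique, so that it has a single shearing coordinate. *)
Lemma cone_shear p N T fwd d v k r : neck_length (model p) d ->
  (forall V, clip_vertices (model p) N V <-> forall j, V j = line_of (v j)) ->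
  (forall j, v j <> (0, 0)) -> (forall a b, T a b <-> cone a b) ->
  let w := axis p fwd d in
  (forall j, det2 (v j) w <> 0) ->
  det2 (v k) (v (k - 1)%Z) <> 0 -> det2 (v k) (v (k + 1)%Z) <> 0 -> 0 < r ->
  Rabs (det2 (v k) (v (k + 1)%Z) * det2 (v (k - 1)%Z) w)
    = r * Rabs (det2 (v k) (v (k - 1)%Z) * det2 (v (k + 1)%Z) w) ->
  forall s, is_shear (model p) N T fwd (Some k, None) s <-> s = ln r.
Proof.
  intros HN HV Hv HT w Dw Dm Dp Hr E s.
  assert (Dw' : forall j, det2 w (v j) <> 0) by (intros j; rewrite det2_anti; pose proof (Dw j); lra).
  assert (E' : Rabs (det2 (v k) (v (k + 1)%Z) * det2 w (v (k - 1)%Z))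
    = r * Rabs (det2 (v k) (v (k - 1)%Z) * det2 w (v (k + 1)%Z))).
  { rewrite Rabs_mult in *. rewrite (Rabs_mult (det2 (v k) (v (k - 1)%Z))) in *.
    rewrite !(det2_anti w), !Rabs_Ropp. exact E. }
  split.
  - intros (V & P & KV & KP & u & u' & K1 & K2 & K3 & K4 & K5 & K6 & K).
    pose proof (proj1 (HV V) KV) as KV'. apply (model_spiral_point p fwd d P HN) in KP.
    assert (Edge : forall x, (T (Some k) x \/ is_side (Some k) x) -> (T None x \/ is_side None x) ->
       x = Some (k - 1)%Z \/ x = Some (k + 1)%Z).
    { intros [j|] H1 H2; rewrite HT in *; cbn in *; [|tauto].
      destruct H1 as [[]|[-> | H1]]; [right; reflexivity | left; f_equal; lia]. }
    destruct (Edge u K1 K2) as [-> | ->]; [|exfalso; unfold cyclic, opt_lt in K3; lia].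
    destruct (Edge u' K4 K5) as [-> | ->]; [exfalso; unfold cyclic, opt_lt in K6; lia|].
    rewrite !(realise_corner v w V P) in K by assumption.
    cbn [corner] in K. apply shear_cross_ratio in K; auto; [|apply axis_nonzero].
    rewrite K. apply ln_cross_ratio; auto.
  - intros ->. apply (shear_intro p N T fwd d v _ _ (Some (k - 1)%Z) (Some (k + 1)%Z));
      rewrite ?HT; cbn [cone is_side corner]; auto; unfold cyclic, opt_lt; try lia; right; lia.
Qed.

(** ** Crowns with a tine *)

Lemma tine_cone_shear p T fwd d k : de p = 0 -> neck_length (model p) d ->
  (forall a b, T a b <-> cone a b) ->
  forall s, is_shear (model p) 1 T fwd (Some k, None) s <-> s = 2 * ln (multiplier fwd d).
Proof.
  intros De HN HT. pose proof HN as Tr. apply model_neck_length in Tr. destruct Tr as [_ Tr].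
  pose proof (be_pos p) as Hb. pose proof (multiplier_pos fwd d) as M.
  assert (Sw : forall j, det2 (tine_vertex p j) (axis p fwd d)
      = multiplier fwd d * det2 (tine_vertex p (j + 1)) (axis p fwd d)).
  { intros j. rewrite tine_vertex_succ. apply axis_det_shift. assumption. }
  assert (Ds : forall j, det2 (tine_vertex p j) (tine_vertex p (j + 1)) = - be p).
  { apply Z.bi_induction; [intros ? ? ->; reflexivity | |].
    - unfold tine_vertex. change (0 + 1)%Z with 1%Z. rewrite zpow_1. unfold det2, act.
      cbn [sl2_zpow sl2_one monodromy ma mb mc md fst snd]. ring.
    - intros j. replace (Z.succ j) with (j + 1)%Z by lia.
      rewrite !(tine_vertex_succ p (_ + 1)), (tine_vertex_succ p j), !det2_act. reflexivity. }
  assert (Dm : det2 (tine_vertex p k) (tine_vertex p (k - 1)) = be p).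
  { rewrite det2_anti. replace k with (k - 1 + 1)%Z at 2 by lia. rewrite Ds. ring. }
  replace (2 * ln (multiplier fwd d)) with (ln (multiplier fwd d * multiplier fwd d)) by (rewrite ln_mult; lra).
  apply (cone_shear p 1 T fwd d (tine_vertex p) k); auto.
  - intros V. apply model_tine_vertices. assumption.
  - intros j. apply tine_vertex_nonzero.
  - intros j. apply tine_axis_det. assumption.
  - rewrite Dm. lra.
  - rewrite Ds. lra.
  - nra.
  - rewrite Ds, Dm, (Sw (k - 1)%Z). replace (k - 1 + 1)%Z with k by lia. rewrite (Sw k).
    rewrite !Rabs_mult, Rabs_Ropp, (Rabs_pos_eq (multiplier fwd d)) by lra. ring.
Qed.

(** ** Crowns with a flipper *)

Definition parity (k : Z) : R := if Z.even k then 1 else -1.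

Lemma ln_side_area p k : 0 < de p ->
  ln (side_area p k / side_area p (k + 1)) = parity k * ln (de p) /\
  ln (side_area p k / side_area p (k - 1)) = parity k * ln (de p).
Proof.
  intros De. unfold side_area, parity. rewrite Z.even_add, Z.even_sub. change (Z.even 1) with false.
  assert (E : ln (1 / de p) = - ln (de p)) by (unfold Rdiv; rewrite Rmult_1_l; apply ln_Rinv, De).
  destruct (Z.even k); cbn [Bool.eqb]; rewrite ?E, ?Rdiv_1_r; split; ring.
Qed.

Lemma side_area_pos p k : 0 < de p -> 0 < side_area p k.
Proof. unfold side_area. destruct (Z.even k); lra. Qed.

Lemma flipper_determinants p fwd d : 0 < de p -> neck_length (model p) d ->
  (forall k, det2 (flipper_vertex p k) (axis p fwd d) <> 0) /\
  (forall k, det2 (flipper_vertex p k) (axis p fwd d)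
     = multiplier fwd d * det2 (flipper_vertex p (k + 2)) (axis p fwd d)) /\
  (forall k, det2 (flipper_vertex p k) (flipper_vertex p (k - 1)) = side_area p (k - 1)) /\
  (forall k, det2 (flipper_vertex p k) (flipper_vertex p (k - 2)) <> 0) /\
  (forall k, Rabs (det2 (flipper_vertex p k) (flipper_vertex p (k - 2)))
     = Rabs (det2 (flipper_vertex p k) (flipper_vertex p (k + 2)))).
Proof.
  intros De HN. apply model_neck_length in HN. destruct HN as [_ Tr].
  split; [intros k; apply flipper_axis_det; assumption|].
  split; [intros k; rewrite flipper_vertex_shift; apply axis_det_shift; assumption|].
  split; [|split].
  - intros k. rewrite det2_anti. replace k with (k - 1 + 1)%Z at 2 by lia. rewrite flipper_det_succ. ring.
  - intros k E. apply (flipper_det_shift2 p (k - 2)). rewrite det2_anti. replace (k - 2 + 2)%Z with k by lia. lra.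
  - intros k. rewrite det2_anti, Rabs_Ropp. rewrite <- (det2_act (monodromy p)), <- !flipper_vertex_shift.
    replace (k - 2 + 2)%Z with k by lia. reflexivity.
Qed.

(** An arc to the interior puncture, next to arcs from both neighbours. *)
Lemma flipper_cone_shear p T fwd d k : 0 < de p -> neck_length (model p) d ->
  (forall a b, T a b <-> cone a b) ->
  forall s, is_shear (model p) 2 T fwd (Some k, None) s <->
    s = parity k * ln (de p) + ln (multiplier fwd d).
Proof.
  intros De HN HT. pose proof (multiplier_pos fwd d) as M.
  destruct (flipper_determinants p fwd d De HN) as (Dw & Sw & Dm & _ & _).
  pose proof (side_area_pos p k De) as S0. pose proof (side_area_pos p (k - 1) De) as S1.
  assert (Q : 0 < side_area p k / side_area p (k - 1)) by (apply Rdiv_lt_0_compat; assumption).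
  destruct (ln_side_area p k De) as [_ <-]. rewrite <- ln_mult by assumption.
  apply (cone_shear p 2 T fwd d (flipper_vertex p) k); auto.
  - intros V. apply model_flipper_vertices. assumption.
  - intros j. apply flipper_vertex_nonzero.
  - rewrite Dm. lra.
  - rewrite flipper_det_succ. lra.
  - apply Rmult_lt_0_compat; assumption.
  - rewrite flipper_det_succ, Dm, (Sw (k - 1)%Z). replace (k - 1 + 2)%Z with (k + 1)%Z by lia.
    rewrite !Rabs_mult, Rabs_Ropp, (Rabs_pos_eq (multiplier fwd d)),
      (Rabs_pos_eq (side_area p k)), (Rabs_pos_eq (side_area p (k - 1))) by lra. field. lra.
Qed.

(** An arc to the interior puncture, enclosed in a loop. *)
Lemma flipper_enclosed_shear p T fwd d k : 0 < de p -> neck_length (model p) d ->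
  arc_system 2 T -> T (Some k) None -> T (Some k) (Some (k + 2)%Z) ->
  is_shear (model p) 2 T fwd (Some k, None) (2 * ln (multiplier fwd d)).
Proof.
  intros De HN S T1 T2. pose proof (multiplier_pos fwd d) as M.
  destruct (flipper_determinants p fwd d De HN) as (Dw & Sw & _ & Dn & De2).
  pose proof (flipper_det_shift2 p) as Ds.
  replace (2 * ln (multiplier fwd d)) with (ln (multiplier fwd d * multiplier fwd d)) by (rewrite ln_mult; lra).
  assert (A1 : T (Some (k - 2)%Z) None).
  { pose proof (shift_invariant 2 T (-1) _ _ S T1) as Q. cbn [shift option_map] in Q.
    replace (-1 * 2 + k)%Z with (k - 2)%Z in Q by lia. exact Q. }
  assert (A2 : T (Some (k + 2)%Z) None).
  { pose proof (shift_invariant 2 T 1 _ _ S T1) as Q. cbn [shift option_map] in Q.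
    replace (1 * 2 + k)%Z with (k + 2)%Z in Q by lia. exact Q. }
  assert (A3 : T (Some (k - 2)%Z) (Some k)).
  { pose proof (shift_invariant 2 T (-1) _ _ S T2) as Q. cbn [shift option_map] in Q.
    replace (-1 * 2 + k)%Z with (k - 2)%Z in Q by lia.
    replace (-1 * 2 + (k + 2))%Z with k in Q by lia. exact Q. }
  apply (shear_intro p 2 T fwd d (flipper_vertex p) _ _ (Some (k - 2)%Z) (Some (k + 2)%Z)); auto; cbn [corner].
  - intros V. apply model_flipper_vertices. assumption.
  - apply flipper_vertex_nonzero.
  - left. apply (as_sym 2 T S), A3.
  - left. apply (as_sym 2 T S), A1.
  - unfold cyclic, opt_lt. lia.
  - left. apply (as_sym 2 T S), A2.
  - unfold cyclic, opt_lt. lia.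
  - apply Dw.
  - apply Dn.
  - rewrite det2_anti. pose proof (Dw (k - 2)%Z). lra.
  - apply Ds.
  - rewrite det2_anti. pose proof (Dw (k + 2)%Z). lra.
  - nra.
  - rewrite !(det2_anti (axis p fwd d)), (Sw (k - 2)%Z). replace (k - 2 + 2)%Z with k by lia. rewrite (Sw k).
    rewrite !Rabs_mult, !Rabs_Ropp, !Rabs_mult, (De2 k), (Rabs_pos_eq (multiplier fwd d)) by lra. ring.
Qed.

Lemma flipper_loop_shear p T fwd d k : 0 < de p -> neck_length (model p) d ->
  arc_system 2 T -> T (Some k) None ->
  is_shear (model p) 2 T fwd (Some k, Some (k + 2)%Z) (parity k * ln (de p) - ln (multiplier fwd d)).
Proof.
  intros De HN S T1. pose proof (multiplier_pos fwd d) as M.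
  destruct (flipper_determinants p fwd d De HN) as (Dw & Sw & Dm & _ & _).
  pose proof (flipper_det_succ p) as Ds.
  assert (A2 : T (Some (k + 2)%Z) None).
  { pose proof (shift_invariant 2 T 1 _ _ S T1) as Q. cbn [shift option_map] in Q.
    replace (1 * 2 + k)%Z with (k + 2)%Z in Q by lia. exact Q. }
  pose proof (side_area_pos p k De) as S0. pose proof (side_area_pos p (k + 1) De) as S1.
  assert (M' : 0 < / multiplier fwd d) by (apply Rinv_0_lt_compat, M).
  replace (parity k * ln (de p) - ln (multiplier fwd d))
    with (ln (side_area p k / side_area p (k + 1) * / multiplier fwd d)).
  2:{ rewrite ln_mult, ln_Rinv by (try assumption; apply Rdiv_lt_0_compat; assumption).
      destruct (ln_side_area p k De) as [-> _]. ring. }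
  apply (shear_intro p 2 T fwd d (flipper_vertex p) _ _ None (Some (k + 1)%Z)); auto; cbn [corner is_side].
  - intros V. apply model_flipper_vertices. assumption.
  - apply flipper_vertex_nonzero.
  - unfold cyclic, opt_lt. lia.
  - right. left. reflexivity.
  - right. right. lia.
  - unfold cyclic, opt_lt. lia.
  - apply flipper_det_shift2.
  - apply Dw.
  - apply Dw.
  - rewrite Ds. lra.
  - pose proof (Dm (k + 2)%Z) as Q. replace (k + 2 - 1)%Z with (k + 1)%Z in Q by lia. rewrite Q. lra.
  - apply Rmult_lt_0_compat; [apply Rdiv_lt_0_compat|]; assumption.
  - pose proof (Dm (k + 2)%Z) as Q. replace (k + 2 - 1)%Z with (k + 1)%Z in Q by lia.
    rewrite Q, Ds, (Sw k), !Rabs_mult, Rabs_Ropp, (Rabs_pos_eq (multiplier fwd d)),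
      (Rabs_pos_eq (side_area p k)), (Rabs_pos_eq (side_area p (k + 1))) by lra.
    field. lra.
Qed.

Lemma parity_sign k : is_sign (parity k).
Proof. unfold parity, is_sign. destruct (Z.even k); tauto. Qed.

Lemma parity_eq j k : Z.even j = Z.even k -> exists m, k = (m * 2 + j)%Z.
Proof.
  intros H. exists ((k - j) / 2)%Z.
  assert (E : Z.even (k - j) = true) by (rewrite Z.even_sub, H; destruct (Z.even k); reflexivity).
  apply Z.even_spec in E. destruct E as [m Hm]. rewrite Hm, (Z.mul_comm 2), Z.div_mul; lia.
Qed.

(** There are three kinds of arcs up to isotopy and symmetry: an arc to the
    interior puncture next to another one, such an arc enclosed in a loop, and
    a loop.  In terms of [ln de] and the neck length, the two shearing
    coordinates of any triangulation have determinant [1] or [-1]. *)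
Lemma flipper_shears T fwd e1 e2 :
  ideal_triangulation 2 T -> ~ same_arc 2 e1 e2 ->
  (forall a b, T a b <-> same_arc 2 e1 (a, b) \/ same_arc 2 e2 (a, b)) ->
  exists x1 y1 x2 y2, is_sign (x1 * y2 - x2 * y1) /\
    forall p d, 0 < de p -> neck_length (model p) d ->
      is_shear (model p) 2 T fwd e1 (x1 * ln (de p) + y1 * d) /\
      is_shear (model p) 2 T fwd e2 (x2 * ln (de p) + y2 * d).
Proof.
  intros [S _] Hne HT.
  assert (Self : forall e, same_arc 2 e e).
  { intros [a b]. exists 0%Z. left. cbn [fst snd]. destruct a, b; split; reflexivity. }
  destruct e1 as [a1 b1], e2 as [a2 b2].
  assert (T1 : T a1 b1) by (apply HT; left; apply Self).
  assert (T2 : T a2 b2) by (apply HT; right; apply Self).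
  set (g := if fwd then 1 else -1).
  assert (Lm : forall d, ln (multiplier fwd d) = g * d / 2).
  { intros d. unfold multiplier, g. rewrite ln_exp. destruct fwd; lra. }
  assert (Hg : g = 1 \/ g = -1) by (unfold g; destruct fwd; tauto).
  assert (Sg : forall X a b s, is_shear X 2 T fwd (a, b) s -> is_shear X 2 T fwd (b, a) s)
    by (intros; apply is_shear_reverse; assumption).
  assert (Tr : forall i j, T (Some i) None -> Z.even i = Z.even j -> T (Some j) None).
  { intros i j H E. destruct (parity_eq i j E) as [m ->]. exact (shift_invariant 2 T m _ _ S H). }
  assert (Sy : forall a b, T a b -> T b a) by (apply (as_sym 2 T S)).
  assert (Cone : forall i j, T (Some i) None -> T (Some j) None -> Z.even i <> Z.even j ->
     forall a b, T a b <-> cone a b).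
  { intros i j Hi Hj Hij.
    assert (All : forall k, T (Some k) None).
    { intros k. destruct (Bool.bool_dec (Z.even i) (Z.even k)) as [E|E]; [apply (Tr i k Hi E)|].
      apply (Tr j k Hj). destruct (Z.even i), (Z.even j), (Z.even k); congruence. }
    intros a b. split.
    - intros H. destruct (bigon_arc T a b S H) as [(k & [[-> ->]|[-> ->]])|(k & [[-> ->]|[-> ->]])]; cbn; try exact I.
      + apply (as_noncrossing 2 T S _ _ _ _ H (All (k + 1)%Z)). left. unfold cyclic, opt_lt. lia.
      + apply (as_noncrossing 2 T S _ _ _ _ (Sy _ _ H) (All (k + 1)%Z)). left. unfold cyclic, opt_lt. lia.
    - destruct a as [i'|], b as [j'|]; cbn; try tauto; intros _; auto. }
  assert (LoopPar : forall i j, T (Some i) (Some (i + 2)%Z) -> T (Some j) None -> Z.even i = Z.even j).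
  { intros i j Hi Hj. destruct (Bool.bool_dec (Z.even i) (Z.even j)) as [E|E]; [assumption|exfalso].
    assert (Hj' : T (Some (i + 1)%Z) None).
    { apply (Tr j); [assumption|]. rewrite Z.even_add. change (Z.even 1) with false.
      destruct (Z.even i), (Z.even j); cbn; congruence. }
    apply (as_noncrossing 2 T S _ _ _ _ Hi Hj'). left. unfold cyclic, opt_lt. lia. }
  assert (CC : forall i j, T (Some i) None -> T (Some j) None -> Z.even i <> Z.even j ->
    forall p d, 0 < de p -> neck_length (model p) d ->
      is_shear (model p) 2 T fwd (Some i, None) (parity i * ln (de p) + g / 2 * d)).
  { intros i j Hi Hj Hij p d De HN. apply (flipper_cone_shear p T fwd d i De HN (Cone i j Hi Hj Hij)).
    rewrite Lm. field. }
  assert (CL : forall i j, T (Some i) None -> T (Some j) (Some (j + 2)%Z) ->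
    forall p d, 0 < de p -> neck_length (model p) d ->
      is_shear (model p) 2 T fwd (Some i, None) (0 * ln (de p) + g * d)).
  { intros i j Hi Hj p d De HN.
    replace (0 * ln (de p) + g * d) with (2 * ln (multiplier fwd d)) by (rewrite Lm; field).
    apply flipper_enclosed_shear; auto.
    destruct (parity_eq j i (LoopPar j i Hj Hi)) as [m ->].
    pose proof (shift_invariant 2 T m _ _ S Hj) as Q. cbn [shift option_map] in Q.
    replace (m * 2 + (j + 2))%Z with (m * 2 + j + 2)%Z in Q by lia. exact Q. }
  assert (LC : forall i j, T (Some i) (Some (i + 2)%Z) -> T (Some j) None ->
    forall p d, 0 < de p -> neck_length (model p) d ->
      is_shear (model p) 2 T fwd (Some i, Some (i + 2)%Z) (parity i * ln (de p) + - (g / 2) * d)).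
  { intros i j Hi Hj p d De HN.
    replace (parity i * ln (de p) + - (g / 2) * d) with (parity i * ln (de p) - ln (multiplier fwd d)) by (rewrite Lm; field).
    apply flipper_loop_shear; auto. apply (Tr j); [assumption | symmetry; apply LoopPar; assumption]. }
  assert (Shift : forall i j, Z.even i = Z.even j ->
     same_arc 2 (Some i, None) (Some j, None) /\ same_arc 2 (Some i, Some (i + 2)%Z) (Some j, Some (j + 2)%Z)).
  { intros i j E. destruct (parity_eq i j E) as [m ->]. split; exists m; left; cbn [fst snd shift option_map]; split; f_equal; lia. }
  assert (Flip : forall a b c d', same_arc 2 (a, b) (c, d') ->
     same_arc 2 (b, a) (c, d') /\ same_arc 2 (a, b) (d', c) /\ same_arc 2 (b, a) (d', c)).
  { intros a b c d' [m [[H1 H2]|[H1 H2]]]; cbn [fst snd] in *; repeat split; exists m; cbn [fst snd]; tauto. }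
  pose proof (bigon_arc T a1 b1 S T1) as B1. pose proof (bigon_arc T a2 b2 S T2) as B2.
  pose proof parity_sign as Par. unfold is_sign in Par |- *.
  destruct B1 as [(i & C1)|(i & C1)], B2 as [(j & C2)|(j & C2)].
  - assert (Hi : T (Some i) None) by (destruct C1 as [[-> ->]|[-> ->]]; auto).
    assert (Hj : T (Some j) None) by (destruct C2 as [[-> ->]|[-> ->]]; auto).
    assert (Ne : Z.even i <> Z.even j).
    { intros E. apply Hne. destruct (Shift i j E) as [Q _]. destruct (Flip _ _ _ _ Q) as (Q1 & Q2 & Q3).
      destruct C1 as [[-> ->]|[-> ->]], C2 as [[-> ->]|[-> ->]]; assumption. }
    exists (parity i), (g / 2), (parity j), (g / 2). split.
    + unfold parity. destruct (Z.even i), (Z.even j); try congruence; destruct Hg as [-> | ->]; lra.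
    + intros p d De HN. pose proof (CC i j Hi Hj Ne p d De HN). pose proof (CC j i Hj Hi (not_eq_sym Ne) p d De HN).
      destruct C1 as [[-> ->]|[-> ->]], C2 as [[-> ->]|[-> ->]]; auto.
  - assert (Hi : T (Some i) None) by (destruct C1 as [[-> ->]|[-> ->]]; auto).
    assert (Hj : T (Some j) (Some (j + 2)%Z)) by (destruct C2 as [[-> ->]|[-> ->]]; auto).
    exists 0, g, (parity j), (- (g / 2)). split.
    + destruct (Par j) as [-> | ->], Hg as [-> | ->]; lra.
    + intros p d De HN. pose proof (CL i j Hi Hj p d De HN). pose proof (LC j i Hj Hi p d De HN).
      destruct C1 as [[-> ->]|[-> ->]], C2 as [[-> ->]|[-> ->]]; auto.
  - assert (Hi : T (Some i) (Some (i + 2)%Z)) by (destruct C1 as [[-> ->]|[-> ->]]; auto).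
    assert (Hj : T (Some j) None) by (destruct C2 as [[-> ->]|[-> ->]]; auto).
    exists (parity i), (- (g / 2)), 0, g. split.
    + destruct (Par i) as [-> | ->], Hg as [-> | ->]; lra.
    + intros p d De HN. pose proof (CL j i Hj Hi p d De HN). pose proof (LC i j Hi Hj p d De HN).
      destruct C1 as [[-> ->]|[-> ->]], C2 as [[-> ->]|[-> ->]]; auto.
  - exfalso.
    assert (Hi : T (Some i) (Some (i + 2)%Z)) by (destruct C1 as [[-> ->]|[-> ->]]; auto).
    assert (Hj : T (Some j) (Some (j + 2)%Z)) by (destruct C2 as [[-> ->]|[-> ->]]; auto).
    destruct (Bool.bool_dec (Z.even i) (Z.even j)) as [E|E].
    + apply Hne. destruct (Shift i j E) as [_ Q]. destruct (Flip _ _ _ _ Q) as (Q1 & Q2 & Q3).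
      destruct C1 as [[-> ->]|[-> ->]], C2 as [[-> ->]|[-> ->]]; assumption.
    + destruct (parity_eq j (i + 1)) as [m Em].
      { rewrite Z.even_add. change (Z.even 1) with false. destruct (Z.even i), (Z.even j); cbn; congruence. }
      pose proof (shift_invariant 2 T m _ _ S Hj) as Q. cbn [shift option_map] in Q.
      apply (as_noncrossing 2 T S _ _ _ _ Hi Q). left. unfold cyclic, opt_lt. lia.
Qed.

Lemma tine_shears T fwd e : ideal_triangulation 1 T ->
  (forall a b, T a b <-> same_arc 1 e (a, b)) ->
  exists y, is_sign y /\ forall p d, de p = 0 -> neck_length (model p) d ->
    is_shear (model p) 1 T fwd e (y * d).
Proof.
  intros [S _] HT. destruct e as [a b].
  assert (T1 : T a b).
  { apply HT. exists 0%Z. left. cbn [fst snd]. destruct a, b; split; reflexivity. }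
  exists (if fwd then 1 else -1). split; [destruct fwd; [left | right]; reflexivity|].
  intros p d De HN.
  assert (Sy : forall a b, T a b -> T b a) by (apply (as_sym 1 T S)).
  destruct (monogon_arc T a b S T1) as [i Hi].
  assert (Hi' : T (Some i) None) by (destruct Hi as [[-> ->]|[-> ->]]; auto).
  assert (All : forall k, T (Some k) None).
  { intros k. pose proof (shift_invariant 1 T (k - i) _ _ S Hi') as Q. cbn [shift option_map] in Q.
    replace ((k - i) * 1 + i)%Z with k in Q by lia. exact Q. }
  assert (Cone : forall a b, T a b <-> cone a b).
  { intros x y. split.
    - intros H. destruct (monogon_arc T x y S H) as [k [[-> ->]|[-> ->]]]; exact I.
    - destruct x, y; cbn; try tauto; intros _; auto. }
  assert (Q : is_shear (model p) 1 T fwd (Some i, None) ((if fwd then 1 else -1) * d)).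
  { apply (tine_cone_shear p T fwd d i De HN Cone). unfold multiplier. rewrite ln_exp. destruct fwd; field. }
  destruct Hi as [[-> ->]|[-> ->]]; [exact Q | apply is_shear_reverse, Q].
Qed.

(** * The volume form *)

Lemma minus_plus_l {G : AbelianGroup} (x y : G) : minus (plus x y) x = y.
Proof.
  unfold minus. rewrite (plus_comm x y), <- plus_assoc.
  etransitivity; [apply f_equal, plus_opp_r | apply plus_zero_r].
Qed.

(** The one-sided derivative in the direction [u]. *)
Lemma filterdiff_direction {V : NormedModule R_AbsRing} (f : V -> R) (D : V -> Prop) x u l :
  D x -> (forall t, 0 < t -> D (plus x (scal t u))) ->
  filterdiff f (within D (locally x)) l ->
  forall eps : posreal, exists delta : posreal, forall t, 0 < t < delta ->
    Rabs (f (plus x (scal t u)) - f x - t * l u) <= eps * t.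
Proof.
  intros Dx Du [L H] eps.
  assert (Lim : is_filter_lim (within D (locally x)) x).
  { intros P HP. unfold within. revert HP. apply filter_imp. auto. }
  set (e := eps / (norm u + 1)). pose proof (norm_ge_0 u) as N0.
  assert (e0 : 0 < e) by (apply Rdiv_lt_0_compat; [apply cond_pos | lra]).
  specialize (H x Lim (mkposreal e e0)). unfold within in H.
  assert (T : filterlim (fun t : R => plus x (scal t u)) (locally 0) (locally x)).
  { assert (C : continuous (fun t : R => plus x (scal t u)) 0).
    { apply (continuous_plus (K := R_AbsRing) (fun _ : R => x) (fun t : R => scal t u)).
      - apply continuous_const.
      - apply (continuous_scal_l (K := R_AbsRing) (fun t : R => t) u). apply continuous_id. }
    unfold continuous in C. replace (plus x (scal 0 u)) with x in C; [exact C|].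
    assert (Z : scal (0 : R_AbsRing) u = zero) by exact (scal_zero_l (K := R_AbsRing) u).
    symmetry. etransitivity; [apply (f_equal (plus x)), Z | apply plus_zero_r]. }
  specialize (T _ H). destruct T as [delta Hd]. exists delta. intros t [t0 t1].
  assert (B : ball 0 delta t).
  { unfold ball; cbn. unfold AbsRing_ball, abs, minus, plus, opp; cbn. rewrite Rabs_pos_eq; lra. }
  specialize (Hd t B (Du t t0)).
  assert (E : minus (plus x (scal t u)) x = scal t u).
  { exact (minus_plus_l (G := NormedModule.AbelianGroup R_AbsRing V) x (scal t u)). }
  rewrite E in Hd. rewrite (linear_scal l L) in Hd.
  change (norm (minus (minus (f (plus x (scal t u))) (f x)) (scal t (l u)))) with
    (Rabs (f (plus x (scal t u)) - f x - t * l u)) in Hd.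
  apply Rle_trans with (1 := Hd). cbn [pos].
  apply Rle_trans with (e * (Rabs t * norm u)).
  - apply Rmult_le_compat_l; [lra|]. apply (norm_scal t u).
  - rewrite (Rabs_pos_eq t) by lra. unfold e.
    replace (eps / (norm u + 1) * (t * norm u)) with (eps * t * (norm u / (norm u + 1))) by (field; lra).
    rewrite <- (Rmult_1_r (eps * t)) at 2. pose proof (cond_pos eps).
    apply Rmult_le_compat_l; [nra|]. apply (Rmult_le_reg_r (norm u + 1)); [lra|].
    replace (norm u / (norm u + 1) * (norm u + 1)) with (norm u) by (field; lra). lra.
Qed.

(** A differential relative to a domain is determined on the directions along
    which the domain extends; at neck length [0], only half of them do. *)
Lemma filterdiff_unique {V : NormedModule R_AbsRing} (f g : V -> R) (D : V -> Prop) x u l m :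
  D x -> (forall t, 0 < t -> D (plus x (scal t u))) -> (forall y, D y -> f y = g y) ->
  filterdiff f (within D (locally x)) l -> filterdiff g (within D (locally x)) m -> l u = m u.
Proof.
  intros Dx Du E Hf Hg. apply cond_eq. intros eps Heps.
  assert (e0 : 0 < eps / 4) by lra. set (e := mkposreal _ e0).
  destruct (filterdiff_direction f D x u l Dx Du Hf e) as [d1 H1].
  destruct (filterdiff_direction g D x u m Dx Du Hg e) as [d2 H2].
  set (t := Rmin d1 d2 / 2). assert (Q : 0 < Rmin d1 d2) by (apply Rmin_glb_lt; apply cond_pos).
  pose proof (Rmin_l d1 d2). pose proof (Rmin_r d1 d2).
  assert (t0 : 0 < t) by (unfold t; lra).
  specialize (H1 t ltac:(unfold t in *; lra)). specialize (H2 t ltac:(unfold t in *; lra)).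
  rewrite !E in H1 by auto. cbn [e pos] in H1, H2.
  set (W := g (plus x (scal t u)) - g x) in *.
  assert (K : Rabs (t * l u - t * m u) <= eps / 2 * t).
  { replace (t * l u - t * m u) with ((W - t * m u) - (W - t * l u)) by ring.
    eapply Rle_trans; [apply Rabs_triang|]. rewrite Rabs_Ropp. lra. }
  rewrite <- Rmult_minus_distr_l, Rabs_mult, (Rabs_pos_eq t) in K by lra.
  apply Rle_lt_trans with (eps / 2); [|lra].
  apply (Rmult_le_reg_l t); [assumption|]. lra.
Qed.

Lemma within_proper {V : NormedModule R_AbsRing} (D : V -> Prop) x : D x ->
  ProperFilter (within D (locally x)).
Proof.
  intros Dx. split.
  - intros P HP. exists x. unfold within in HP. apply locally_singleton in HP. auto.
  - apply within_filter, locally_filter.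
Qed.

Lemma filterdiff_restrict {V : NormedModule R_AbsRing} (f : V -> R) (D : V -> Prop) x l :
  D x -> filterdiff f (locally x) l -> filterdiff f (within D (locally x)) l.
Proof.
  intros Dx H. pose proof (within_proper D x Dx) as PF.
  apply (filterdiff_locally f x l); [|assumption].
  intros P HP. unfold within. revert HP. apply filter_imp. auto.
Qed.

(** [filterdiff_ext_lin] with an equality of real numbers, accessible to
    [ring]. *)
Lemma filterdiff_ext_diff {V : NormedModule R_AbsRing} (f : V -> R) x (l m : V -> R) :
  filterdiff f (locally x) l -> (forall u, l u = m u) -> filterdiff f (locally x) m.
Proof. intros H E. exact (filterdiff_ext_lin f l m H E). Qed.

Lemma filterdiff_fst (f : R -> R) (p : R * R) l : is_derive f (fst p) l ->
  filterdiff (fun q : R * R => f (fst q)) (locally p) (fun u => l * fst u).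
Proof.
  intros H.
  assert (F : filterdiff (fun q : R * R => fst q) (locally p) (fun u : R * R => fst u))
    by (apply filterdiff_linear, is_linear_fst).
  pose proof (filterdiff_comp' (fun q : R * R => fst q) f p _ _ F H) as G.
  apply (filterdiff_ext_diff _ _ _ _ G). intros u. unfold scal; cbn. unfold mult; cbn. ring.
Qed.

Lemma filterdiff_snd (f : R -> R) (p : R * R) l : is_derive f (snd p) l ->
  filterdiff (fun q : R * R => f (snd q)) (locally p) (fun u => l * snd u).
Proof.
  intros H.
  assert (F : filterdiff (fun q : R * R => snd q) (locally p) (fun u : R * R => snd u))
    by (apply filterdiff_linear, is_linear_snd).
  pose proof (filterdiff_comp' (fun q : R * R => snd q) f p _ _ F H) as G.
  apply (filterdiff_ext_diff _ _ _ _ G). intros u. unfold scal; cbn. unfold mult; cbn. ring.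
Qed.

Lemma filterdiff_second (p : R * R) :
  filterdiff (fun q : R * R => snd q) (locally p) (fun u => 0 * fst u + 1 * snd u).
Proof.
  apply (filterdiff_ext_diff _ _ (fun u : R * R => snd u)); [apply filterdiff_linear, is_linear_snd|].
  assert (E : forall a b : R, b = 0 * a + 1 * b) by (intros; ring). intros [a b]. apply E.
Qed.

Lemma filterdiff_real (h : R -> R) (f : R * R -> R) p a b k :
  filterdiff f (locally p) (fun u => a * fst u + b * snd u) -> is_derive h (f p) k ->
  filterdiff (fun q => h (f q)) (locally p) (fun u => k * a * fst u + k * b * snd u).
Proof.
  intros F H. pose proof (filterdiff_comp' f h p _ _ F H) as G.
  apply (filterdiff_ext_diff _ _ _ _ G). intros u. unfold scal; cbn. unfold mult; cbn. ring.
Qed.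

Lemma filterdiff_combination (f g : R * R -> R) p a b a' b' x y :
  filterdiff f (locally p) (fun u => a * fst u + b * snd u) ->
  filterdiff g (locally p) (fun u => a' * fst u + b' * snd u) ->
  filterdiff (fun q => x * f q + y * g q) (locally p)
    (fun u => (x * a + y * a') * fst u + (x * b + y * b') * snd u).
Proof.
  intros F G.
  assert (C : forall n m : R_AbsRing, mult n m = mult m n) by (intros; apply Rmult_comm).
  pose proof (filterdiff_scal_r_fct (K := R_AbsRing) (V := R_NormedModule) x f _ C F) as F'.
  pose proof (filterdiff_scal_r_fct (K := R_AbsRing) (V := R_NormedModule) y g _ C G) as G'.
  pose proof (filterdiff_plus_fct _ _ _ _ F' G') as S.
  apply (filterdiff_ext_diff _ _ _ _ S). intros u. unfold plus, scal; cbn. unfold mult; cbn. ring.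
Qed.

Lemma is_derive_cosh x : is_derive cosh x (sinh x).
Proof. apply is_derive_Reals, derivable_pt_lim_cosh. Qed.

Lemma is_derive_sinh x : is_derive sinh x (cosh x).
Proof. apply is_derive_Reals, derivable_pt_lim_sinh. Qed.

Lemma is_derive_half (f : R -> R) x l : is_derive f (x / 2) l -> is_derive (fun t => f (t / 2)) x (l / 2).
Proof.
  intros H. assert (D : is_derive (fun t : R => t / 2) x (/ 2)) by (auto_derive; [exact I | field]).
  pose proof (is_derive_comp f (fun t : R => t / 2) x _ _ H D) as K.
  replace (l / 2) with (scal (/ 2) l); [exact K|]. unfold scal; cbn. unfold mult; cbn. field.
Qed.

Definition log_de (q : R * R) : R := ln (half_sum (fst q) (snd q) - cosh (snd q / 2)).

(** This is [al / (al + de)] for the crown of the given lengths. *)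
Definition weight (c d : R) : R := (half_sum c d + cosh (d / 2)) / (2 * half_sum c d).

Lemma weight_pos c d : 0 < weight c d.
Proof.
  pose proof (half_sum_pos c d). pose proof (cosh_pos (d / 2)). apply Rdiv_lt_0_compat; lra.
Qed.

Lemma log_strap_diff c d : 0 < c ->
  filterdiff (fun q : R * R => 2 * ln (sinh (fst q / 2))) (locally (c, d))
    (fun u => cosh (c / 2) / sinh (c / 2) * fst u).
Proof.
  intros Hc. apply (filterdiff_fst (fun t => 2 * ln (sinh (t / 2)))). cbn [fst].
  pose proof (sinh_pos (c / 2) ltac:(lra)) as S.
  pose proof (is_derive_half sinh c _ (is_derive_sinh (c / 2))) as D1.
  assert (D2 : is_derive (fun y => 2 * ln y) (sinh (c / 2)) (2 / sinh (c / 2)))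
    by (auto_derive; [assumption | field; lra]).
  pose proof (is_derive_comp (fun y => 2 * ln y) (fun t => sinh (t / 2)) c _ _ D2 D1) as K.
  replace (cosh (c / 2) / sinh (c / 2)) with (scal (cosh (c / 2) / 2) (2 / sinh (c / 2))); [exact K|].
  unfold scal; cbn. unfold mult; cbn. field. lra.
Qed.

(** As [de] is [sinh (c / 2) ^ 2 / al] and [al + de] is twice [half_sum], the
    logarithm of [de] varies [weight] times as fast as [2 ln (sinh (c / 2))] in
    the strap direction. *)
Lemma log_de_diff c d : 0 < c -> exists m,
  filterdiff log_de (locally (c, d))
    (fun u => weight c d * (cosh (c / 2) / sinh (c / 2)) * fst u + m * snd u).
Proof.
  intros Hc. pose proof (sinh_pos (c / 2) ltac:(lra)) as S.
  pose proof (half_sum_pos c d) as Q0. pose proof (half_sum_gt c d Hc) as Q1.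
  pose proof (half_sum_sq c d) as Q2. pose proof (cosh_pos (d / 2)) as C0.
  pose proof (cosh_sinh_sq (c / 2)) as Id1. pose proof (cosh_sinh_sq (d / 2)) as Id2.
  assert (Sq : forall (f : R -> R) x l, is_derive f x l -> is_derive (fun t => f t ^ 2) x (2 * f x * l)).
  { intros f x l H.
    assert (D : is_derive (fun y : R => y ^ 2) (f x) (2 * f x)) by (auto_derive; [exact I | ring]).
    pose proof (is_derive_comp (fun y => y ^ 2) f x _ _ D H) as K.
    replace (2 * f x * l) with (scal l (2 * f x)); [exact K|]. unfold scal; cbn. unfold mult; cbn. ring. }
  pose proof (Sq _ c _ (is_derive_half cosh c _ (is_derive_cosh (c / 2)))) as A1. cbv beta in A1.
  pose proof (Sq _ d _ (is_derive_half sinh d _ (is_derive_sinh (d / 2)))) as A2. cbv beta in A2.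
  pose proof (is_derive_half cosh d _ (is_derive_cosh (d / 2))) as A3. cbv beta in A3.
  pose proof (filterdiff_fst (fun t => cosh (t / 2) ^ 2) (c, d) _ A1) as B1.
  pose proof (filterdiff_snd (fun t => sinh (t / 2) ^ 2) (c, d) _ A2) as B2.
  pose proof (filterdiff_snd (fun t => cosh (t / 2)) (c, d) _ A3) as B3.
  set (a1 := 2 * cosh (c / 2) * (sinh (c / 2) / 2)) in *.
  set (a2 := 2 * sinh (d / 2) * (cosh (d / 2) / 2)) in *. set (a3 := sinh (d / 2) / 2) in *.
  assert (B1' : filterdiff (fun q : R * R => cosh (fst q / 2) ^ 2) (locally (c, d)) (fun u => a1 * fst u + 0 * snd u)).
  { apply (filterdiff_ext_diff _ _ _ _ B1). intros u. ring. }
  assert (B2' : filterdiff (fun q : R * R => sinh (snd q / 2) ^ 2) (locally (c, d)) (fun u => 0 * fst u + a2 * snd u)).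
  { apply (filterdiff_ext_diff _ _ _ _ B2). intros u. ring. }
  assert (B3' : filterdiff (fun q : R * R => cosh (snd q / 2)) (locally (c, d)) (fun u => 0 * fst u + a3 * snd u)).
  { apply (filterdiff_ext_diff _ _ _ _ B3). intros u. ring. }
  pose proof (filterdiff_combination _ _ (c, d) _ _ _ _ 1 1 B1' B2') as C1.
  assert (Dq : is_derive sqrt (1 * cosh (fst (c, d) / 2) ^ 2 + 1 * sinh (snd (c, d) / 2) ^ 2) (/ (2 * half_sum c d))).
  { cbn [fst snd]. rewrite !Rmult_1_l. rewrite <- Q2.
    assert (P : 0 < half_sum c d ^ 2) by (apply pow_lt; assumption).
    auto_derive; [assumption|]. rewrite sqrt_pow2 by lra. field. lra. }
  pose proof (filterdiff_real sqrt _ (c, d) _ _ _ C1 Dq) as C2.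
  pose proof (filterdiff_combination _ _ (c, d) _ _ _ _ 1 (-1) C2 B3') as C3.
  assert (Dl : is_derive ln (1 * sqrt (1 * cosh (fst (c, d) / 2) ^ 2 + 1 * sinh (snd (c, d) / 2) ^ 2) + -1 * cosh (snd (c, d) / 2))
     (/ (half_sum c d - cosh (d / 2)))).
  { cbn [fst snd]. rewrite !Rmult_1_l. fold (half_sum c d).
    replace (half_sum c d + -1 * cosh (d / 2)) with (half_sum c d - cosh (d / 2)) by ring.
    auto_derive; [lra | field; lra]. }
  pose proof (filterdiff_real ln _ (c, d) _ _ _ C3 Dl) as C4. cbv beta in C4.
  eexists. refine (filterdiff_ext _ log_de _ _ (filterdiff_ext_diff _ _ _ _ C4 _)).
  - intros [x y]. unfold log_de, half_sum; cbn [fst snd]. rewrite !Rmult_1_l. f_equal. ring.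
  - intros u. f_equal.
    f_equal. unfold weight, a1.
    assert (E : (half_sum c d + cosh (d / 2)) * (half_sum c d - cosh (d / 2)) = sinh (c / 2) ^ 2).
    { transitivity (half_sum c d ^ 2 - cosh (d / 2) ^ 2); [ring|]. rewrite Q2, Id1, Id2. ring. }
    assert (E' : / (half_sum c d - cosh (d / 2)) = (half_sum c d + cosh (d / 2)) / sinh (c / 2) ^ 2).
    { rewrite <- E. field. lra. }
    rewrite E'. field. lra.
Qed.

(** By invariance and [normal_form], shears are functions of the lengths. *)
Lemma crown_shears T fwd e1 e2 : ideal_triangulation 2 T -> ~ same_arc 2 e1 e2 ->
  (forall a b, T a b <-> same_arc 2 e1 (a, b) \/ same_arc 2 e2 (a, b)) ->
  exists x1 y1 x2 y2, is_sign (x1 * y2 - x2 * y1) /\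
    forall q X, domain2 q -> in_moduli (fst q) (snd q) X ->
      is_shear X 2 T fwd e1 (x1 * log_de q + y1 * snd q) /\
      is_shear X 2 T fwd e2 (x2 * log_de q + y2 * snd q).
Proof.
  intros HT Hne HT'. destruct (flipper_shears T fwd e1 e2 HT Hne HT') as (x1 & y1 & x2 & y2 & Hs & K).
  exists x1, y1, x2, y2. split; [assumption|]. intros [c d] X [Hc Hd] HX; cbn [fst snd] in *.
  destruct (normal_form X) as [p Hp].
  pose proof (chart_in_moduli _ _ _ _ _ (chart_sym _ _ _ Hp) HX) as HM.
  destruct (shape_half_sum p c d HM) as (_ & Ede & _).
  pose proof (half_sum_gt c d Hc) as Q.
  destruct (K p d ltac:(lra) (proj2 HM)) as [K1 K2]. rewrite Ede in K1, K2.
  split; apply (chart_shear _ _ _ _ _ _ _ _ Hp); assumption.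
Qed.

(** Up to sign, the wedge product of the shearing coordinates is that of the
    differentials of [log_de] and of the neck length. *)
Lemma wp_flipper_exists c d : 0 < c -> 0 <= d -> wp_flipper c d (weight c d).
Proof.
  intros Hc Hd T fwd e1 e2 HT Hne HT'.
  destruct (crown_shears T fwd e1 e2 HT Hne HT') as (x1 & y1 & x2 & y2 & Hs & K).
  destruct (log_de_diff c d Hc) as [m Dm].
  assert (Dx : domain2 (c, d)) by (split; assumption).
  pose proof (filterdiff_second (c, d)) as Ds.
  pose proof (filterdiff_restrict _ domain2 _ _ Dx (filterdiff_combination _ _ _ _ _ _ _ x1 y1 Dm Ds)) as D1.
  pose proof (filterdiff_restrict _ domain2 _ _ Dx (filterdiff_combination _ _ _ _ _ _ _ x2 y2 Dm Ds)) as D2.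
  pose proof (filterdiff_restrict _ domain2 _ _ Dx (log_strap_diff c d Hc)) as Dk.
  exists (fun q => x1 * log_de q + y1 * snd q), (fun q => x2 * log_de q + y2 * snd q).
  eexists. eexists. eexists. exists (fun u => weight c d * snd u), (x1 * y2 - x2 * y1), 1.
  split; [|split; [exact D1 | split; [exact D2 | split; [exact Dk | split]]]].
  - intros q X Hq HX. apply K; assumption.
  - apply (is_linear_comp (fun u : R * R => snd u) (fun t : R => weight c d * t)).
    + apply is_linear_snd.
    + apply (is_linear_scal_r (K := R_AbsRing) (V := R_NormedModule) (weight c d)). intros; apply Rmult_comm.
  - split; [assumption|]. split; [left; reflexivity|]. split.
    + intros [a b] [a' b']. unfold wedge; cbn [fst snd]. ring.
    + intros [a b] _. cbn [snd]. ring.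
Qed.

(** One triangulation, with both arcs ending at the interior puncture, is
    enough to determine the form. *)
Lemma wp_flipper_unique c d w : 0 < c -> 0 <= d -> 0 < w -> wp_flipper c d w -> w = weight c d.
Proof.
  intros Hc Hd Hw H.
  assert (Hne : ~ same_arc 2 (Some 0%Z, None) (Some 1%Z, None)).
  { intros [k [[E _]|[_ E]]]; cbn [fst snd shift option_map] in E; [injection E as E; lia | discriminate]. }
  assert (HT : forall a b, cone a b <-> same_arc 2 (Some 0%Z, None) (a, b) \/ same_arc 2 (Some 1%Z, None) (a, b)).
  { intros a b. split.
    - intros Hc'. destruct a as [i|], b as [j|]; cbn in Hc'; try tauto.
      + destruct (Bool.bool_dec (Z.even 0) (Z.even i)) as [E|E].
        * left. destruct (parity_eq _ _ E) as [k ->]. exists k. left. cbn. split; reflexivity.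
        * right. assert (E' : Z.even 1 = Z.even i) by (cbn in *; destruct (Z.even i); congruence).
          destruct (parity_eq _ _ E') as [k ->]. exists k. left. split; reflexivity.
      + destruct (Bool.bool_dec (Z.even 0) (Z.even j)) as [E|E].
        * left. destruct (parity_eq _ _ E) as [k ->]. exists k. right. cbn. split; reflexivity.
        * right. assert (E' : Z.even 1 = Z.even j) by (cbn in *; destruct (Z.even j); congruence).
          destruct (parity_eq _ _ E') as [k ->]. exists k. right. split; reflexivity.
    - intros [[k [[E1 E2]|[E1 E2]]]|[k [[E1 E2]|[E1 E2]]]]; cbn in E1, E2; subst; exact I. }
  destruct (H cone true _ _ (cone_triangulation 2 ltac:(lia)) Hne HT)
    as (f1 & f2 & df1 & df2 & dk & omega & eps & eps' & K & D1 & D2 & Dk & Lo & He & He' & W & Om).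
  assert (Val : forall q, domain2 q -> f1 q = 1 * log_de q + (1 / 2) * snd q /\ f2 q = -1 * log_de q + (1 / 2) * snd q).
  { intros [x y] Hq. assert (HM := canonical_in_moduli x y ltac:(left; apply Hq) (proj2 Hq)).
    destruct (K (x, y) _ Hq HM) as [K1 K2]. cbn [fst snd] in *.
    pose proof (half_sum_gt x y (proj1 Hq)) as Q.
    assert (De : 0 < de (canonical x y)) by (cbn [canonical de]; lra).
    apply (flipper_cone_shear _ cone true y 0 De (proj2 HM) ltac:(tauto)) in K1.
    apply (flipper_cone_shear _ cone true y 1 De (proj2 HM) ltac:(tauto)) in K2.
    rewrite K1, K2. unfold log_de, multiplier. rewrite ln_exp. cbn [canonical de fst snd].
    unfold parity; cbn [Z.even]. split; field. }
  destruct (log_de_diff c d Hc) as [m Dm].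
  assert (Dx : domain2 (c, d)) by (split; assumption).
  pose proof (filterdiff_second (c, d)) as Ds.
  pose proof (filterdiff_restrict _ domain2 _ _ Dx (filterdiff_combination _ _ _ _ _ _ _ 1 (1 / 2) Dm Ds)) as G1.
  pose proof (filterdiff_restrict _ domain2 _ _ Dx (filterdiff_combination _ _ _ _ _ _ _ (-1) (1 / 2) Dm Ds)) as G2.
  pose proof (filterdiff_restrict _ domain2 _ _ Dx (log_strap_diff c d Hc)) as Gk.
  assert (Dir : forall a b : R, 0 <= a -> 0 <= b -> forall t : R, 0 < t ->
     domain2 (plus (c, d) (scal t ((a, b) : R * R)))).
  { intros a b Ha Hb t Ht. unfold domain2, plus, scal; cbn. unfold mult; cbn. split; nra. }
  assert (Uq : forall (f g l l' : R * R -> R) (a b : R), 0 <= a -> 0 <= b -> (forall q, domain2 q -> f q = g q) ->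
     filterdiff f (within domain2 (locally (c, d))) l -> filterdiff g (within domain2 (locally (c, d))) l' ->
     l (a, b) = l' (a, b)).
  { intros f g l l' a b Ha Hb Hfg Hf Hg.
    exact (filterdiff_unique f g domain2 (c, d) (a, b) l l' Dx (Dir a b Ha Hb) Hfg Hf Hg). }
  pose proof (Uq _ _ _ _ 1 0 ltac:(lra) ltac:(lra) (fun q Hq => proj1 (Val q Hq)) D1 G1) as P1.
  pose proof (Uq _ _ _ _ 0 1 ltac:(lra) ltac:(lra) (fun q Hq => proj1 (Val q Hq)) D1 G1) as P2.
  pose proof (Uq _ _ _ _ 1 0 ltac:(lra) ltac:(lra) (fun q Hq => proj2 (Val q Hq)) D2 G2) as P3.
  pose proof (Uq _ _ _ _ 0 1 ltac:(lra) ltac:(lra) (fun q Hq => proj2 (Val q Hq)) D2 G2) as P4.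
  pose proof (Uq _ _ _ _ 1 0 ltac:(lra) ltac:(lra) (fun q _ => eq_refl) Dk Gk) as P5.
  pose proof (Uq _ _ _ _ 0 1 ltac:(lra) ltac:(lra) (fun q _ => eq_refl) Dk Gk) as P6.
  cbn [fst snd] in P1, P2, P3, P4, P5, P6. rewrite Rmult_0_r in P6.
  pose proof (Om _ P6) as P7. cbn [snd] in P7.
  specialize (W (1, 0) (0, 1)). unfold wedge in W. rewrite P1, P2, P3, P4, P5, P6, P7 in W.
  pose proof (sinh_pos (c / 2) ltac:(lra)) as S. pose proof (cosh_pos (c / 2)) as C.
  pose proof (weight_pos c d) as Wp.
  set (k := cosh (c / 2) / sinh (c / 2)) in *. assert (k0 : 0 < k) by (apply Rdiv_lt_0_compat; assumption).
  assert (E : weight c d * k = eps * eps' * (w * k)) by lra.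
  assert (E' : weight c d = eps * eps' * w) by (apply (Rmult_eq_reg_r k); lra).
  destruct He as [-> | ->], He' as [-> | ->]; lra.
Qed.

(** The only shearing coordinate of a crown with a tine is plus or minus the
    neck length. *)
Lemma wp_tine_iff d w : 0 <= d -> 0 < w -> wp_tine d w <-> w = 1.
Proof.
  intros Hd Hw.
  assert (Gen : forall T fwd e y,
    (forall p d, de p = 0 -> neck_length (model p) d -> is_shear (model p) 1 T fwd e (y * d)) ->
    forall d' X, domain1 d' -> in_moduli 0 d' X -> is_shear X 1 T fwd e (y * d')).
  { intros T fwd e y K d' X Hd' HX. destruct (normal_form X) as [p Hp].
    pose proof (chart_in_moduli _ _ _ _ _ (chart_sym _ _ _ Hp) HX) as HM.
    apply (chart_shear _ _ _ _ _ _ _ _ Hp), K; [|apply HM].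
    destruct HM as [HM _]. apply model_strap_length in HM. destruct HM as [_ HM].
    replace (0 / 2) with 0 in HM by lra. rewrite sinh_0 in HM. pose proof (al_pos p).
    assert (Z : al p * de p = 0) by (rewrite <- HM; ring). apply Rmult_integral in Z. destruct Z; lra. }
  assert (Lin : forall y : R, filterdiff (fun t : R => y * t) (within domain1 (locally d)) (fun t : R => y * t)).
  { intros y. apply filterdiff_linear.
    apply (is_linear_scal_r (K := R_AbsRing) (V := R_NormedModule) y). intros; apply Rmult_comm. }
  split.
  - intros H.
    assert (HT : forall a b, cone a b <-> same_arc 1 (Some 0%Z, None) (a, b)).
    { intros a b. split.
      - intros Hc. destruct a as [i|], b as [j|]; cbn in Hc; try tauto.
        + exists i. left. cbn [fst snd shift option_map]. split; f_equal; lia.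
        + exists j. right. cbn [fst snd shift option_map]. split; f_equal; lia.
      - intros [k [[E1 E2]|[E1 E2]]]; cbn in E1, E2; subst; exact I. }
    destruct (H cone true _ (cone_triangulation 1 ltac:(lia)) HT) as (f & df & eps & K & D & He & E).
    assert (Val : forall y, domain1 y -> f y = 1 * y).
    { intros y Hy. assert (HM := canonical_in_moduli 0 y (Rle_refl 0) Hy).
      specialize (K y _ Hy HM). destruct HM as [HM1 HM2]. apply model_strap_length in HM1.
      destruct HM1 as [_ HM1]. replace (0 / 2) with 0 in HM1 by lra. rewrite sinh_0 in HM1.
      pose proof (al_pos (canonical 0 y)).
      assert (Z : de (canonical 0 y) = 0).
      { assert (Z : al (canonical 0 y) * de (canonical 0 y) = 0) by (rewrite <- HM1; ring).
        apply Rmult_integral in Z. destruct Z; lra. }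
      apply (tine_cone_shear _ cone true y 0 Z HM2 ltac:(tauto)) in K. rewrite K.
      unfold multiplier. rewrite ln_exp. field. }
    assert (P : df 1 = 1 * 1).
    { apply (filterdiff_unique (V := R_NormedModule) f (fun y => 1 * y) domain1 d 1 df (fun y => 1 * y)).
      - exact Hd.
      - intros t Ht. unfold domain1, plus, scal; cbn. unfold mult; cbn. unfold domain1 in *. lra.
      - exact Val.
      - exact D.
      - apply Lin. }
    rewrite E in P. destruct He as [-> | ->]; lra.
  - intros ->. intros T fwd e HT HT'. destruct (tine_shears T fwd e HT HT') as (y & Hy & K).
    exists (fun t => y * t), (fun t => y * t), y.
    split; [apply Gen, K|]. split; [apply Lin|]. split; [assumption|]. intros u. ring.
Qed.

Lemma weight_0 d : weight 0 d = 1.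
Proof.
  unfold weight. pose proof (half_sum_pos 0 d) as P. pose proof (half_sum_sq 0 d) as Q.
  replace (0 / 2) with 0 in Q by lra. rewrite cosh_0 in Q. pose proof (cosh_sinh_sq (d / 2)).
  pose proof (cosh_pos (d / 2)).
  assert (half_sum 0 d = cosh (d / 2)) as -> by nra. field. lra.
Qed.

Lemma wp_form_iff c d w : 0 <= c -> 0 <= d -> wp_form c d w <-> w = weight c d.
Proof.
  intros Hc Hd. split.
  - intros (Hw & H0 & H1). destruct Hc as [Hc| <-].
    + apply wp_flipper_unique; auto.
    + rewrite weight_0. apply (wp_tine_iff d w Hd Hw), H0. reflexivity.
  - intros ->. split; [apply weight_pos|]. split.
    + intros ->. apply wp_tine_iff; [assumption | apply weight_pos | apply weight_0].
    + intros Hc'. apply wp_flipper_exists; assumption.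
Qed.

Lemma volume_value c d : / (half_sum c d + cosh (d / 2)) * weight c d = 1 / sqrt (2 * cosh c + 2 * cosh d).
Proof.
  pose proof (half_sum_pos c d) as P. pose proof (cosh_pos (d / 2)) as C.
  assert (E : 2 * cosh c + 2 * cosh d = (2 * half_sum c d) ^ 2).
  { rewrite Rpow_mult_distr, half_sum_sq.
    assert (Dbl : forall x, cosh x = 2 * cosh (x / 2) ^ 2 - 1).
    { intros x. unfold cosh. rewrite <- (exp_half x).
      replace (- x) with (- (x / 2) + - (x / 2)) by lra. rewrite exp_plus.
      assert (I : exp (x / 2) * exp (- (x / 2)) = 1) by apply exp_mul_opp.
      set (X := exp (x / 2)) in *. set (Y := exp (- (x / 2))) in *. clearbody X Y. nra. }
    rewrite (Dbl c), (Dbl d), cosh_sinh_sq. pose proof (cosh_sinh_sq (c / 2)). pose proof (cosh_sinh_sq (d / 2)). lra. }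
  rewrite E, sqrt_pow2 by lra. unfold weight. field. lra.
Qed.

Theorem theorem5p2 (c d : R) (hc : 0 <= c) (hd : 0 <= d) :
  forall v : R, is_volume c d v <-> v = 1 / sqrt (2 * cosh c + 2 * cosh d).
Proof.
  intros v. rewrite <- volume_value. split.
  - intros (X & S & w & HX & _ & HS & Hw & ->).
    apply wp_form_iff in Hw; [|assumption ..]. rewrite Hw. f_equal.
    destruct (normal_form X) as [p Hp]. apply chart_sym in Hp.
    apply (model_action p c d S (chart_in_moduli _ _ _ _ _ Hp HX)), (chart_action _ _ _ _ Hp HS).
  - intros ->. pose proof (canonical_in_moduli c d hc hd) as HM.
    pose proof (half_sum_pos c d) as P. pose proof (cosh_pos (d / 2)) as C.
    assert (I : 0 < / (half_sum c d + cosh (d / 2))) by (apply Rinv_0_lt_compat; lra).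
    exists (model (canonical c d)), (- ln (/ (half_sum c d + cosh (d / 2)))), (weight c d).
    split; [assumption|]. split; [intros Y HY; apply (moduli_point c d); assumption|].
    split; [|split; [apply wp_form_iff; auto|]].
    + apply (model_action _ c d); [assumption|]. rewrite Ropp_involutive. apply exp_ln, I.
    + rewrite Ropp_involutive, exp_ln by assumption. reflexivity.
Qed.
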